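(* Let $(a,b,c)$ satisfy the standing conditions. For all $\epsilon,\delta>0$ there exists $\varepsilon_0>0$ such that every global solution $(u,\eta)\in C(\mathbb R,(H^1\times H^1)(\mathbb R))$ of the $abcd$ system with $\|(u,\eta)(0)\|_{H^1\times H^1}<\varepsilon_0$ satisfies $$\lim_{t\to\pm\infty}\|(u,\eta)(t)\|_{(H^1\times H^1)(I(t))}=0,\qquad I(t)=(-\infty,-(3+\epsilon)|t|)\cup((3+\delta)|t|,\infty).$$ Moreover, if $a=c=\frac16-b$, the same holds with $I(t)=(-\infty,-(2+\epsilon)|t|)\cup((2+\delta)|t|,\infty)$. In particular, there are no small solitary waves of speed greater than $3$, and, if $a=c$, none of speed greater than $2$: for every $s>3$ (respectively $s>2$ if $a=c$) there is $\varepsilon_0>0$ such that no nonzero solution $(u,\eta)(t,x)=(U,N)(x-\omega t)$ with $|\omega|\ge s$ and $\|(U,N)\|_{H^1\times H^1}<\varepsilon_0$ exists.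
   Context: The Hamiltonian $abcd$ system (with $b=d$) is $$(1-b\partial_x^2)\partial_t\eta+\partial_x(a\,\partial_x^2u+u+u\eta)=0,\qquad (1-b\partial_x^2)\partial_tu+\partial_x\big(c\,\partial_x^2\eta+\eta+\tfrac12u^2\big)=0,\qquad (t,x)\in\mathbb R\times\mathbb R,$$ with real-valued $u,\eta$. Standing conditions: $b=d>0$, $a,c<0$, and $a+b=\frac12(\theta^2-\frac13)$, $c+b=\frac12(1-\theta^2)$ for some $\theta\in[0,1]$. $\|(u,\eta)\|_{(H^1\times H^1)(I)}^2=\int_I(u^2+u_x^2+\eta^2+\eta_x^2)\,dx$ (up to equivalent norm). *)

(* Defs.v *)
From HB Require Import structures.
From mathcomp Require Import all_boot all_order all_algebra.
From mathcomp Require Import all_classical all_reals all_analysis.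
Set Implicit Arguments.
Unset Strict Implicit.
Unset Printing Implicit Defensive.
Import Order.TTheory GRing.Theory Num.Theory.
Import numFieldNormedType.Exports.
Local Open Scope ring_scope.
Local Open Scope classical_set_scope.

Section Sobolev.
Context {R : realType}.
Local Notation mu := (@lebesgue_measure R).
Implicit Types f g phi : R -> R.

Definition test_function phi : Prop :=
  (forall n x, derivable (phi^`(n)) x 1) /\
  compact (closure [set x | phi x != 0]).

Definition L2_weak_derivative f g : Prop :=
  g \in Lfun mu 2%:E /\
  forall phi, test_function phi ->
    \int[mu]_x (f x * phi^`()%classic x) = - \int[mu]_x (g x * phi x).

Definition H1 f : Prop :=
  f \in Lfun mu 2%:E /\ exists g, L2_weak_derivative f g.

(* A representative of the weak derivative, which is unique up to a null set;
   meaningful when [H1 f] holds. *)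
Definition wderiv f : R -> R := xget (cst 0) [set g | L2_weak_derivative f g].

(* The norm of (H^1 x H^1)(I), for f and g in H^1(R) and I open: the weak
   derivative of a restriction to I is the restriction of the weak derivative. *)
Definition H1xH1_norm (I : set R) f g : R :=
  Num.sqrt (\int[mu]_(x in I)
    (f x ^+ 2 + wderiv f x ^+ 2 + g x ^+ 2 + wderiv g x ^+ 2)).

End Sobolev.

Section SpaceTime.
Context {R : realType}.

(* Functions of space-time take the time t first and the position x second. *)
Definition dt (phi : R -> R -> R) : R -> R -> R := fun t x => (phi^~ x)^`() t.
Definition dx (phi : R -> R -> R) : R -> R -> R := fun t x => (phi t)^`() x.

Fixpoint Ck (k : nat) (phi : R -> R -> R) : Prop :=
  continuous (fun p : R * R => phi p.1 p.2) /\
  if k is k'.+1 then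
    [/\ forall t x, derivable (phi^~ x) t 1,
        forall t x, derivable (phi t) x 1,
        Ck k' (dt phi) & Ck k' (dx phi)]
  else True.

Definition test_function2 (phi : R -> R -> R) : Prop :=
  (forall k, Ck k phi) /\
  compact (closure [set p : R * R | phi p.1 p.2 != 0]).

End SpaceTime.

Section ABCD.
Context {R : realType}.
Local Notation mu := (@lebesgue_measure R).
Implicit Types (a b c : R) (u eta : R -> R -> R).

Definition abcd_conditions a b c : Prop :=
  [/\ 0 < b, a < 0, c < 0 &
    exists theta, [/\ 0 <= theta <= 1,
      a + b = 2^-1 * (theta ^+ 2 - 3^-1) &
      c + b = 2^-1 * (1 - theta ^+ 2)]].

Definition C_H1xH1 u eta : Prop :=
  (forall t, H1 (u t) /\ H1 (eta t)) /\
  forall t, H1xH1_norm setT (fun x => u s x - u t x)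
                            (fun x => eta s x - eta t x) @[s --> t] --> 0.

(* The system in the sense of distributions on R x R, all derivatives being
   moved to the test function. The integrals are iterated, since u and eta are
   given by representatives chosen separately at each time, which need not be
   jointly measurable. *)
Definition abcd_equations a b c u eta : Prop :=
  forall phi, test_function2 phi ->
    \int[mu]_t (\int[mu]_x
      (eta t x * (dt phi t x - b * dx (dx (dt phi)) t x)
       + a * u t x * dx (dx (dx phi)) t x
       + (u t x + u t x * eta t x) * dx phi t x)) = 0 /\
    \int[mu]_t (\int[mu]_x
      (u t x * (dt phi t x - b * dx (dx (dt phi)) t x)
       + c * eta t x * dx (dx (dx phi)) t x
       + (eta t x + 2^-1 * u t x ^+ 2) * dx phi t x)) = 0.

Definition abcd_solution a b c u eta : Prop :=
  C_H1xH1 u eta /\ abcd_equations a b c u eta.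

Definition exterior (v w t : R) : set R :=
  `]-oo, - (v * `|t|)[ `|` `]w * `|t|, +oo[.

Definition exterior_decay a b c (v : R) : Prop :=
  forall eps delta : R, 0 < eps -> 0 < delta ->
  exists eps0 : R, 0 < eps0 /\
    forall u eta, abcd_solution a b c u eta ->
      H1xH1_norm setT (u 0) (eta 0) < eps0 ->
      H1xH1_norm (exterior (v + eps) (v + delta) t) (u t) (eta t)
        @[t --> +oo] --> 0 /\
      H1xH1_norm (exterior (v + eps) (v + delta) t) (u t) (eta t)
        @[t --> -oo] --> 0.

(* (U, N) is nonzero as an element of H^1 x H^1, where functions are identified
   when they are equal almost everywhere. *)
Definition no_small_solitary_wave a b c (s : R) : Prop :=
  exists eps0 : R, 0 < eps0 /\
    ~ exists (U N : R -> R) (omega : R),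
      [/\ abcd_solution a b c (fun t x => U (x - omega * t))
                              (fun t x => N (x - omega * t)),
          ~ {ae mu, forall x, U x = 0 /\ N x = 0},
          s <= `|omega| &
          H1xH1_norm setT U N < eps0].

End ABCD.

(* Main.v *)
(** Write b = be^2, A = -a/b and C = -c/b, so that A, C > 0 and A + C = 2 - 1/(3b) < 2. Put
    D = be d/dx and let q, r, m, n be the images of u, eta, u^2/2, u eta under (1 - D^2)^-1. With
    F = C eta + (1 - C) r + m and G = A u + (1 - A) q + n the system is u_t = -F_x, eta_t = -G_x,
    and the energy density e = (u^2 + eta^2 + A (Du)^2 + C (D eta)^2 + u^2 eta)/2 has the flux
    J = F G - DF DG + A Du DF + C D eta DG. Up to total derivatives and terms of higher order, 2 e
    and J are quadratic forms in q, Dq, D^2 q, D^3 q and the same derivatives of r, and A + C <= 2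
    makes |J| at most 3/4 of 2 e. Hence the integral of chi (+-x - 2 |t| - c) e is almost
    nonincreasing in |t| for a slowly varying increasing chi: chi = 1 shows that small solutions
    stay small, and a logistic chi with c = delta |t| empties the region +-x > (2 + delta) |t|. A
    solitary wave of speed greater than 2 would never leave that region.

    As u and eta are only distributional solutions, the identities are used for their mollifications
    on [-L, L] with the cutoff 1 - x^2/L^2: mollifying the products costs O(sqrt e), the flux through
    the cutoff costs O(1/L), and Fatou's lemma removes both. *)

From HB Require Import structures.
Require Import Defs.
From mathcomp Require Import all_boot all_order all_algebra.
From mathcomp Require Import all_classical all_reals all_analysis.
From mathcomp Require Import measurable_realfun ring lra.
Set Implicit Arguments.
Unset Strict Implicit.
Unset Printing Implicit Defensive.
Import Order.TTheory GRing.Theory Num.Theory.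
Import numFieldNormedType.Exports.
Local Open Scope ring_scope.
Local Open Scope classical_set_scope.

(** * Square-integrable functions *)

(** The comparison of the flux with the energy leaves a quarter of the quadratic form [dissipation]
    to spare, and the numerical constants serve to fit all other terms into that quarter: D chi' is
    at most 1/96 of chi', and |u|, |eta| are at most 1/128. The obstacle is the part of the flux
    containing m and n: these are nonlocal, so smallness of u and eta at a point says nothing about
    them there. The remedy is to add the total derivative of 260 chi' (m Dm + n Dn). As m - D^2 m =
    u^2/2, it yields -130 (m^2 + 2 (Dm)^2 + (D^2 m)^2) + 130 (u^2/2)^2, and similarly for n, so that
    only local products remain, which are small. The same device, trading -2 q D^2 q for 2 (Dq)^2,
    lets flux and energy be compared coefficient by coefficient. For every final time T a new weight
    is taken: it starts at distance delta T, where the initial datum has little mass, and moves at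
    speed exactly 2, so delta does not enter the differential inequality. *)

Section integration.
Context {R : realType}.
Local Notation mu := (@lebesgue_measure R).
Implicit Types (f g k : R -> R) (x y z t : R).

Definition integrableR f := mu.-integrable setT (EFin \o f).

Definition sqintegrable f := measurable_fun setT f /\ integrableR (fun x => f x ^+ 2).

Definition L2norm f : R := Num.sqrt (\int[mu]_x (f x ^+ 2)).

Lemma integrableR_measurable f : integrableR f -> measurable_fun setT f.
Proof. by move=> /integrableP[/measurable_EFinP]. Qed.

Lemma le_integrableR f g : measurable_fun setT f -> integrableR g ->
  (forall x, `|f x| <= g x) -> integrableR f.
Proof.
move=> mf ig fg; apply: le_integrable ig => //; first exact/measurable_EFinP.
by move=> x _ /=; rewrite lee_fin (le_trans (fg x))// ler_norm.
Qed.

Lemma integrableRD f g : integrableR f -> integrableR g -> integrableR (fun x => f x + g x).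
Proof. by move=> mf mg; have := integrableD measurableT mf mg. Qed.

Lemma integrableRN f : integrableR f -> integrableR (fun x => - f x).
Proof. by move=> mf; have := integrableN mf. Qed.

Lemma integrableRB f g : integrableR f -> integrableR g -> integrableR (fun x => f x - g x).
Proof. by move=> mf mg; exact/integrableRD/integrableRN. Qed.

Lemma integrableRZ f (a : R) : integrableR f -> integrableR (fun x => a * f x).
Proof. by move=> mf; have := integrableZl measurableT a mf. Qed.

Lemma integrableR_norm f : integrableR f -> integrableR (fun x => `|f x|).
Proof. by move=> mf; have := integrable_norm mf. Qed.

Lemma Lfun2P f : (f \in Lfun mu 2%:E) <-> sqintegrable f.
Proof.
split=> [h|[mf f2]].
  split; last exact: Lfun2_integrable_sqr.
  by move: h; rewrite inE => /andP[/[!inE]].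
rewrite inE; apply/andP; split; first by rewrite inE.
rewrite inE /= /finite_norm unlock /Lnorm poweR_lty//.
move: f2 => /integrableP[_]; apply: le_lt_trans.
rewrite le_eqVlt; apply/orP; left; apply/eqP.
by apply: eq_integral => x _; rewrite !abse_EFin poweR_EFin powR_mulrn// normrX.
Qed.

Lemma sqintegrable_measurable f : sqintegrable f -> measurable_fun setT f.
Proof. by case. Qed.

Lemma sqintegrable_sqr f : sqintegrable f -> integrableR (fun x => f x ^+ 2).
Proof. by case. Qed.

Lemma integrableRM f g : sqintegrable f -> sqintegrable g ->
  integrableR (fun x => f x * g x).
Proof.
move=> [mf f2] [mg g2]; apply: (@le_integrableR _ (fun x => f x ^+ 2 + g x ^+ 2)).
- exact: measurable_funM.
- exact: integrableRD.
- move=> x; rewrite normrM -(real_normK (num_real (f x))).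
  by rewrite -(real_normK (num_real (g x))); nra.
Qed.

Lemma le_sqintegrable f g : measurable_fun setT f -> sqintegrable g ->
  (forall x, `|f x| <= `|g x|) -> sqintegrable f.
Proof.
move=> mf [mg g2] fg; split=> //; apply: (le_integrableR _ g2).
  exact: measurable_funX.
by move=> x; rewrite normrX -(real_normK (num_real (g x))) lerXn2r ?nnegrE.
Qed.

Lemma sqintegrableD f g : sqintegrable f -> sqintegrable g ->
  sqintegrable (fun x => f x + g x).
Proof.
move=> hf hg; split.
  by apply: measurable_funD; exact: sqintegrable_measurable.
rewrite (_ : (fun x => _) =
  (fun x => f x ^+ 2 + 2 * (f x * g x) + g x ^+ 2)); last first.
  by apply/funext => x; ring.
apply: integrableRD; last exact: sqintegrable_sqr.
apply: integrableRD; first exact: sqintegrable_sqr.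
exact/integrableRZ/integrableRM.
Qed.

Lemma sqintegrableZ f (a : R) : sqintegrable f -> sqintegrable (fun x => a * f x).
Proof.
move=> hf; split.
  apply: measurable_funM => //; exact: sqintegrable_measurable.
rewrite (_ : (fun x => _) = (fun x => a ^+ 2 * f x ^+ 2)); last first.
  by apply/funext => x; ring.
exact/integrableRZ/sqintegrable_sqr.
Qed.

Lemma sqintegrableN f : sqintegrable f -> sqintegrable (fun x => - f x).
Proof.
move=> /(sqintegrableZ (-1)); congr sqintegrable; apply/funext => x; ring.
Qed.

Lemma sqintegrableB f g : sqintegrable f -> sqintegrable g ->
  sqintegrable (fun x => f x - g x).
Proof. by move=> hf hg; exact/sqintegrableD/sqintegrableN. Qed.

Lemma sqintegrable_norm f : sqintegrable f -> sqintegrable (fun x => `|f x|).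
Proof.
move=> hf; apply: (le_sqintegrable _ hf) => [|x]; last by rewrite normr_id.
by apply: measurableT_comp => //; exact: sqintegrable_measurable.
Qed.

Lemma le_integral_integrableR f g : integrableR f -> integrableR g ->
  (forall x, f x <= g x) -> \int[mu]_x f x <= \int[mu]_x g x.
Proof. by move=> hf hg fg; apply: le_Rintegral. Qed.

Lemma integral_sqr_ge0 f : 0 <= \int[mu]_x (f x ^+ 2).
Proof. by apply: Rintegral_ge0 => x _; exact: sqr_ge0. Qed.

Lemma L2norm_ge0 f : 0 <= L2norm f.
Proof. exact: sqrtr_ge0. Qed.

Lemma sqr_L2norm f : L2norm f ^+ 2 = \int[mu]_x (f x ^+ 2).
Proof. by rewrite sqr_sqrtr// integral_sqr_ge0. Qed.

Lemma L2normZ f (a : R) : sqintegrable f ->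
  L2norm (fun x => a * f x) = `|a| * L2norm f.
Proof.
move=> hf; rewrite /L2norm; under eq_Rintegral do rewrite exprMn.
rewrite RintegralZl//; last exact: sqintegrable_sqr.
by rewrite sqrtrM ?sqr_ge0// sqrtr_sqr.
Qed.

Lemma le_L2norm f g : sqintegrable f -> sqintegrable g ->
  (forall x, `|f x| <= `|g x|) -> L2norm f <= L2norm g.
Proof.
move=> [_ f2] [_ g2] fg; rewrite ler_sqrt ?integral_sqr_ge0//.
apply: le_integral_integrableR => // x.
by rewrite -(real_normK (num_real (f x))) -(real_normK (num_real (g x)))
  lerXn2r ?nnegrE.
Qed.

Lemma cauchy_schwarz f g : sqintegrable f -> sqintegrable g ->
  `|\int[mu]_x (f x * g x)| <= L2norm f * L2norm g.
Proof.
move=> hf hg; have ifg := integrableRM hf hg.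
have f2 := sqintegrable_sqr hf; have g2 := sqintegrable_sqr hg.
set I := \int[mu]_x _; set F := L2norm f; set G := L2norm g.
have F0 : 0 <= F by exact: L2norm_ge0.
have G0 : 0 <= G by exact: L2norm_ge0.
have key (a b : R) : 2 * a * b * I <= a ^+ 2 * F ^+ 2 + b ^+ 2 * G ^+ 2.
  rewrite /I !sqr_L2norm -!RintegralZl// -RintegralD//; [|exact: integrableRZ..].
  apply: le_integral_integrableR; first exact: integrableRZ.
    by apply: integrableRD; exact: integrableRZ.
  by move=> x; have := sqr_ge0 (a * f x - b * g x); nra.
have FG : `|I| ^+ 2 <= F ^+ 2 * G ^+ 2.
  rewrite real_normK ?num_real//.
  (* If F = 0, the weights [G ^+ 2 + 1] and [I] in [key] give 2 (G^2 + 1) I^2 <= I^2 G^2, hence I =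
     0; otherwise I / F^2 and 1 are the optimal weights. *)
  have [F00|Fn0] := eqVneq F 0.
    have := key (G ^+ 2 + 1) I; rewrite F00 expr0n /= mul0r mulr0 add0r.
    by have := sqr_ge0 G; have := sqr_ge0 I; nra.
  have F2 : 0 < F ^+ 2 by rewrite exprn_even_gt0.
  have := key (I / F ^+ 2) 1.
  rewrite (_ : (I / F ^+ 2) ^+ 2 * F ^+ 2 = I ^+ 2 / F ^+ 2); last by field.
  rewrite (_ : 2 * (I / F ^+ 2) * 1 * I = 2 * (I ^+ 2 / F ^+ 2)); last by field.
  rewrite expr1n mul1r => h; rewrite [leRHS]mulrC -ler_pdivrMr//; lra.
by rewrite -(@ler_pXn2r _ 2%N)// ?nnegrE ?mulr_ge0// exprMn.
Qed.

Lemma L2normD f g : sqintegrable f -> sqintegrable g ->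
  L2norm (fun x => f x + g x) <= L2norm f + L2norm g.
Proof.
move=> hf hg; rewrite -(@ler_pXn2r _ 2%N)//; last 2 first.
- by rewrite nnegrE L2norm_ge0.
- by rewrite nnegrE addr_ge0 ?L2norm_ge0.
have := cauchy_schwarz hf hg; rewrite ler_norml => /andP[_ cs].
rewrite sqr_L2norm.
rewrite (_ : (\int[mu]_x ((f x + g x) ^+ 2)) = \int[mu]_x (f x ^+ 2) +
   2 * \int[mu]_x (f x * g x) + \int[mu]_x (g x ^+ 2)).
  rewrite -!sqr_L2norm; nra.
have fg := integrableRM hf hg.
rewrite -RintegralZl// -RintegralD//; [|exact: sqintegrable_sqr|exact: integrableRZ].
rewrite -RintegralD//; last 2 first.
- by apply: integrableRD; [exact: sqintegrable_sqr|exact: integrableRZ].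
- exact: sqintegrable_sqr.
by apply: eq_Rintegral => x _; ring.
Qed.

End integration.

(** * Reflections and translations of Lebesgue integrals *)

Section reflection.
Context {R : realType}.
Local Notation mu := (@lebesgue_measure R).
Implicit Types (f g k : R -> R) (x y z t : R).

Lemma measurable_reflect (c : R) : measurable_fun setT (fun y : R => c - y).
Proof. exact: measurable_funB. Qed.

Section pushforward_reflect.
Variable c : R.
Let phi : measurableTypeR R -> measurableTypeR R := fun y => c - y.
Let mphi : measurable_fun setT phi := measurable_reflect c.
HB.instance Definition _ := isMeasurableFun.Build _ _ _ _ phi mphi.

Lemma lebesgue_measure_reflect (A : set R) : measurable A ->
  mu A = mu ((fun y : R => c - y) @^-1` A).
Proof.
move=> mA; rewrite [LHS](@lebesgue_measure_unique _ (pushforward mu phi))//.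
move=> X /ocitvP[->|[[a b]/= ab ->]]; first by rewrite !measure0.
rewrite /pushforward.
(* The reflection exchanges the open and the closed end, which does not affect the length. *)
have -> : phi @^-1` `]a, b] = `[c - b, c - a[%classic.
  apply/seteqP; split => y /=; rewrite !in_itv/= /phi => /andP[? ?];
    apply/andP; split; lra.
rewrite !lebesgue_measure_itv/= !lte_fin.
by rewrite ltrD2l ltrN2 ab -!EFinB; congr (_%:E); ring.
Qed.

Lemma ge0_integral_reflect (f : R -> \bar R) : measurable_fun setT f ->
  (forall x, 0 <= f x)%E -> (\int[mu]_y f (c - y)%R = \int[mu]_x f x)%E.
Proof.
move=> mf f0.
rewrite [RHS](@eq_measure_integral _ _ _ _ (pushforward mu phi)); last first.
  by move=> A mA _; exact: lebesgue_measure_reflect.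
by rewrite ge0_integral_pushforward.
Qed.

End pushforward_reflect.

Lemma integrableR_reflect f c : integrableR f -> integrableR (fun y => f (c - y)).
Proof.
move=> /integrableP[mf fi]; apply/integrableP; split.
  exact: (measurableT_comp mf (measurable_reflect c)).
rewrite (@ge0_integral_reflect c (fun x => `|(f x)%:E|%E))//.
exact: measurableT_comp.
Qed.

Lemma integral_reflect f c : integrableR f ->
  \int[mu]_y f (c - y) = \int[mu]_x f x.
Proof.
move=> /integrableP[mf fi]; rewrite /Rintegral; congr fine.
rewrite integralE [RHS]integralE.
have mf' := measurableT_comp mf (measurable_reflect c).
congr (_ - _)%E.
- rewrite -[RHS](@ge0_integral_reflect c) => [|//|x].
  + by apply: eq_integral => x _; rewrite funepos.unlock.
  + exact: measurable_funepos.
  + exact: funepos_ge0.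
- rewrite -[RHS](@ge0_integral_reflect c) => [|//|x].
  + by apply: eq_integral => x _; rewrite funeneg.unlock.
  + exact: measurable_funeneg.
  + exact: funeneg_ge0.
Qed.

Lemma sqintegrable_reflect f c : sqintegrable f -> sqintegrable (fun y => f (c - y)).
Proof.
move=> [mf f2]; split; last exact: (integrableR_reflect c f2).
exact: (measurableT_comp mf (measurable_reflect c)).
Qed.

Lemma L2norm_reflect f c : sqintegrable f -> L2norm (fun y => f (c - y)) = L2norm f.
Proof. by move=> [mf f2]; rewrite /L2norm (integral_reflect c f2). Qed.

(** A translation is the composition of two reflections. *)
Lemma integrableR_shift f c : integrableR f -> integrableR (fun y => f (y + c)).
Proof.
move=> /(integrableR_reflect c)/(integrableR_reflect 0); congr integrableR.
by apply/funext => x; congr f; ring.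
Qed.

Lemma integral_shift f c : integrableR f -> \int[mu]_y f (y + c) = \int[mu]_x f x.
Proof.
move=> sf; rewrite -(integral_reflect c sf).
rewrite -(integral_reflect 0 (integrableR_reflect c sf)).
by apply: eq_Rintegral => x _; congr f; ring.
Qed.

End reflection.

(** * Weighted Young inequality for convolutions *)

Section young.
Context {R : realType}.
Local Notation mu := (@lebesgue_measure R).
Implicit Types (f g k phi : R -> R) (x y z t : R).

Lemma integrableR_bounded k f (M : R) : measurable_fun setT k ->
  (forall x, `|k x| <= M) -> integrableR f -> integrableR (fun x => k x * f x).
Proof.
move=> mk kM sf; apply: (@le_integrableR _ _ (fun x => M * `|f x|)).
- by apply: measurable_funM => //; exact: integrableR_measurable.
- exact/integrableRZ/integrableR_norm.
- by move=> x; rewrite normrM ler_wpM2r.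
Qed.

Lemma sqintegrable_bounded k (M : R) : integrableR k ->
  (forall x, `|k x| <= M) -> sqintegrable k.
Proof.
move=> sk kM; split; first exact: integrableR_measurable.
apply: (@integrableR_bounded k k M) => //; exact: integrableR_measurable.
Qed.

Lemma fin_num_integral f : integrableR f -> (\int[mu]_x (f x)%:E \is a fin_num)%E.
Proof. by move=> sf; exact: integrable_fin_num. Qed.

Lemma EFin_integral f : integrableR f ->
  (\int[mu]_x f x)%:E = (\int[mu]_x (f x)%:E)%E.
Proof. by move=> sf; rewrite fineK// fin_num_integral. Qed.

(** Cauchy-Schwarz for the measure k (x - y) dy, applied to |f| and 1; in terms of Lebesgue measure
    each factor receives sqrt (k (x - y)). *)
Lemma cauchy_schwarz_kernel f k x (M : R) : sqintegrable f -> integrableR k ->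
  (forall z, 0 <= k z <= M) ->
  (\int[mu]_y (`|f y| * k (x - y))) ^+ 2 <=
  (\int[mu]_y k y) * \int[mu]_y (f y ^+ 2 * k (x - y)).
Proof.
move=> sf sk kM.
have k0 z : 0 <= k z by case/andP: (kM z).
have kMn z : `|k z| <= M by rewrite ger0_norm//; case/andP: (kM z).
have mk' : measurable_fun setT (fun y => k (x - y)).
  exact: integrableR_measurable (integrableR_reflect x sk).
have s1 : sqintegrable (fun y => Num.sqrt (k (x - y))).
  split; last first.
    rewrite (_ : (fun y => _) = (fun y => k (x - y))).
      exact: integrableR_reflect.
    by apply/funext => y; rewrite sqr_sqrtr.
  exact: (measurableT_comp (continuous_measurable_fun (@sqrt_continuous R))).
have s2 : sqintegrable (fun y => `|f y| * Num.sqrt (k (x - y))).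
  split.
    by apply: measurable_funM; apply: sqintegrable_measurable => //;
      exact: sqintegrable_norm.
  rewrite (_ : (fun y => _) = (fun y => k (x - y) * f y ^+ 2)); last first.
    by apply/funext => y; rewrite exprMn sqr_sqrtr// real_normK ?num_real// mulrC.
  apply: (@integrableR_bounded _ _ M) => //; exact: sqintegrable_sqr.
rewrite -(integral_reflect x sk).
have : `|\int[mu]_y (Num.sqrt (k (x - y)) * (`|f y| * Num.sqrt (k (x - y))))| ^+ 2
    <= (L2norm (fun y => Num.sqrt (k (x - y))) *
        L2norm (fun y => `|f y| * Num.sqrt (k (x - y)))) ^+ 2.
  by rewrite lerXn2r ?nnegrE ?mulr_ge0 ?L2norm_ge0//; exact: cauchy_schwarz.
rewrite [X in _ <= X -> _]exprMn !sqr_L2norm real_normK ?num_real//.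
rewrite (_ : \int[mu]_y _ = \int[mu]_y (`|f y| * k (x - y))); last first.
  apply: eq_Rintegral => y _; rewrite mulrCA -expr2 sqr_sqrtr//.
move=> /le_trans; apply; rewrite le_eqVlt; apply/orP; left; apply/eqP.
congr (_ * _); apply: eq_Rintegral => y _; first by rewrite sqr_sqrtr.
by rewrite exprMn sqr_sqrtr// real_normK ?num_real.
Qed.

(** [cauchy_schwarz_kernel] at fixed x, then Tonelli; the comparison of k with k2 moves the weight
    from x to y. It serves twice: with constant weight and k2 = k, which is Young's inequality, and
    with k a mollifier and k2 = H k, where H bounds the variation of the weight over the support of
    k. *)
Lemma young_weighted f k k2 phi g (M Mp : R) :
  sqintegrable f -> integrableR k -> (forall z, 0 <= k z <= M) -> integrableR k2 -> (forall z, 0 <= k2 z) ->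
  measurable_fun setT phi -> (forall x, 0 <= phi x <= Mp) ->
  (forall x y, phi x * k (x - y) <= phi y * k2 (x - y)) ->
  measurable_fun setT g ->
  (forall x, `|g x| <= \int[mu]_y (`|f y| * k (x - y))) ->
  integrableR (fun x => phi x * g x ^+ 2) /\
  \int[mu]_x (phi x * g x ^+ 2) <=
    (\int[mu]_x k x) * (\int[mu]_x k2 x) * \int[mu]_x (phi x * f x ^+ 2).
Proof.
move=> sf sk kM sk2 k20 mphi phiM phik mg gle.
have k0 z : 0 <= k z by case/andP: (kM z).
have p0 z : 0 <= phi z by case/andP: (phiM z).
have kMn z : `|k z| <= M by rewrite ger0_norm//; case/andP: (kM z).
have pMn z : `|phi z| <= Mp by rewrite ger0_norm//; case/andP: (phiM z).
have sf2 := sqintegrable_sqr sf.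
have mk := integrableR_measurable sk.
have mf2 := integrableR_measurable sf2.
have spf : integrableR (fun x => phi x * f x ^+ 2) by exact: (integrableR_bounded _ pMn).
have sfk x : integrableR (fun y => f y ^+ 2 * k (x - y)).
  under eq_fun do rewrite mulrC.
  apply: (@integrableR_bounded (fun y => k (x - y)) _ M) => //.
  exact: integrableR_measurable (integrableR_reflect x sk).
have K0 : 0 <= \int[mu]_x k x by exact: Rintegral_ge0.
(* The estimate is proved for extended real integrals, where Tonelli asks only for nonnegativity;
   its finiteness then gives the integrability. *)
suff key : (\int[mu]_x (phi x * g x ^+ 2)%:E <=
    ((\int[mu]_x k x) * (\int[mu]_x k2 x) * \int[mu]_x (phi x * f x ^+ 2))%:E)%E.
  have sg : integrableR (fun x => phi x * g x ^+ 2).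
    apply/integrableP; split.
      by apply/measurable_EFinP/measurable_funM => //; exact: measurable_funX.
    apply: (@le_lt_trans _ _ (\int[mu]_x (phi x * g x ^+ 2)%:E)%E).
      rewrite le_eqVlt; apply/orP; left; apply/eqP.
      apply: eq_integral => x _ /=; rewrite ger0_norm// mulr_ge0// sqr_ge0//.
    exact: le_lt_trans key (ltry _).
  by split=> //; rewrite -lee_fin EFin_integral.
pose h (p : R * R) : \bar R := ((\int[mu]_x k x) * (phi p.1 * (f p.2 ^+ 2 * k (p.1 - p.2))))%:E.
have mh : measurable_fun setT h.
  apply/measurable_EFinP/measurable_funM => //.
  apply: measurable_funM; first exact: (measurableT_comp mphi measurable_fst).
  apply: measurable_funM; first exact: (measurableT_comp mf2 measurable_snd).
  apply: (measurableT_comp mk); apply: measurable_funB => //.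
have h0 p : (0 <= h p)%E.
  by rewrite lee_fin mulr_ge0// mulr_ge0// mulr_ge0// sqr_ge0.
apply: (@le_trans _ _ (\int[mu]_x \int[mu]_y h (x, y))%E).
  apply: ge0_le_integral => //.
  - by move=> x _; rewrite lee_fin mulr_ge0// sqr_ge0.
  - by apply/measurable_EFinP/measurable_funM => //; exact: measurable_funX.
  - exact: measurable_fun_fubini_tonelli_F.
  move=> x _; rewrite /h /=.
  rewrite -EFin_integral; last exact/integrableRZ/integrableRZ.
  rewrite lee_fin RintegralZl//; last exact: integrableRZ.
  have -> : \int[mu]_y (phi x * (f y ^+ 2 * k (x - y))) =
      phi x * \int[mu]_y (f y ^+ 2 * k (x - y)) by rewrite RintegralZl//; exact: sfk.
  rewrite [leRHS]mulrCA; apply: ler_wpM2l => //.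
  apply: le_trans (cauchy_schwarz_kernel x sf sk kM).
  rewrite -(real_normK (num_real (g x))) lerXn2r ?nnegrE// .
  by apply: Rintegral_ge0 => y _; rewrite mulr_ge0.
rewrite fubini_tonelli//.
have s0 x y : integrableR (fun y => phi y * k2 (x - y)).
  apply: (@integrableR_bounded _ _ Mp) => //; exact: integrableR_reflect.
have sk2y y : integrableR (fun x => k2 (x - y)) by exact: (integrableR_shift (- y)).
rewrite -RintegralZl// EFin_integral; last exact: integrableRZ.
apply: ge0_le_integral => //.
- by move=> x _; apply: integral_ge0 => y Dy; exact: h0.
- exact: measurable_fun_fubini_tonelli_G.
- apply/measurable_EFinP; apply: measurable_funM => //.
  exact: integrableR_measurable.
move=> y _; rewrite /h/=.
set a := _ * (phi y * _); set c := (\int[mu]_x k x) * (phi y * f y ^+ 2).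
have -> : a = \int[mu]_x (c * k2 (x - y)).
  rewrite RintegralZl//; last exact: sk2y.
  by rewrite (integral_shift (- y) sk2) /a /c; ring.
rewrite EFin_integral; last exact: integrableRZ.
apply: ge0_le_integral => //.
- by move=> x _; rewrite lee_fin mulr_ge0// mulr_ge0// mulr_ge0// sqr_ge0.
- apply/measurable_EFinP; apply: measurable_funM => //.
  apply: measurable_funM => //; apply: measurable_funM => //.
  exact: (measurableT_comp mk (measurable_funB _ _)).
- apply/measurable_EFinP/measurable_funM => //.
  exact: integrableR_measurable (sk2y y).
move=> x _; rewrite lee_fin /c -mulrA; apply: ler_wpM2l => //.
rewrite mulrCA [leRHS]mulrAC [leRHS]mulrC; apply: ler_wpM2l => //.
exact: sqr_ge0.
Qed.

End young.

(** * Smooth functions, mollifiers and weak derivatives *)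

Section derivatives.
Context {R : realType}.
Implicit Types (f g k : R -> R) (x y z t c : R).

Lemma is_derive_fcst x c : is_derive x 1 (fun _ : R => c) 0.
Proof. exact: is_derive_cst. Qed.

Lemma is_derive_fD f g x df dg : is_derive x 1 f df -> is_derive x 1 g dg ->
  is_derive x 1 (fun y => f y + g y) (df + dg).
Proof. by move=> hf hg; exact: is_deriveD. Qed.

Lemma is_derive_fN f x df : is_derive x 1 f df ->
  is_derive x 1 (fun y => - f y) (- df).
Proof. by move=> hf; exact: is_deriveN. Qed.

Lemma is_derive_fB f g x df dg : is_derive x 1 f df -> is_derive x 1 g dg ->
  is_derive x 1 (fun y => f y - g y) (df - dg).
Proof. by move=> hf hg; exact: is_deriveB. Qed.

Lemma is_derive_fM f g x df dg : is_derive x 1 f df -> is_derive x 1 g dg ->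
  is_derive x 1 (fun y => f y * g y) (df * g x + f x * dg).
Proof.
move=> hf hg; apply: (is_derive_eq (is_deriveM hf hg)).
by rewrite /GRing.scale /= addrC mulrC.
Qed.

Lemma is_derive_fZ f x c df : is_derive x 1 f df ->
  is_derive x 1 (fun y => c * f y) (c * df).
Proof.
move=> hf; apply: (is_derive_eq (is_derive_fM (is_derive_fcst x c) hf)); ring.
Qed.

Lemma is_derive_fX f n x df : is_derive x 1 f df ->
  is_derive x 1 (fun y => f y ^+ n) (n%:R * f x ^+ n.-1 * df).
Proof.
move=> hf; rewrite (_ : (fun y => _) = f ^+ n); first exact: is_deriveX.
by rewrite exprfctE.
Qed.

Lemma is_derive_fcomp f g x df dg : is_derive x 1 f df -> is_derive (f x) 1 g dg ->
  is_derive x 1 (fun y => g (f y)) (dg * df).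
Proof. by move=> hf hg; exact: is_derive1_comp. Qed.

Lemma is_derive_affine x s c : is_derive x 1 (fun y => s * y + c) s.
Proof.
apply: (is_derive_eq (is_derive_fD (is_derive_fZ s (is_derive_id x 1))
  (is_derive_fcst x c))).
by rewrite addr0 mulr1.
Qed.

Lemma is_derive_comp_affine f x s c df : is_derive (s * x + c) 1 f df ->
  is_derive x 1 (fun y => f (s * y + c)) (s * df).
Proof.
move=> hf; rewrite mulrC; exact: (is_derive_fcomp (is_derive_affine x s c) hf).
Qed.

Lemma is_derive_reflect f x c df : is_derive (c - x) 1 f df ->
  is_derive x 1 (fun y => f (c - y)) (- df).
Proof.
move=> hf; rewrite (_ : (fun y => _) = (fun y => f ((-1) * y + c))).
  apply: (is_derive_eq (@is_derive_comp_affine f x (-1) c df _)); last by rewrite mulN1r.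
  by rewrite mulN1r addrC.
by apply/funext => y; rewrite mulN1r addrC.
Qed.

Lemma is_derive_fshift f x c df : is_derive (x + c) 1 f df ->
  is_derive x 1 (fun y => f (y + c)) df.
Proof.
move=> hf; rewrite (_ : (fun y => _) = (fun y => f (1 * y + c))).
  by apply: (is_derive_eq (@is_derive_comp_affine f x 1 c df _)); rewrite mul1r.
by apply/funext => y; rewrite mul1r.
Qed.

Lemma is_derive_derivable f x df : is_derive x 1 f df -> derivable f x 1.
Proof. by case. Qed.

Lemma is_derive_derive1 f x df : is_derive x 1 f df -> f^`() x = df.
Proof. by move=> [_ <-]; rewrite derive1E. Qed.

Lemma is_derive_continuous f x df : is_derive x 1 f df -> {for x, continuous f}.
Proof. by case=> hf _; exact/differentiable_continuous/derivable1_diffP. Qed.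

Lemma derivable_is_derive f x : derivable f x 1 -> is_derive x 1 f (f^`() x).
Proof. by move=> df; rewrite derive1E; exact: derivableP. Qed.

(** Derivatives are given by witnesses rather than by iterating [derive1], so that closure under
    sums, products and affine substitutions is a plain induction. [smooth_derivable] and
    [derivable_smooth] translate to and from the form found in [test_function]. *)
Fixpoint differentiable_upto n f : Prop :=
  if n is n'.+1 then
    exists2 g, (forall x, is_derive x 1 f (g x)) & differentiable_upto n' g
  else True.

Definition smooth f := forall n, differentiable_upto n f.

Lemma smooth_derivable f : smooth f -> forall n x, derivable (f^`(n)) x 1.
Proof.
move=> sf n; move: (sf n.+1) => {sf}; elim: n f => [|n IH] f [g hg hn] x.
  by case: (hg x).
rewrite (_ : f^`(n.+1) = g^`(n)); first exact: IH.
rewrite derive1Sn; congr (_^`(n)); apply/funext => y.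
exact: is_derive_derive1.
Qed.

Lemma smooth_step f g : (forall x, is_derive x 1 f (g x)) -> smooth g -> smooth f.
Proof. by move=> fg sg [//|n]; exists g. Qed.

Lemma smooth_derive f : smooth f ->
  smooth (f^`()) /\ forall x, is_derive x 1 f (f^`() x).
Proof.
move=> sf; have [g hg _] := sf 1%N.
have -> : f^`() = g by apply/funext => x; exact: is_derive_derive1.
split=> // n; have [g' hg' h] := sf n.+1.
suff -> : g = g' by [].
by apply/funext => x; rewrite -(is_derive_derive1 (hg x)) (is_derive_derive1 (hg' x)).
Qed.

Lemma smoothP f g : smooth f -> (forall x, is_derive x 1 f (g x)) -> smooth g.
Proof.
move=> /smooth_derive[sf _] h; suff <- : f^`() = g by [].
by apply/funext => x; exact: is_derive_derive1.
Qed.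

Lemma smooth_continuous f : smooth f -> continuous f.
Proof. by move=> /smooth_derive[_ h] x; exact: is_derive_continuous (h x). Qed.

Lemma differentiable_uptoW n f :
  differentiable_upto n.+1 f -> differentiable_upto n f.
Proof.
by elim: n f => [//|n IH] f [g hg gn]; exists g => //; exact: IH.
Qed.

Lemma differentiable_uptoD n f g : differentiable_upto n f ->
  differentiable_upto n g -> differentiable_upto n (fun x => f x + g x).
Proof.
elim: n f g => [//|n IH] f g [f' hf fn] [g' hg gn].
by exists (fun x => f' x + g' x); [move=> x; exact: is_derive_fD|exact: IH].
Qed.

Lemma differentiable_uptoM n f g : differentiable_upto n f ->
  differentiable_upto n g -> differentiable_upto n (fun x => f x * g x).
Proof.
elim: n f g => [//|n IH] f g /[dup] /differentiable_uptoW fn [f' hf f'n]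
  /[dup] /differentiable_uptoW gn [g' hg g'n].
exists (fun x => f' x * g x + f x * g' x); first by move=> x; exact: is_derive_fM.
by apply: differentiable_uptoD; exact: IH.
Qed.

Lemma smooth_cst c : smooth (fun _ => c).
Proof.
have h n : differentiable_upto n (fun _ : R => 0).
  by elim: n => [//|n IH]; exists (fun=> 0) => // x; exact: is_derive_fcst.
by move=> [//|n]; exists (fun=> 0) => // x; exact: is_derive_fcst.
Qed.

Lemma smoothD f g : smooth f -> smooth g -> smooth (fun x => f x + g x).
Proof. by move=> sf sg n; exact: differentiable_uptoD. Qed.

Lemma smoothM f g : smooth f -> smooth g -> smooth (fun x => f x * g x).
Proof. by move=> sf sg n; exact: differentiable_uptoM. Qed.

Lemma smoothZ f c : smooth f -> smooth (fun x => c * f x).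
Proof. by move=> sf; apply: smoothM => //; exact: smooth_cst. Qed.

Lemma smoothN f : smooth f -> smooth (fun x => - f x).
Proof.
by move=> /(smoothZ (-1)); congr smooth; apply/funext => x; rewrite mulN1r.
Qed.

Lemma smoothB f g : smooth f -> smooth g -> smooth (fun x => f x - g x).
Proof. by move=> sf sg; exact/smoothD/smoothN. Qed.

Lemma smooth_comp_affine f s c : smooth f -> smooth (fun x => f (s * x + c)).
Proof.
move=> sf n; elim: n f sf => [//|n IH] f /smooth_derive[sf df].
exists (fun x => s * derive1 f (s * x + c)).
  by move=> x; exact: is_derive_comp_affine.
apply: differentiable_uptoM; [exact: smooth_cst|exact: IH].
Qed.

Lemma smooth_reflect f c : smooth f -> smooth (fun x => f (c - x)).
Proof.
move=> /(smooth_comp_affine (-1) c); congr smooth.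
by apply/funext => x; rewrite mulN1r addrC.
Qed.

Lemma smooth_shift f c : smooth f -> smooth (fun x => f (x + c)).
Proof.
move=> /(smooth_comp_affine 1 c); congr smooth.
by apply/funext => x; rewrite mul1r.
Qed.

Lemma smooth_expR s : smooth (fun x => expR (s * x)).
Proof.
suff h n c : differentiable_upto n (fun x => c * expR (s * x)).
  by move=> n; have := h n 1; congr differentiable_upto; apply/funext => x; rewrite mul1r.
elim: n c => [//|n IH] c; exists (fun x => (c * s) * expR (s * x)) => // x.
apply: (is_derive_eq (is_derive_fZ c (is_derive_fcomp
  (is_derive_fZ s (is_derive_id x 1)) (is_derive_expR (s * x))))).
ring.
Qed.

End derivatives.

(** * A smooth bump function *)

Section bump.
Context {R : realType}.
Local Notation mu := (@lebesgue_measure R).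
Implicit Types (f g k : R -> R) (x y z t c : R).

(** The powers are kept as a parameter because a derivative of a member is a linear combination of
    members, so that smoothness is an induction over the whole family. *)
Definition flat n x : R := if 0 < x then x^-1 ^+ n * expR (- x^-1) else 0.

Lemma flat_ge0 n x : 0 <= flat n x.
Proof.
rewrite /flat; case: ifPn => // x0.
by rewrite mulr_ge0// ?expR_ge0// exprn_ge0// invr_ge0 ltW.
Qed.

(** With y = 1/x, the inequality exp y >= y^(n+2) / (n+2)! leaves a factor x^2, which makes the
    difference quotient at 0 tend to 0. *)
Lemma flat_le n x : flat n x <= n.+2`!%:R * x ^+ 2.
Proof.
rewrite /flat; case: ifPn => [x0|_]; last by rewrite mulr_ge0// sqr_ge0.
have y0 : 0 < x^-1 by rewrite invr_gt0.
have := expR_ge1Dxn n.+1 (ltW y0).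
set F := (n.+2)`!%:R.
have F0 : 0 < F by rewrite ltr0n fact_gt0.
move=> h; rewrite expRN ler_pdivrMr ?expR_gt0//.
have x2 : 0 <= F * x ^+ 2 by rewrite mulr_ge0 ?sqr_ge0// ltW.
have e : x^-1 ^+ n = F * x ^+ 2 * (x^-1 ^+ n.+2 / F).
  have -> : F * x ^+ 2 * (x^-1 ^+ n.+2 / F) = x^-1 ^+ n * (x * x^-1) ^+ 2 * (F / F).
    by rewrite !exprS; ring.
  by rewrite divff ?gt_eqF// divff ?gt_eqF// expr1n !mulr1.
rewrite {1}e; apply: ler_wpM2l => //; apply: le_trans h.
by rewrite -[leLHS]add0r lerD.
Qed.

Lemma is_derive_flat n x :
  is_derive x 1 (flat n) (flat n.+2 x - n%:R * flat n.+1 x).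
Proof.
have [x0|x0|->] := ltgtP x 0.
- rewrite /flat ltNge (ltW x0) /= mulr0 subr0.
  apply: (near_eq_is_derive _ (is_derive_fcst x 0)).
  near=> y; rewrite ifN// -leNgt; near: y; exact: lt_le_nbhsl.
- have xn0 : x != 0 by rewrite gt_eqF.
  rewrite /flat x0.
  suff h : is_derive x 1 (fun x => x^-1 ^+ n * expR (- x^-1))
      (x^-1 ^+ n.+2 * expR (- x^-1) - n%:R * (x^-1 ^+ n.+1 * expR (- x^-1))).
    apply: (near_eq_is_derive _ h).
    near=> y; rewrite /flat ifT//.
    by near: y; exact: lt_nbhsr.
  have dV : is_derive x 1 (fun y : R => y^-1) (- x ^- 2).
    have d1 := @derivable_id R R x 1.
    have h1 := @derivableV R R id x 1 xn0 d1.
    have h2 := @deriveV R R id x 1 xn0 d1.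
    by apply: DeriveDef => //; rewrite h2 derive_id /GRing.scale /= mulr1.
  have dP : is_derive x 1 (fun y : R => y^-1 ^+ n)
      (n%:R * x^-1 ^+ n.-1 * - x ^- 2).
    exact: is_derive_fX.
  apply: (is_derive_eq (is_derive_fM dP
    (is_derive_fcomp (is_derive_fN dV) (is_derive_expR _)))).
  rewrite -exprVn opprK; case: n {dP} => [|n] /=.
    by rewrite !mul0r subr0 add0r mul1r mulrC.
  rewrite !exprS; ring.
(* By [flat_le] the difference quotient at 0 is at most (n+2)! |y| in absolute value, so it extends
   continuously by 0. *)
- have f0 : flat n 0 = 0 by rewrite /flat ltxx.
  have -> : flat n.+2 0 - n%:R * flat n.+1 0 = 0 by rewrite /flat ltxx mulr0 subr0.
  apply/is_derive1_caratheodory; exists (fun y => flat n y / y); split.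
  + move=> z; rewrite f0 !subr0; have [->|z0] := eqVneq z 0.
      by rewrite f0 mulr0.
    by rewrite divfK.
  + have nrm0 : `|y| @[y --> (0 : R)] --> (0 : R).
      by have := @norm_continuous _ R 0; rewrite /continuous_at normr0.
    rewrite /prop_for /continuous_at /= f0 mul0r.
    apply: (@squeeze_cvgr _ _ _ _ (fun y : R => - ((n.+2)`!%:R * `|y|))
       (fun y : R => (n.+2)`!%:R * `|y|)).
    * near=> y; rewrite -ler_norml normrM normfV.
      have [->|y0] := eqVneq y 0; first by rewrite normr0 invr0 !mulr0.
      rewrite ler_pdivrMr ?normr_gt0// ger0_norm ?flat_ge0//.
      by rewrite -mulrA -normrM -expr2 ger0_norm ?sqr_ge0// flat_le.
    * rewrite -[X in _ --> X]oppr0; apply: cvgN.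
      rewrite -[X in _ --> X](mulr0 (n.+2)`!%:R); apply: cvgM; first exact: cvg_cst.
      exact: nrm0.
    * rewrite -[X in _ --> X](mulr0 (n.+2)`!%:R); apply: cvgM; first exact: cvg_cst.
      exact: nrm0.
  + by rewrite f0 mul0r.
Unshelve. all: by end_near. Qed.

Lemma smooth_flat n : smooth (flat n).
Proof.
move=> m; elim: m n => [//|m IH] n; exists (fun x => flat n.+2 x - n%:R * flat n.+1 x).
  exact: is_derive_flat.
apply: differentiable_uptoD; first exact: IH.
have -> : (fun x => - (n%:R * flat n.+1 x)) = (fun x => (- n%:R) * flat n.+1 x).
  by apply/funext => x; rewrite mulNr.
by apply: differentiable_uptoM; [exact: smooth_cst|exact: IH].
Qed.

Definition pre_bump x : R := flat 0 (1 + x) * flat 0 (1 - x).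

Lemma smooth_pre_bump : smooth pre_bump.
Proof.
apply: smoothM; last exact/smooth_reflect/smooth_flat.
have := smooth_shift 1 (smooth_flat 0); congr smooth.
by apply/funext => x; rewrite addrC.
Qed.

Lemma pre_bump_ge0 x : 0 <= pre_bump x.
Proof. by rewrite mulr_ge0// flat_ge0. Qed.

Lemma pre_bump_support x : 1 <= `|x| -> pre_bump x = 0.
Proof.
rewrite ler_normr /pre_bump /flat => /orP[h|h].
- by rewrite [in X in _ * X]ltNge subr_le0 h mulr0.
- by rewrite ltNge -lerBrDl sub0r lerNr h mul0r.
Qed.

Lemma pre_bump_gt0 x : `|x| < 1 -> 0 < pre_bump x.
Proof.
rewrite ltr_norml => /andP[h1 h2]; rewrite /pre_bump /flat.
have -> : 0 < 1 + x by lra.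
have -> : 0 < 1 - x by lra.
by rewrite !expr0 !mul1r mulr_gt0// expR_gt0.
Qed.

End bump.

(** * Compactly supported functions and primitives *)

Section compact_support.
Context {R : realType}.
Local Notation mu := (@lebesgue_measure R).
Implicit Types (f g k : R -> R) (x y z t c M e : R).

Definition supported_in M f := forall x, M <= `|x| -> f x = 0.

Lemma supported_inW M M' f : M <= M' -> supported_in M f -> supported_in M' f.
Proof. by move=> MM' h x hx; apply: h; exact: le_trans hx. Qed.

Lemma smooth_test_function M f : smooth f -> supported_in M f -> test_function f.
Proof.
move=> sf hM; split; first exact: smooth_derivable.
have sub : closure [set x | f x != 0] `<=` `[- M, M].
  rewrite [X in _ `<=` X](closure_id _).1; last exact: itv_closed_ends_closed.
  apply: closure_subset => x /= fx; rewrite in_itv /= -ler_norml.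
  by rewrite leNgt; apply: contra fx => /ltW /hM ->.
apply: subclosed_compact sub; first exact: closed_closure.
exact: (@segment_compact R (- M) M).
Qed.

Lemma continuous_within_itv f (A : set R) : continuous f -> {within A, continuous f}.
Proof. by move=> cf; exact: continuous_subspaceT. Qed.

Lemma supported_integrable M f : continuous f -> supported_in M f -> integrableR f.
Proof.
move=> cf hM.
have := @continuous_compact_integrable R f `[- M, M] (@segment_compact R (- M) M)
  (continuous_within_itv cf).
rewrite integrable_mkcond//; congr integrable.
apply/funext => x; rewrite patchE; case: ifPn => // /negP xM /=.
rewrite hM// leNgt; apply/negP => h; apply: xM.
by rewrite inE /= in_itv /= -ler_norml ltW.
Qed.

Lemma supported_bounded M f : continuous f -> supported_in M f ->
  exists2 C, 0 <= C & forall x, `|f x| <= C.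
Proof.
move=> cf hM; have [M0|M0] := leP M 0.
  by exists 0 => // x; rewrite hM ?normr0// (le_trans M0).
have cnf : {within `[- M, M], continuous (fun x => `|f x|)}.
  apply: continuous_within_itv => x; apply: continuous_comp; first exact: cf.
  exact: norm_continuous.
have MM : - M <= M by lra.
have [c cM hc] := EVT_max MM cnf.
exists `|f c| => // x; have [xM|xM] := leP M `|x|; first by rewrite hM// normr0.
by apply: hc; rewrite in_itv /= -ler_norml ltW.
Qed.

Lemma supported_sqintegrable M f : continuous f -> supported_in M f -> sqintegrable f.
Proof.
move=> cf hM; have [C _ hC] := supported_bounded cf hM.
exact: sqintegrable_bounded (supported_integrable cf hM) hC.
Qed.

Lemma supported_derive M f g : supported_in M f ->
  (forall x, is_derive x 1 f (g x)) -> forall x, M < `|x| -> g x = 0.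
Proof.
move=> hM df x xM; rewrite -(is_derive_derive1 (df x)).
apply: (@is_derive_derive1 _ f); apply: (near_eq_is_derive _ (is_derive_fcst x 0)).
near=> y; rewrite hM// ltW//; near: y.
have := @norm_continuous _ R x; rewrite /continuous_at => h.
exact: (cvgr_gt _ h).
Unshelve. all: by end_near. Qed.

(** [supported_derive] says nothing where |x| = M; enlarging the radius by 1 restores the closed
    form of [supported_in], and the exact radius never matters. *)
Lemma supported_derive_in M f g : supported_in M f -> continuous g ->
  (forall x, is_derive x 1 f (g x)) -> supported_in (M + 1) g.
Proof.
move=> hM _ df x xM; apply: (supported_derive hM df); apply: lt_le_trans xM; lra.
Qed.

Definition primitive f x := \int[mu]_(y in `]-oo, x]) f y.

Lemma is_derive_primitive f x : continuous f -> integrableR f ->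
  is_derive x 1 (primitive f) (f x).
Proof.
move=> cf fi; have xx : x < x + 1 by rewrite ltrDl.
have fi' : mu.-integrable `]-oo, x + 1] (EFin \o f) by exact: integrableS fi.
have [|d1 d2] := @continuous_FTC1 R f -oo%O x (x + 1) xx fi' _ (cf x).
  exact: ltNyr.
by apply: DeriveDef => //; rewrite -derive1E.
Qed.

Lemma primitive_ge0 f x : (forall y, 0 <= f y) -> 0 <= primitive f x.
Proof. by move=> f0; exact: Rintegral_ge0. Qed.

Lemma primitive_le f x : integrableR f -> (forall y, 0 <= f y) ->
  primitive f x <= \int[mu]_y f y.
Proof.
move=> fi f0; rewrite /primitive Rintegral_mkcond.
apply: le_integral_integrableR => //.
  have : mu.-integrable `]-oo, x] (EFin \o f) by exact: integrableS fi.
  by rewrite integrable_mkcond//; congr integrable; apply/funext => y; rewrite -restrict_EFin.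
by move=> y; rewrite patchE; case: ifP.
Qed.

Lemma primitive_left f x : (forall y, y <= x -> f y = 0) -> primitive f x = 0.
Proof.
move=> hf; rewrite /primitive (_ : 0 = \int[mu]_(y in `]-oo, x]) (fun=> 0) y); last first.
  by rewrite /Rintegral integral0.
by apply: eq_Rintegral => y; rewrite inE /= in_itv /= => /hf.
Qed.

Lemma primitive_right f x : (forall y, x < y -> f y = 0) ->
  primitive f x = \int[mu]_y f y.
Proof.
move=> hf; rewrite /primitive Rintegral_mkcond; apply: eq_Rintegral => y _.
rewrite patchE; case: ifPn => // /negP; rewrite inE /= in_itv /= => /negP.
by rewrite -ltNge => /hf ->.
Qed.

End compact_support.

(** * The mollifier *)

Section mollifier.
Context {R : realType}.
Local Notation mu := (@lebesgue_measure R).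
Implicit Types (f g k : R -> R) (x y z t c M e : R).

Definition rho e x : R :=
  (\int[mu]_y pre_bump (e^-1 * y))^-1 * pre_bump (e^-1 * x).

Lemma scaled_bump_smooth e : smooth (fun x : R => pre_bump (e^-1 * x)).
Proof.
have := smooth_comp_affine e^-1 0 (@smooth_pre_bump R); congr smooth.
by apply/funext => x; rewrite addr0.
Qed.

Lemma scaled_bump_supported e : 0 < e ->
  supported_in e (fun x : R => pre_bump (e^-1 * x)).
Proof.
move=> e0 x ex; rewrite pre_bump_support// normrM gtr0_norm ?invr_gt0//.
by rewrite ler_pdivlMl// mulr1.
Qed.

Lemma scaled_bump_integrable e : 0 < e ->
  integrableR (fun x : R => pre_bump (e^-1 * x)).
Proof.
move=> e0; apply: (supported_integrable _ (scaled_bump_supported e0)).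
exact/smooth_continuous/scaled_bump_smooth.
Qed.

(** The constant is the minimum of the bump on [-1/2, 1/2]; at scale e this segment becomes
    [-e/2, e/2], of length e. This lower bound replaces a change of variables and suffices for
    [rho_le]. *)
Lemma scaled_bump_mass : exists2 c : R, 0 < c & forall e, 0 < e ->
  c * e <= \int[mu]_y pre_bump (e^-1 * y).
Proof.
have h12 : - 2^-1 <= 2^-1 :> R by lra.
have cpb : {within `[- 2^-1, 2^-1 : R], continuous (@pre_bump R)}.
  exact/continuous_within_itv/smooth_continuous/smooth_pre_bump.
have [m mI hm] := EVT_min h12 cpb.
exists (pre_bump m).
  apply: pre_bump_gt0; move: mI; rewrite in_itv /= -ler_norml => /le_lt_trans; apply; lra.
move=> e e0.
pose I := `[- (e / 2), e / 2]%classic.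
have iI : integrableR (\1_I : R -> R) by exact: integrable_indic_itv.
have -> : pre_bump m * e = \int[mu]_y (pre_bump m * \1_I y).
  have muI : mu I = e%:E.
    rewrite /I lebesgue_measure_itv/= lte_fin ifT; last by lra.
    by rewrite -EFinB; congr (_%:E); lra.
  rewrite RintegralZl; [|exact: measurableT|exact: iI]. rewrite /Rintegral integral_indic; [|exact: measurableT|exact: measurable_itv].
  by rewrite [X in fine X](_ : _ = e%:E)// setIT.
apply: le_integral_integrableR; first exact: integrableRZ.
  exact: scaled_bump_integrable.
move=> y; rewrite indicE; case: (boolP (y \in I)) => [|_]; last by rewrite mulr0 pre_bump_ge0.
rewrite mulr1 inE /I /= in_itv /= => /andP[y1 y2]; apply: hm.
have e1 : e^-1 * e = 1 by rewrite mulVf// gt_eqF.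
have ei : 0 < e^-1 by rewrite invr_gt0.
by rewrite in_itv /=; apply/andP; split; nra.
Qed.

Lemma scaled_bump_mass_gt0 e : 0 < e -> 0 < \int[mu]_y pre_bump (e^-1 * y).
Proof.
by move=> e0; have [c c0 /(_ _ e0)] := scaled_bump_mass; apply: lt_le_trans; rewrite mulr_gt0.
Qed.

Lemma rho_ge0 e x : 0 < e -> 0 <= rho e x.
Proof.
by move=> e0; rewrite mulr_ge0 ?pre_bump_ge0// invr_ge0 ltW// scaled_bump_mass_gt0.
Qed.

Lemma smooth_rho e : smooth (rho e).
Proof. exact/smoothZ/scaled_bump_smooth. Qed.

Lemma rho_supported e : 0 < e -> supported_in e (rho e).
Proof. by move=> e0 x ex; rewrite /rho scaled_bump_supported// mulr0. Qed.

Lemma continuous_rho e : continuous (rho e).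
Proof. exact/smooth_continuous/smooth_rho. Qed.

Lemma rho_integrable e : 0 < e -> integrableR (rho e).
Proof. by move=> e0; exact: supported_integrable (@continuous_rho e) (rho_supported e0). Qed.

Lemma integral_rho e : 0 < e -> \int[mu]_x rho e x = 1.
Proof.
move=> e0; rewrite RintegralZl//; last exact: scaled_bump_integrable.
by rewrite mulVf// gt_eqF// scaled_bump_mass_gt0.
Qed.

Lemma pre_bump_le1 x : pre_bump x <= 1 :> R.
Proof.
have h (y : R) : 0 <= flat 0 y <= 1.
  rewrite flat_ge0 /flat /=; case: ifPn => [y0|_]; last exact: ler01.
  by rewrite expr0 mul1r -[leRHS]expR0 ler_expR oppr_le0 invr_ge0 ltW.
rewrite /pre_bump; move: (h (1 + x)) (h (1 - x)) => /andP[a1 a2] /andP[b1 b2]; nra.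
Qed.

Lemma rho_le : exists2 C : R, 0 < C & forall e x, 0 < e -> rho e x <= C / e.
Proof.
have [c c0 hc] := scaled_bump_mass; exists c^-1; first by rewrite invr_gt0.
move=> e x e0; rewrite /rho -invfM.
rewrite -[leRHS]mulr1 ler_pM//.
- by rewrite invr_ge0 ltW// scaled_bump_mass_gt0.
- exact: pre_bump_ge0.
- by rewrite lef_pV2 ?posrE ?scaled_bump_mass_gt0 ?mulr_gt0//; exact: hc.
- exact: pre_bump_le1.
Qed.

End mollifier.

Section test_functions.
Context {R : realType}.
Implicit Types (f phi : R -> R).

Lemma derivable_smooth f : (forall n x, derivable (f^`(n)) x 1) -> smooth f.
Proof.
move=> df n; elim: n f df => [//|n IH] f df; exists (derive1 f).
  by move=> x; apply: derivable_is_derive; exact: (df 0%N).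
by apply: IH => m x; rewrite -derive1Sn; exact: df.
Qed.

Lemma test_functionP phi : test_function phi ->
  smooth phi /\ exists M, supported_in M phi.
Proof.
move=> [dphi cphi]; split; first exact: derivable_smooth.
(* [compact_bounded] bounds the support by every number above M, here M + 1, and at distance M + 2
   the function must vanish. *)
have [M [_ hM]] := compact_bounded cphi; exists (M + 2) => x xM.
apply/eqP; apply: contraT => phix.
have MM : M < M + 1 by rewrite ltrDl.
have clx : closure [set x | phi x != 0] x by exact: subset_closure.
have := hM (M + 1) MM x clx; rewrite /=; by move: xM; lra.
Qed.

End test_functions.

(** * Mollification of L^2 functions and the Sobolev embedding of H^1 *)

Section convolution.
Context {R : realType}.
Local Notation mu := (@lebesgue_measure R).
Implicit Types (f g k : R -> R) (x y z t c M e d : R).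

Lemma ae_imp (P Q : R -> Prop) : {ae mu, forall x, P x} ->
  (forall x, P x -> Q x) -> {ae mu, forall x, Q x}.
Proof.
move=> [A [mA A0 PA]] PQ; exists A; split=> //; apply: subset_trans PA.
by move=> x /=; apply: contra_not; exact: PQ.
Qed.

Lemma ae_and (P Q : R -> Prop) : {ae mu, forall x, P x} ->
  {ae mu, forall x, Q x} -> {ae mu, forall x, P x /\ Q x}.
Proof.
move=> hP hQ; have := negligibleU hP hQ; apply: negligibleS => x /=.
by move=> /not_andP.
Qed.

Definition convol f k x : R := \int[mu]_y (f y * k (x - y)).

Lemma convol_integrable f k x : sqintegrable f -> sqintegrable k ->
  integrableR (fun y => f y * k (x - y)).
Proof. by move=> sf sk; apply: integrableRM => //; exact: sqintegrable_reflect. Qed.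

Lemma convol_le f k x : sqintegrable f -> sqintegrable k ->
  `|convol f k x| <= L2norm f * L2norm k.
Proof.
move=> sf sk; rewrite -(L2norm_reflect x sk).
by apply: cauchy_schwarz => //; exact: sqintegrable_reflect.
Qed.

Lemma sqintegrable_rho e : 0 < e -> sqintegrable (@rho R e).
Proof. by move=> e0; exact: supported_sqintegrable (@continuous_rho _ e) (rho_supported e0). Qed.

(** On a compact set |f| is dominated by 1 + f^2, and constants are integrable there. *)
Lemma sqintegrable_locally f : sqintegrable f -> locally_integrable setT f.
Proof.
move=> [mf f2]; split=> //; first exact: openT.
move=> K _ cK; have mK := compact_measurable cK.
have iK : mu.-integrable K (EFin \o (fun y => 1 + f y ^+ 2)).
  have i1 : mu.-integrable K (EFin \o (fun=> 1)).
    apply: measurable_bounded_integrable => //; first exact: compact_finite_measure.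
    by exists 1; split=> // M M1 x _ /=; rewrite normr1 ltW.
  have i2 : mu.-integrable K (EFin \o (fun y => f y ^+ 2)) by exact: integrableS f2.
  by have := @integrableD _ _ _ mu K mK _ _ i1 i2.
have /integrableP[_] := iK; apply: le_lt_trans.
apply: ge0_le_integral => //.
- by apply/measurable_EFinP/measurableT_comp => //; exact: measurable_funTS.
- apply/measurable_EFinP; apply: measurableT_comp => //.
  by apply: measurable_funTS; apply: measurable_funD => //; exact: measurable_funX.
move=> x _ /=; rewrite lee_fin.
have -> : `|1 + f x ^+ 2| = 1 + `|f x| ^+ 2.
  by rewrite real_normK ?num_real// ger0_norm// addr_ge0// sqr_ge0.
by have := sqr_ge0 (`|f x| - 1); have := normr_ge0 (f x); nra.
Qed.

(** As [rho e] is at most C / e and vanishes outside the ball of radius e, whose length is 2 e, the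
    error is at most 2 C times the mean of |f - f x| over that ball. *)
Lemma convol_rho_lebesgue_pt f x : sqintegrable f -> lebesgue_pt f x ->
  convol f (rho n.+1%:R^-1) x @[n --> \oo] --> f x.
Proof.
move=> sf lx; have [C C0 hC] := @rho_le R.
have [mf _] := sf.
have key e : 0 < e -> (`|convol f (rho e) x - f x|%:E <= (2 * C)%:E * davg f x e)%E.
  move=> e0; have sr := sqintegrable_rho e0.
  have ir := integrableR_reflect x (rho_integrable e0).
  have -> : convol f (rho e) x - f x = \int[mu]_y ((f y - f x) * rho e (x - y)).
    under eq_Rintegral do rewrite mulrBl.
    rewrite RintegralB//; [|exact: convol_integrable|exact: integrableRZ].
    by rewrite RintegralZl// integral_reflect ?integral_rho ?mulr1//; exact: rho_integrable.
  have iD : integrableR (fun y => (f y - f x) * rho e (x - y)).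
    under eq_fun do rewrite mulrBl.
    by apply: integrableRB; [exact: convol_integrable|exact: integrableRZ].
  rewrite EFin_normr_Rintegral//.
  apply: (le_trans (le_abse_integral _ measurableT (measurable_int _ iD))).
  rewrite /davg /iavg lebesgue_measure_ball; last exact: ltW.
  have e2 : 0 < e *+ 2 by rewrite mulrn_wgt0.
  rewrite inver gt_eqF//.
  have mball : measurable (ball x e) by exact: measurable_ball.
  have mg : measurable_fun setT (fun y => `|(f y - f x)%:E|%E).
    by apply/measurable_EFinP; apply: measurableT_comp => //; exact: measurable_funB.
  apply: (@le_trans _ _ (\int[mu]_(y in ball x e) ((C / e)%:E * `|(f y - f x)%:E|))%E).
    rewrite [leRHS]integral_mkcond.
    apply: ge0_le_integral => //.
    - by apply: measurableT_comp => //; exact: measurable_int iD.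
    - apply/(measurable_restrictT _ _).1 => //.
      by apply: measurable_funTS; apply: emeasurable_funM.
    move=> y _; rewrite patchE; case: ifPn => [_|/negP yb].
      rewrite /= normrM lee_fin mulrC (ger0_norm (rho_ge0 _ e0)).
      by apply: ler_wpM2r => //; exact: hC.
    rewrite /= (rho_supported e0) ?mulr0 ?normr0// leNgt; apply/negP => h.
    by apply: yb; rewrite inE.
  rewrite ge0_integralZl//; [|exact: measurable_funTS|by rewrite lee_fin divr_ge0 ?ltW].
  rewrite muleA; apply: lee_wpmul2r; first exact: integral_ge0.
  rewrite -EFinM lee_fin (_ : 2 * C * (e *+ 2)^-1 = C / e)//.
  by rewrite -(mulr_natr e); field; rewrite gt_eqF.
have l2 : ((2 * C)%:E * davg f x r)%E @[r --> 0^'+] --> 0%E.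
  by rewrite -(mule0 (2 * C)%:E); apply: cvgeM => //; exact: cvg_cst.
move/cvge_at_rightP : l2 => /(_ (fun n => n.+1%:R^-1)) l2.
have {}l2 : ((2 * C)%:E * davg f x n.+1%:R^-1)%E @[n --> \oo] --> 0%E.
  by apply: l2; split; [move=> n; rewrite invr_gt0|exact: cvg_harmonic].
apply/subr_cvg0/norm_cvg0P.
have : (`|convol f (rho n.+1%:R^-1) x - f x|%:E)%E @[n --> \oo] --> 0%E.
  apply: (@squeeze_cvge _ _ _ _ (fun=> 0%E) _ (fun n => ((2 * C)%:E * davg f x n.+1%:R^-1)%E)).
  - near=> n; rewrite lee_fin normr_ge0 /=; apply: key; by rewrite invr_gt0.
  - exact: cvg_cst.
  - exact: l2.
by move/fine_cvgP => [].
Unshelve. all: by end_near. Qed.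

Lemma convol_rho_ae f : sqintegrable f ->
  {ae mu, forall x, convol f (rho n.+1%:R^-1) x @[n --> \oo] --> f x}.
Proof.
move=> sf; have := lebesgue_differentiation (sqintegrable_locally sf).
by move/ae_imp; apply=> x; exact: convol_rho_lebesgue_pt.
Qed.


Lemma weak_derivativeP f g phi dphi M : L2_weak_derivative f g -> smooth phi ->
  supported_in M phi -> (forall x, is_derive x 1 phi (dphi x)) ->
  \int[mu]_x (f x * dphi x) = - \int[mu]_x (g x * phi x).
Proof.
move=> [_ fg] sp hM dp; rewrite -(fg _ (smooth_test_function sp hM)).
by apply: eq_Rintegral => x _; rewrite (is_derive_derive1 (dp x)).
Qed.

(** The test function is y -> k (x - y); the sign of its derivative cancels the sign in the
    definition of the weak derivative. *)
Lemma convol_weak_derivative f g k dk M x : sqintegrable f -> L2_weak_derivative f g -> smooth k ->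
  supported_in M k -> (forall x, is_derive x 1 k (dk x)) ->
  convol f dk x = convol g k x.
Proof.
move=> sf fg sk hM dk'; have := @weak_derivativeP f g (fun y => k (x - y))
  (fun y => - dk (x - y)) (M + `|x|) fg (smooth_reflect x sk).
have h1 : supported_in (M + `|x|) (fun y => k (x - y)).
  move=> y hy; apply: hM; have := ler_normB x (x - y).
  by rewrite opprB addrC subrK; lra.
have h2 y : is_derive y 1 (fun y => k (x - y)) (- dk (x - y)) by exact: is_derive_reflect.
move=> /(_ h1 h2); rewrite /convol => h.
have cdk : continuous dk by exact/smooth_continuous/(smoothP sk).
have sdk : sqintegrable dk.
  exact: supported_sqintegrable cdk (supported_derive_in hM cdk dk').
rewrite -[RHS]opprK -h -mulN1r -RintegralZl//; last first.
  under eq_fun do rewrite mulrN.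
  exact/integrableRN/convol_integrable.
by apply: eq_Rintegral => y _; ring.
Qed.

Section difference.
Variables (f g r1 r2 : R -> R) (a b : R).
Hypotheses (sf : sqintegrable f) (fg : L2_weak_derivative f g) (ab : a <= b).
Hypotheses (s1 : smooth r1) (s2 : smooth r2).
Hypotheses (p1 : forall y, 0 <= r1 y) (p2 : forall y, 0 <= r2 y).
Hypotheses (z1 : forall y, ~~ (a <= y <= b) -> r1 y = 0).
Hypotheses (z2 : forall y, ~~ (a <= y <= b) -> r2 y = 0).
Hypotheses (i1 : \int[mu]_y r1 y = 1) (i2 : \int[mu]_y r2 y = 1).

Let M := Num.max `|a| `|b| + 1.

Let far y : M <= `|y| -> ~~ (a <= y <= b).
Proof.
move=> My; apply/negP => /andP[ay yb].
have : `|y| <= Num.max `|a| `|b|.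
  rewrite ler_norml le_max lerNl le_max; apply/andP; split.
    by apply/orP; left; rewrite lerNl; exact: le_trans (lerNnormlW (lexx _)) ay.
  by apply/orP; right; exact: le_trans yb (ler_norm _).
by move: My; rewrite /M; lra.
Qed.

Let m1 : supported_in M r1. Proof. by move=> y /far /z1. Qed.
Let m2 : supported_in M r2. Proof. by move=> y /far /z2. Qed.
Let c1 := smooth_continuous s1.
Let c2 := smooth_continuous s2.
Let n1 := supported_integrable c1 m1.
Let n2 := supported_integrable c2 m2.

(** The one-dimensional Sobolev embedding with averages in place of point values, since f has no
    preferred representative. The difference r1 - r2 has mean zero, hence a primitive k that
    vanishes outside [a, b] and satisfies |k| <= 1. Testing the weak derivative with k gives the
    integral of -g k, and Cauchy-Schwarz produces sqrt (b - a). *)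
Lemma bump_difference : `|\int[mu]_y (f y * r1 y) - \int[mu]_y (f y * r2 y)| <=
  Num.sqrt (b - a) * L2norm g.
Proof.
pose k y := primitive r1 y - primitive r2 y.
have dk y : is_derive y 1 k (r1 y - r2 y).
  by apply: is_derive_fB; exact: is_derive_primitive.
have sk : smooth k by apply: (smooth_step dk); exact: smoothB.
have k0 y : ~~ (a <= y <= b) -> k y = 0.
  rewrite negb_and -!ltNge /k => /orP[ya|by_].
    by rewrite !primitive_left ?subrr// => z zy; [apply: z2|apply: z1];
      rewrite negb_and -!ltNge (le_lt_trans zy ya).
  by rewrite !primitive_right ?i1 ?i2 ?subrr// => z zy; [apply: z2|apply: z1];
    rewrite negb_and -!ltNge (lt_trans by_ zy) orbT.
have k1 y : `|k y| <= 1.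
  have := primitive_ge0 y p1; have := primitive_ge0 y p2.
  have := primitive_le y n1 p1; have := primitive_le y n2 p2.
  by rewrite i1 i2 ler_norml /k; lra.
have mk : supported_in M k by move=> y /far /k0.
have sqk : sqintegrable k := supported_sqintegrable (smooth_continuous sk) mk.
have sg : sqintegrable g by case: fg => /Lfun2P.
rewrite -RintegralB//; [|exact: integrableRM sf (supported_sqintegrable c1 m1)
  |exact: integrableRM sf (supported_sqintegrable c2 m2)].
under eq_Rintegral do rewrite -mulrBr.
rewrite (weak_derivativeP fg sk mk dk) normrN mulrC.
apply: (le_trans (cauchy_schwarz sg sqk)); apply: ler_wpM2l; first exact: L2norm_ge0.
rewrite ler_sqrt ?subr_ge0//.
pose I := `[a, b]%classic.
have muI : mu I = (b - a)%:E.
  rewrite /I lebesgue_measure_itv/= lte_fin; case: ltP => // ba.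
  by rewrite (@le_anti _ _ a b) ?subrr// ab ba.
have -> : b - a = \int[mu]_y (\1_I y).
  rewrite /Rintegral integral_indic; [|exact: measurableT|exact: measurable_itv].
  by rewrite [X in fine X](_ : _ = (b - a)%:E)// setIT.
apply: le_integral_integrableR; first exact: sqintegrable_sqr.
  exact: integrable_indic_itv.
move=> y; rewrite indicE; case: (boolP (y \in I)) => [_|/negP yI].
  by rewrite -(real_normK (num_real (k y))) exprn_ile1.
rewrite k0 ?expr0n//; apply/negP => h; apply: yI.
by rewrite inE /I /= in_itv.
Qed.

End difference.

Lemma rho_reflect_zero e x a b y : 0 < e -> a <= x - e -> x + e <= b ->
  ~~ (a <= y <= b) -> rho e (x - y) = 0.
Proof.
move=> e0 ax xb; rewrite negb_and -!ltNge => h; apply: (rho_supported e0).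
rewrite ler_normr; case/orP: h => h; apply/orP; [left|right]; lra.
Qed.

Lemma convol_rho_difference f g e d x y : sqintegrable f -> L2_weak_derivative f g ->
  0 < e -> 0 < d ->
  `|convol f (rho e) x - convol f (rho d) y| <=
  Num.sqrt (`|x - y| + 2 * e + 2 * d) * L2norm g.
Proof.
move=> sf fg e0 d0.
have ir z c : 0 < c -> \int[mu]_y rho c (z - y) = 1 :> R.
  by move=> c0; rewrite integral_reflect ?integral_rho//; exact: rho_integrable.
wlog xy : x y e d e0 d0 / x <= y => [W|].
  have [xy|yx] := leP x y; first exact: W.
  by rewrite distrC (distrC x) addrAC; apply: W => //; exact: ltW.
have -> : `|x - y| + 2 * e + 2 * d = (y + e + d) - (x - e - d).
  by rewrite distrC ger0_norm ?subr_ge0//; ring.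
apply: (@bump_difference _ _ (fun z => rho e (x - z)) (fun z => rho d (y - z))) => //.
- lra.
- exact/smooth_reflect/smooth_rho.
- exact/smooth_reflect/smooth_rho.
- by move=> z; exact: rho_ge0.
- by move=> z; exact: rho_ge0.
- by move=> z; apply: rho_reflect_zero => //; lra.
- by move=> z; apply: rho_reflect_zero => //; lra.
- exact: ir.
- exact: ir.
Qed.

(** Passing from scale e to scale 1 costs at most 2 times the norm of g, and the average at scale 1
    is bounded by Cauchy-Schwarz; the bound is uniform in e. *)
Lemma convol_rho_sup f g e x : sqintegrable f -> L2_weak_derivative f g ->
  0 < e <= 1 ->
  `|convol f (rho e) x| <= (2 + L2norm (@rho R 1)) * (L2norm f + L2norm g).
Proof.
move=> sf fg /andP[e0 e1].
have s1 : sqintegrable (@rho R 1) by exact: sqintegrable_rho.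
have h1 := convol_le x sf s1.
have h2 := @convol_rho_difference f g e 1 x x sf fg e0 ltr01.
have f0 := L2norm_ge0 f; have g0 := L2norm_ge0 g; have r0 := L2norm_ge0 (@rho R 1).
have s4 : Num.sqrt (`|x - x| + 2 * e + 2 * 1) <= 2.
  apply: (@le_trans _ _ (Num.sqrt (2 ^+ 2))); last by rewrite sqrtr_sqr ger0_norm.
  by rewrite ler_sqrt ?sqr_ge0// subrr normr0; lra.
have h3 : Num.sqrt (`|x - x| + 2 * e + 2 * 1) * L2norm g <= 2 * L2norm g by exact: ler_wpM2r.
have := ler_normD (convol f (rho e) x - convol f (rho 1) x) (convol f (rho 1) x).
rewrite subrK; nra.
Qed.

Lemma H1_sup_ae f g : sqintegrable f -> L2_weak_derivative f g ->
  {ae mu, forall y, `|f y| <= (2 + L2norm (@rho R 1)) * (L2norm f + L2norm g)}.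
Proof.
move=> sf fg; apply: (ae_imp (convol_rho_ae sf)) => y hy.
apply: (cvgr_to_le (cvg_norm hy)); near=> n; apply: convol_rho_sup => //.
by rewrite invr_gt0 ltr0n /= invf_le1 ?ltr0n// ler1n.
Unshelve. all: by end_near. Qed.

(** Almost every value f y is a limit of averages at scales d, and d <= e eventually, whence 4 e in
    place of 2 e + 2 d. *)
Lemma H1_convol_close_ae f g e x : sqintegrable f -> L2_weak_derivative f g -> 0 < e ->
  {ae mu, forall y, `|f y - convol f (rho e) x| <= Num.sqrt (`|x - y| + 4 * e) * L2norm g}.
Proof.
move=> sf fg e0; apply: (ae_imp (convol_rho_ae sf)) => y hy.
have hy' : (convol f (rho n.+1%:R^-1) y - convol f (rho e) x) @[n --> \oo] -->
    f y - convol f (rho e) x by apply: cvgB => //; exact: cvg_cst.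
apply: (cvgr_to_le (cvg_norm hy')); near=> n.
have n0 : 0 < n.+1%:R^-1 :> R by rewrite invr_gt0.
rewrite distrC; apply: (le_trans (convol_rho_difference x y sf fg e0 n0)).
apply: ler_wpM2r; first exact: L2norm_ge0.
have ne : n.+1%:R^-1 <= e.
  by apply: ltW; near: n; exact: (near_infty_natSinv_lt (PosNum e0)).
have N := normr_ge0 (x - y); move: n0 ne; set d := n.+1%:R^-1 => n0 ne.
by rewrite ler_sqrt; lra.
Unshelve. all: by end_near. Qed.

(** The mollifications of g and of h are both equal to the convolution of f with the derivative of
    the mollifier, and they converge almost everywhere. *)
Lemma weak_derivative_unique f g h : sqintegrable f -> L2_weak_derivative f g ->
  L2_weak_derivative f h -> {ae mu, forall x, g x = h x}.
Proof.
move=> sf fg fh; have sg : sqintegrable g by case: fg => /Lfun2P.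
have sh : sqintegrable h by case: fh => /Lfun2P.
apply: (ae_imp (ae_and (convol_rho_ae sg) (convol_rho_ae sh))) => x [hg hh].
suff e : (fun n => convol g (rho n.+1%:R^-1) x) = (fun n => convol h (rho n.+1%:R^-1) x).
  by move: hg; rewrite e => hg; rewrite -(cvg_lim (@Rhausdorff R) hg) (cvg_lim (@Rhausdorff R) hh).
apply/funext => n.
have n0 : 0 < n.+1%:R^-1 :> R by rewrite invr_gt0.
have [sdr dr] := smooth_derive (@smooth_rho R n.+1%:R^-1).
rewrite -(convol_weak_derivative x sf fg (@smooth_rho R _) (rho_supported n0) dr).
by rewrite -(convol_weak_derivative x sf fh (@smooth_rho R _) (rho_supported n0) dr).
Qed.

Lemma L2_weak_derivativeB f1 f2 g1 g2 : sqintegrable f1 -> sqintegrable f2 ->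
  L2_weak_derivative f1 g1 -> L2_weak_derivative f2 g2 ->
  L2_weak_derivative (fun x => f1 x - f2 x) (fun x => g1 x - g2 x).
Proof.
move=> sf1 sf2 fg1 fg2; have sg1 : sqintegrable g1 by case: fg1 => /Lfun2P.
have sg2 : sqintegrable g2 by case: fg2 => /Lfun2P.
split; first by apply/Lfun2P; exact: sqintegrableB.
move=> phi tphi; have [sp [M hM]] := test_functionP tphi.
have [sdp dp] := smooth_derive sp.
have q1 := supported_sqintegrable (smooth_continuous sp) hM.
have q2 := supported_sqintegrable (smooth_continuous sdp)
  (supported_derive_in hM (smooth_continuous sdp) dp).
have IB (h1 h2 k : R -> R) : sqintegrable h1 -> sqintegrable h2 -> sqintegrable k ->
    \int[mu]_x ((h1 x - h2 x) * k x) = \int[mu]_x (h1 x * k x) - \int[mu]_x (h2 x * k x).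
  move=> ? ? ?; rewrite -RintegralB//; try exact: integrableRM.
  by apply: eq_Rintegral => x _; rewrite mulrBl.
rewrite !IB//; case: fg1 => _ ->//; case: fg2 => _ ->//.
by rewrite opprB addrC opprK.
Qed.

End convolution.

(** * The kernel of the resolvent of the Laplacian *)

Section exponential_decay.
Context {R : realType}.
Local Notation mu := (@lebesgue_measure R).
Implicit Types (f g k dk : R -> R) (x y z t c M e d lam C : R).

Definition env lam x : R := expR (- (lam * `|x|)).

Lemma env_ge0 lam x : 0 <= env lam x. Proof. exact: expR_ge0. Qed.

Lemma env_le1 lam x : 0 < lam -> env lam x <= 1.
Proof.
by move=> l0; rewrite -[leRHS]expR0 ler_expR oppr_le0 mulr_ge0// ltW.
Qed.

Lemma env_shift lam x y d : 0 < lam -> `|x - y| <= d ->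
  env lam x <= expR (lam * d) * env lam y.
Proof.
move=> l0 xyd; rewrite /env -expRD ler_expR.
have : `|y| <= `|x| + d.
  have := ler_normB x (x - y); rewrite opprB addrC subrK; lra.
by nra.
Qed.

Lemma continuous_env lam : continuous (env lam).
Proof.
move=> x; apply: continuous_comp; last exact: continuous_expR.
apply: continuousN; apply: continuousM; first exact: cst_continuous.
exact: norm_continuous.
Qed.

(** The two-sided exponential is dominated by the sum of the exponential density and its reflection,
    divided by lam. *)
Lemma integrable_env lam : 0 < lam -> integrableR (env lam).
Proof.
move=> l0; have := @integrable_exponential_pdf R lam l0; set h := exponential_pdf lam.
move=> hi; have hi' : integrableR (fun x => h (0 - x)) by exact: integrableR_reflect.
have hh := integrableRZ lam^-1 (integrableRD hi hi').
apply: (le_integrableR _ hh); first exact: continuous_measurable_fun (@continuous_env lam).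
move=> x; rewrite ger0_norm ?env_ge0// ler_pdivlMl//.
have hE y : 0 <= y -> h y = lam * expR (- lam * y).
  by move=> y0; rewrite /h /exponential_pdf patchE ifT// inE /= in_itv /= y0.
have h0 y : 0 <= h y.
  have [y0|y0] := leP 0 y; first by rewrite hE// mulr_ge0 ?expR_ge0// ltW.
  by rewrite /h /exponential_pdf patchE ifF//; apply/negP; rewrite inE /= in_itv /= leNgt y0.
have [x0|x0] := leP 0 x.
  rewrite /env ger0_norm// -mulNr -hE// lerDl//.
rewrite /env ltr0_norm// -mulNr sub0r -hE ?lerDr// oppr_ge0 ltW//.
Qed.

(** A class of kernels containing both the compactly supported ones and the resolvent kernel, which
    has no compact support. *)
Definition exp_decay lam k :=
  continuous k /\ exists2 C, 0 <= C & forall x, `|k x| <= C * env lam x.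

Section decay_facts.
Variables (lam : R) (l0 : 0 < lam).

Lemma exp_decay_integrable k : exp_decay lam k -> integrableR k.
Proof.
move=> [ck [C C0 hC]]; apply: (le_integrableR _ (integrableRZ C (integrable_env l0)) hC).
exact: continuous_measurable_fun.
Qed.

Lemma exp_decay_sqintegrable k : exp_decay lam k -> sqintegrable k.
Proof.
move=> dk; apply: (@sqintegrable_bounded _ k (sval (cid2 dk.2))).
  exact: exp_decay_integrable.
case: cid2 => C C0 hC x /=; apply: (le_trans (hC x)).
by rewrite -[leRHS]mulr1 ler_wpM2l// env_le1.
Qed.

Lemma exp_decay_env : exp_decay lam (env lam).
Proof.
split; first exact: continuous_env.
by exists 1 => // x; rewrite mul1r ger0_norm// env_ge0.
Qed.

Lemma supported_exp_decay M k : continuous k -> supported_in M k -> exp_decay lam k.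
Proof.
move=> ck hM; split=> //; have [C C0 hC] := supported_bounded ck hM.
exists (C * expR (lam * M)); first by rewrite mulr_ge0// expR_ge0.
move=> x; have [xM|xM] := leP M `|x|.
  by rewrite hM// normr0 !mulr_ge0// ?expR_ge0// env_ge0.
rewrite -[leLHS]mulr1 -mulrA ler_pM// /env -expRD -[leLHS]expR0 ler_expR.
rewrite subr_ge0 ler_pM2l ?ltW//.
Qed.

Lemma exp_decayD f g : exp_decay lam f -> exp_decay lam g ->
  exp_decay lam (fun x => f x + g x).
Proof.
move=> [cf [C C0 hC]] [cg [D D0 hD]]; split.
  by move=> x; apply: continuousD; [exact: cf|exact: cg].
exists (C + D); first exact: addr_ge0.
by move=> x; rewrite mulrDl (le_trans (ler_normD _ _))// lerD.
Qed.

Lemma exp_decayZ f c : exp_decay lam f -> exp_decay lam (fun x => c * f x).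
Proof.
move=> [cf [C C0 hC]]; split.
  by move=> x; apply: continuousM; [exact: cst_continuous|exact: cf].
exists (`|c| * C); first exact: mulr_ge0.
by move=> x; rewrite normrM -mulrA ler_wpM2l.
Qed.

Lemma exp_decayB f g : exp_decay lam f -> exp_decay lam g ->
  exp_decay lam (fun x => f x - g x).
Proof.
move=> df dg; have := exp_decayD df (exp_decayZ (-1) dg).
by congr exp_decay; apply/funext => x; rewrite mulN1r.
Qed.

(** Differentiation under the integral sign: while t stays within 1 of x, moving the centre of the
    envelope from t to x costs the factor exp lam, and the result is integrable against |f|. *)
Lemma is_derive_convol f k dk x : sqintegrable f -> exp_decay lam k ->
  exp_decay lam dk -> (forall z, is_derive z 1 k (dk z)) ->
  is_derive x 1 (convol f k) (convol f dk x).
Proof.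
move=> sf ek edk dk'.
have [cdk [C C0 hC]] := edk.
pose F t y := f y * k (t - y).
have dF t y : is_derive t 1 (F^~ y) (f y * dk (t - y)).
  exact: (is_derive_fZ (f y) (@is_derive_fshift _ k t (- y) _ (dk' (t - y)))).
have d1F t y : partial1of2 F t y = f y * dk (t - y).
  by rewrite /partial1of2 (is_derive_derive1 (dF t y)).
pose G y := `|f y| * (C * expR lam * env lam (x - y)).
have G0 y : 0 <= G y by rewrite !mulr_ge0// ?expR_ge0// env_ge0.
have iG : integrableR G.
  apply: integrableRM; first exact: sqintegrable_norm.
  by apply/sqintegrableZ/sqintegrable_reflect/exp_decay_sqintegrable/exp_decay_env.
have xI : `]x - 1, x + 1[ x by rewrite /= in_itv /=; apply/andP; split; lra.
have iF t : `]x - 1, x + 1[ t -> mu.-integrable setT (EFin \o F t).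
  by move=> _; apply: convol_integrable => //; exact: exp_decay_sqintegrable.
have dF1 t y : `]x - 1, x + 1[ t -> setT y -> derivable (F^~ y) t 1.
  by move=> _ _; exact: is_derive_derivable (dF t y).
have FG t y : `]x - 1, x + 1[ t -> setT y -> `|partial1of2 F t y| <= G y.
  rewrite /= in_itv /= => /andP[t1 t2] _; rewrite d1F normrM /G ler_wpM2l//.
  apply: (le_trans (hC _)); rewrite -mulrA ler_wpM2l//.
  apply: (le_trans (@env_shift lam (t - y) (x - y) 1 l0 _)); last by rewrite mulr1.
  by rewrite opprB addrA subrK ler_norml; lra.
have h1 := derivable_under_integral measurableT xI iF dF1 G0 iG FG.
have h2 := differentiation_under_integral measurableT xI iF dF1 G0 iG FG.
apply: DeriveDef; first exact: h1.
rewrite -derive1E (_ : convol f k = fun t => \int[mu]_y F t y)// h2.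
by apply: eq_Rintegral => y _; rewrite d1F.
Qed.

End decay_facts.

End exponential_decay.

(** * The resolvent kernel applied to a mollifier *)

Section resolvent_kernel.
Context {R : realType}.
Local Notation mu := (@lebesgue_measure R).
Implicit Types (x y z t c e : R).
Variables (be : R) (be0 : 0 < be).

Let up e y := expR (be^-1 * y) * rho e y.
Let dn e y := expR (- be^-1 * y) * rho e y.

(** The parts y < x and y > x of the integral of exp (-|x - y| / be) rho e y. Green's function has a
    kink at the origin; split in this way, the convolution consists of exponentials times primitives
    of smooth functions. *)
Definition kappa_up e x : R := expR (- be^-1 * x) * primitive (up e) x.
Definition kappa_dn e x : R :=
  expR (be^-1 * x) * (\int[mu]_y dn e y - primitive (dn e) x).

(* kappa - be^2 kappa'' = rho e, by variation of parameters *)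
Definition kappa e x : R := (2 * be)^-1 * (kappa_up e x + kappa_dn e x).
Definition dkappa e x : R := (2 * be ^+ 2)^-1 * (kappa_dn e x - kappa_up e x).

Let lam := be^-1.
Let l0 : 0 < lam. Proof. by rewrite invr_gt0. Qed.

Let smooth_weight s e : smooth (fun y => expR (s * y) * rho e y : R).
Proof. by apply: smoothM; [exact: smooth_expR|exact: smooth_rho]. Qed.

Let supported_weight s e : 0 < e -> supported_in e (fun y => expR (s * y) * rho e y : R).
Proof. by move=> e0 y ey; rewrite rho_supported// mulr0. Qed.

Let integrable_weight s e : 0 < e -> integrableR (fun y => expR (s * y) * rho e y : R).
Proof.
move=> e0; apply: supported_integrable (supported_weight s e0).
exact/smooth_continuous/smooth_weight.
Qed.

Let is_derive_weight s e x : 0 < e ->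
  is_derive x 1 (primitive (fun y => expR (s * y) * rho e y)) (expR (s * x) * rho e x).
Proof.
move=> e0; apply: is_derive_primitive; last exact: integrable_weight.
exact/smooth_continuous/smooth_weight.
Qed.

Let smooth_primitive s e : 0 < e ->
  smooth (primitive (fun y => expR (s * y) * rho e y)).
Proof.
by move=> e0; apply: smooth_step (smooth_weight s e) => x; exact: is_derive_weight.
Qed.

Lemma smooth_kappa_up e : 0 < e -> smooth (kappa_up e).
Proof. by move=> e0; apply: smoothM; [exact: smooth_expR|exact: smooth_primitive]. Qed.

Lemma smooth_kappa_dn e : 0 < e -> smooth (kappa_dn e).
Proof.
move=> e0; apply: smoothM; first exact: smooth_expR.
by apply: smoothB; [exact: smooth_cst|exact: smooth_primitive].
Qed.

Lemma smooth_kappa e : 0 < e -> smooth (kappa e).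
Proof.
by move=> e0; apply/smoothZ/smoothD; [exact: smooth_kappa_up|exact: smooth_kappa_dn].
Qed.

Lemma is_derive_kappa_up e x : 0 < e ->
  is_derive x 1 (kappa_up e) (rho e x - be^-1 * kappa_up e x).
Proof.
move=> e0; apply: (is_derive_eq (is_derive_fM (is_derive_fcomp (is_derive_fZ (- be^-1)
  (is_derive_id x 1)) (is_derive_expR _)) (is_derive_weight be^-1 x e0))).
rewrite /kappa_up [in X in _ + X]mulrA -expRD mulNr addNr expR0; ring.
Qed.

Lemma is_derive_kappa_dn e x : 0 < e ->
  is_derive x 1 (kappa_dn e) (be^-1 * kappa_dn e x - rho e x).
Proof.
move=> e0; apply: (is_derive_eq (is_derive_fM (is_derive_fcomp (is_derive_fZ be^-1
  (is_derive_id x 1)) (is_derive_expR _))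
  (is_derive_fB (is_derive_fcst x _) (is_derive_weight (- be^-1) x e0)))).
rewrite /kappa_dn sub0r mulrN [in X in _ - X]mulrA -expRD mulNr addrN expR0; ring.
Qed.

Lemma is_derive_kappa e x : 0 < e -> is_derive x 1 (kappa e) (dkappa e x).
Proof.
move=> e0; apply: (is_derive_eq (is_derive_fZ _ (is_derive_fD
  (is_derive_kappa_up x e0) (is_derive_kappa_dn x e0)))).
by rewrite /dkappa; field; rewrite gt_eqF.
Qed.

Lemma is_derive_dkappa e x : 0 < e ->
  is_derive x 1 (dkappa e) (be ^- 2 * (kappa e x - rho e x)).
Proof.
move=> e0; apply: (is_derive_eq (is_derive_fZ _ (is_derive_fB
  (is_derive_kappa_dn x e0) (is_derive_kappa_up x e0)))).
by rewrite /kappa; field; rewrite gt_eqF.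
Qed.

Let weight_le s e y : 0 < e <= 1 -> `|s| <= lam ->
  0 <= expR (s * y) * rho e y <= expR lam * rho e y.
Proof.
move=> /andP[e0 e1] sl; have r0 := rho_ge0 y e0.
rewrite mulr_ge0 ?expR_ge0//=.
have [ey|ey] := leP e `|y|; first by rewrite rho_supported// !mulr0.
rewrite ler_wpM2r// ler_expR (le_trans (ler_norm _))// normrM.
have := normr_ge0 s; have := normr_ge0 y; nra.
Qed.

Let mass_le s e : 0 < e <= 1 -> `|s| <= lam ->
  \int[mu]_y (expR (s * y) * rho e y) <= expR lam.
Proof.
move=> ee sl; have /andP[e0 e1] := ee.
rewrite -[leRHS]mulr1 -(integral_rho e0) -RintegralZl//; last exact: rho_integrable.
apply: le_integral_integrableR; first exact: integrable_weight.
  exact/integrableRZ/rho_integrable.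
by move=> y; have /andP[] := weight_le y ee sl.
Qed.

(** To the left of -1 the integral is empty, as [rho e] lives in [-1, 1]. Elsewhere the integral is
    at most exp lam, and exp (-lam x) <= exp (2 lam) [env lam x] for x > -1, which explains 3
    lam. *)
Lemma kappa_up_le e x : 0 < e <= 1 -> 0 <= kappa_up e x <= expR (3 * lam) * env lam x.
Proof.
move=> ee; have /andP[e0 e1] := ee.
have sl : `|lam| <= lam by rewrite gtr0_norm.
have w0 y : 0 <= up e y by have /andP[] := weight_le y ee sl.
have P0 := primitive_ge0 x w0.
have P1 := le_trans (primitive_le x (integrable_weight lam e0) w0) (mass_le ee sl).
rewrite /kappa_up mulr_ge0 ?expR_ge0//=.
have [x1|x1] := leP x (-1).
  rewrite primitive_left ?mulr0 ?mulr_ge0 ?expR_ge0 ?env_ge0// => y yx.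
  by apply: supported_weight => //; rewrite ler_normr; apply/orP; right; lra.
apply: (@le_trans _ _ (expR (- be^-1 * x) * expR lam)).
  by rewrite ler_wpM2l// expR_ge0.
rewrite /env -!expRD ler_expR -/lam; move: l0; generalize lam => L L0.
by have [x0|x0] := leP 0 x; [rewrite ger0_norm//|rewrite ltr0_norm//]; nra.
Qed.

Lemma kappa_dn_le e x : 0 < e <= 1 -> 0 <= kappa_dn e x <= expR (3 * lam) * env lam x.
Proof.
move=> ee; have /andP[e0 e1] := ee.
have sl : `|- lam| <= lam by rewrite normrN gtr0_norm.
have w0 y : 0 <= dn e y by have /andP[] := weight_le y ee sl.
have P0 := primitive_ge0 x w0.
have P2 := primitive_le x (integrable_weight (- lam) e0) w0.
have P1 := mass_le ee sl.
have P3 : 0 <= \int[mu]_y dn e y - primitive (dn e) x by rewrite subr_ge0.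
rewrite /kappa_dn mulr_ge0 ?expR_ge0//=.
have [x1|x1] := leP 1 x.
  rewrite primitive_right ?subrr ?mulr0 ?mulr_ge0 ?expR_ge0 ?env_ge0// => y yx.
  by apply: supported_weight => //; rewrite ler_normr; apply/orP; left; lra.
apply: (@le_trans _ _ (expR (be^-1 * x) * expR lam)).
  by rewrite ler_wpM2l ?expR_ge0//; move: P0 P1; rewrite -/(dn e); lra.
rewrite /env -!expRD ler_expR -/lam; move: l0; generalize lam => L L0.
by have [x0|x0] := leP 0 x; [rewrite ger0_norm//|rewrite ltr0_norm//]; nra.
Qed.

Definition kappa_cst := be^-1 * expR (3 * lam).

Lemma kappa_ge0 e x : 0 < e <= 1 -> 0 <= kappa e x.
Proof.
move=> ee; have /andP[a _] := kappa_up_le x ee; have /andP[b _] := kappa_dn_le x ee.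
by rewrite mulr_ge0 ?addr_ge0// invr_ge0 mulr_ge0// ltW.
Qed.

Lemma kappa_le e x : 0 < e <= 1 -> kappa e x <= kappa_cst * env lam x.
Proof.
move=> ee; have /andP[_ a] := kappa_up_le x ee; have /andP[_ b] := kappa_dn_le x ee.
rewrite /kappa /kappa_cst invfM [2^-1 * _]mulrC -!mulrA ler_wpM2l ?invr_ge0 ?(ltW be0)//; lra.
Qed.

(** Both halves of the kernel are nonnegative, so their difference is bounded by their sum. Thus
    every bound for [kappa] also serves for its derivative. *)
Lemma dkappa_le e x : 0 < e <= 1 -> be * `|dkappa e x| <= kappa e x.
Proof.
move=> ee; have /andP[a _] := kappa_up_le x ee; have /andP[b _] := kappa_dn_le x ee.
have bn0 : be != 0 by rewrite gt_eqF.
rewrite /dkappa normrM gtr0_norm ?invr_gt0 ?mulr_gt0 ?exprn_gt0//.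
have -> : be * ((2 * be ^+ 2)^-1 * `|kappa_dn e x - kappa_up e x|) =
  (2 * be)^-1 * `|kappa_dn e x - kappa_up e x| by field.
rewrite ler_wpM2l ?invr_ge0 ?mulr_ge0 ?(ltW be0)// ler_norml; lra.
Qed.

Lemma exp_decay_kappa e : 0 < e <= 1 -> exp_decay lam (kappa e).
Proof.
move=> ee; have /andP[e0 _] := ee; split; first exact/smooth_continuous/smooth_kappa.
exists kappa_cst; first by rewrite mulr_ge0 ?expR_ge0// invr_ge0 ltW.
by move=> x; rewrite ger0_norm ?kappa_ge0// kappa_le.
Qed.

Lemma smooth_dkappa e : 0 < e -> smooth (dkappa e).
Proof.
by move=> e0; apply: (smoothP (smooth_kappa e0)) => x; exact: is_derive_kappa.
Qed.

Lemma exp_decay_dkappa e : 0 < e <= 1 -> exp_decay lam (dkappa e).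
Proof.
move=> ee; have /andP[e0 _] := ee; split; first exact/smooth_continuous/smooth_dkappa.
exists (be^-1 * kappa_cst); first by rewrite !mulr_ge0 ?expR_ge0// invr_ge0 ltW.
move=> x; rewrite -mulrA ler_pdivlMl//; exact: le_trans (dkappa_le x ee) (kappa_le x ee).
Qed.

End resolvent_kernel.

(** * Time derivatives of the mollified solution *)

Section limits.
Context {R : realType}.
Local Notation mu := (@lebesgue_measure R).
Implicit Types (f g k : R -> R) (x y z t c M e d b : R).

Lemma is_derive_eps f t b : (forall e, 0 < e -> exists2 d, 0 < d &
    forall h, `|h| < d -> `|f (t + h) - f t - h * b| <= e * `|h|) ->
  is_derive t 1 f b.
Proof.
move=> H.
have key : h^-1 *: (f (h *: 1 + t) - f t) @[h --> 0^'] --> b.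
  apply/cvgrPdist_le => /= e e0; have [d d0 hd] := H e e0.
  near=> h.
  have hn0 : h != 0 by near: h; exact: nbhs_dnbhs_neq.
  have h0 : 0 < `|h| by rewrite normr_gt0.
  have hd' : `|h| < d.
    by near: h; exact: dnbhs0_lt.
  have hh := hd h hd'; rewrite /GRing.scale /= mulr1 (addrC h t).
  rewrite (_ : b - h^-1 * (f (t + h) - f t) = - (h^-1 * (f (t + h) - f t - h * b))); last by field.
  by rewrite normrN normrM normfV ler_pdivrMl// [leRHS]mulrC.
apply: DeriveDef; first by apply/cvg_ex; exists b.
exact: cvg_lim key.
Unshelve. all: by end_near. Qed.

(** By the mean value theorem the increments of fn n between t and t + h differ from h b by at most
    e |h|, for all large n and small h; this survives the pointwise limit. *)
Lemma is_derive_limit (fn dfn : nat -> R -> R) f t b :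
  (forall s, fn n s @[n --> \oo] --> f s) ->
  (forall e, 0 < e -> exists2 d, 0 < d & exists N, forall n s, (N <= n)%N ->
     `|s - t| < d -> is_derive s 1 (fn n) (dfn n s) /\ `|dfn n s - b| <= e) ->
  is_derive t 1 f b.
Proof.
move=> fnf H; apply: is_derive_eps => e e0; have [d d0 [N hN]] := H e e0.
exists d => // h hd.
have cv : `|fn n (t + h) - fn n t - h * b| @[n --> \oo] --> `|f (t + h) - f t - h * b|.
  by apply: cvg_norm; apply: cvgB; [exact: cvgB|exact: cvg_cst].
apply: (cvgr_to_le cv); near=> n.
have Nn : (N <= n)%N by near: n; exact: nbhs_infty_ge.
have main (p q : R) : p <= q -> `|p - t| < d -> `|q - t| < d ->
    `|fn n q - fn n p - (q - p) * b| <= e * (q - p).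
  move=> pq pd qd.
  have seg x : x \in `[p, q]%R -> `|x - t| < d.
    rewrite in_itv /= => /andP[px xq]; move: pd qd; rewrite !ltr_norml; lra.
  have der x : x \in `]p, q[%R -> is_derive x 1 (fn n) (dfn n x).
    move=> xpq; apply: (hN n x Nn _).1; apply: seg.
    exact: (subset_itv_oo_cc xpq).
  have con : {within `[p, q], continuous (fn n)}.
    apply: continuous_in_subspaceT => x; rewrite inE /= => xpq.
    apply: is_derive_continuous (hN n x Nn _).1; exact: seg.
  have [x xpq ->] := MVT_segment pq der con.
  have qp : 0 <= q - p by rewrite subr_ge0.
  rewrite (_ : _ - _ = (dfn n x - b) * (q - p)); last by ring.
  rewrite normrM (ger0_norm qp); apply: ler_wpM2r => //.
  by apply: (hN n x Nn _).2; exact: seg.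
have e1 : t + h - t = h by ring.
have e2 : t - (t + h) = - h by ring.
have [h0|h0] := leP 0 h.
  have := main t (t + h); rewrite e1 subrr normr0 (ger0_norm h0) lerDl; apply=> //.
  by rewrite ger0_norm// in hd.
have := main (t + h) t; rewrite e1 e2 subrr normr0 (ltr0_norm h0) gerDl => hh.
rewrite -normrN.
have -> : - (fn n (t + h) - fn n t - h * b) = fn n t - fn n (t + h) - - h * b by ring.
by apply: hh => //; [exact: ltW|rewrite -(ltr0_norm h0)].
Unshelve. all: by end_near. Qed.

End limits.

(** * Continuous curves in L^2 *)

Section curves.
Context {R : realType}.
Local Notation mu := (@lebesgue_measure R).
Implicit Types (f g k h : R -> R) (x y z s t c M e d b : R) (V W : R -> R -> R).

Definition L2curve V := (forall t, sqintegrable (V t)) /\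
  forall t, L2norm (fun x => V s x - V t x) @[s --> t] --> 0.

Lemma cvg0_le (F G : R -> R) t : (forall s, `|F s| <= G s) -> G s @[s --> t] --> 0 ->
  F s @[s --> t] --> 0.
Proof.
move=> FG G0; apply/norm_cvg0P; apply: (squeeze_cvgr _ (cvg_cst 0) G0).
by near=> s; rewrite normr_ge0 FG.
Unshelve. all: by end_near. Qed.

Lemma L2norm_lip f g : sqintegrable f -> sqintegrable g ->
  `|L2norm f - L2norm g| <= L2norm (fun x => f x - g x).
Proof.
move=> sf sg; have sfg := sqintegrableB sf sg.
have := L2normD sfg sg; have := L2normD (sqintegrableN sfg) sf.
have -> : (fun x => - (f x - g x) + f x) = g by apply/funext => x; ring.
have -> : (fun x => f x - g x + g x) = f by apply/funext => x; ring.
have -> : L2norm (fun x => - (f x - g x)) = L2norm (fun x => f x - g x).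
  by rewrite /L2norm; under eq_Rintegral do rewrite sqrrN.
by rewrite ler_norml; lra.
Qed.

Lemma L2curve_norm V t : L2curve V -> L2norm (V s) @[s --> t] --> L2norm (V t).
Proof.
move=> [sV cV]; apply/subr_cvg0; apply: (cvg0_le _ (cV t)) => s; exact: L2norm_lip.
Qed.

Lemma L2curve_pairing V h t : L2curve V -> sqintegrable h ->
  (\int[mu]_x (V s x * h x)) @[s --> t] --> \int[mu]_x (V t x * h x).
Proof.
move=> [sV cV] sh; apply/subr_cvg0.
apply: (@cvg0_le _ (fun s => L2norm (fun x => V s x - V t x) * L2norm h)) => [s|].
  rewrite -RintegralB//; try exact: integrableRM.
  under eq_Rintegral do rewrite -mulrBl.
  by apply: cauchy_schwarz => //; exact: sqintegrableB.
by rewrite -[X in _ --> X](mul0r (L2norm h)); apply: cvgM => //; exact: cvg_cst.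
Qed.

Lemma L2curve_bounded V t : L2curve V ->
  exists2 d, 0 < d & forall s, `|s - t| < d -> L2norm (V s) <= L2norm (V t) + 1.
Proof.
move=> cV; have h := L2curve_norm (t := t) cV.
have /cvgr_dist_le/(_ _ ltr01) := h => -[d /= d0 hd]; exists d => // s st.
have := hd s; rewrite /= distrC => /(_ st); rewrite ler_norml; lra.
Qed.

Lemma L2curveZ V c : L2curve V -> L2curve (fun t x => c * V t x).
Proof.
move=> [sV cV]; split=> t; first exact: sqintegrableZ.
have h : (`|c| * L2norm (fun x => V s x - V t x)) @[s --> t] --> (0 : R).
  by rewrite -[X in _ --> X](mulr0 `|c|); apply: cvgM; [exact: cvg_cst|exact: cV].
apply: (cvg0_le _ h) => s; rewrite ger0_norm ?L2norm_ge0//.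
rewrite -L2normZ; last exact: sqintegrableB.
rewrite le_eqVlt; apply/orP; left; apply/eqP; congr L2norm; apply/funext => x; ring.
Qed.

End curves.

(** * Test functions with separated variables *)

Section product_test.
Context {R : realType}.
Implicit Types (p q psi : R -> R) (M : R).

Lemma continuous_tensor p q : continuous p -> continuous q ->
  continuous (fun z : R * R => p z.1 * q z.2).
Proof.
move=> cp cq z; apply: (@continuousM _ _ (fun z => p z.1) (fun z => q z.2)).
  by apply: continuous_comp; [exact: cvg_fst|exact: cp].
by apply: continuous_comp; [exact: cvg_snd|exact: cq].
Qed.

Lemma dt_tensor p q (dp : R -> R) : (forall t : R, is_derive t 1 p (dp t)) ->
  dt (fun t x => p t * q x) = fun t x => dp t * q x.
Proof.
move=> hp; apply/funext => t; apply/funext => x.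
rewrite [LHS](is_derive_derive1 (is_derive_fM (hp t) (is_derive_fcst t (q x)))); ring.
Qed.

Lemma dx_tensor p q (dq : R -> R) : (forall x : R, is_derive x 1 q (dq x)) ->
  dx (fun t x => p t * q x) = fun t x => p t * dq x.
Proof.
move=> hq; apply/funext => t; apply/funext => x.
exact: (is_derive_derive1 (is_derive_fZ (p t) (hq x))).
Qed.

Lemma Ck_tensor k p q : smooth p -> smooth q -> Ck k (fun t x => p t * q x).
Proof.
elim: k p q => [|k IH] p q sp sq; split=> //.
- by apply: continuous_tensor; exact: smooth_continuous.
- by apply: continuous_tensor; exact: smooth_continuous.
- have [sdp hp] := smooth_derive sp; have [sdq hq] := smooth_derive sq.
  split.
  + by move=> t x; exact: (is_derive_derivable (is_derive_fM (hp t) (is_derive_fcst t (q x)))).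
  + by move=> t x; exact: (is_derive_derivable (is_derive_fZ (p t) (hq x))).
  + by rewrite (dt_tensor _ hp); exact: IH.
  + by rewrite (dx_tensor _ hq); exact: IH.
Qed.

Lemma test_function2_tensor p q M N : smooth p -> smooth q -> supported_in M p ->
  supported_in N q -> test_function2 (fun t x => p t * q x).
Proof.
move=> sp sq hM hN; split; first by move=> k; exact: Ck_tensor.
have cK : compact (`[- M, M]%classic `*` `[- N, N]%classic : set (R * R)).
  by apply: compact_setX; exact: segment_compact.
apply: (subclosed_compact _ cK); first exact: closed_closure.
have clK : closed (`[- M, M]%classic `*` `[- N, N]%classic : set (R * R)).
  exact: (compact_closed (@norm_hausdorff _ _) cK).
rewrite [X in _ `<=` X](closure_id _).1//; apply: closure_subset => z /= h.
rewrite /= !in_itv /= -!ler_norml; split.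
  by rewrite leNgt; apply: contra h => /ltW /hM ->; rewrite mul0r.
by rewrite leNgt; apply: contra h => /ltW /hN ->; rewrite mulr0.
Qed.

End product_test.

(** * The lemma of du Bois-Reymond *)

Section continuous_mollification.
Context {R : realType}.
Local Notation mu := (@lebesgue_measure R).
Implicit Types (f F g k h p : R -> R) (x y z s t c M e d b : R).

Lemma continuous_mul f g : continuous f -> continuous g -> continuous (fun x => f x * g x).
Proof. by move=> cf cg x; apply: continuousM; [exact: cf|exact: cg]. Qed.

Lemma continuous_reflect f c : continuous f -> continuous (fun x => f (c - x)).
Proof.
move=> cf x; apply: continuous_comp; last exact: cf.
by apply: continuousB; [exact: cst_continuous|].
Qed.

Lemma supported_reflect M k c : supported_in M k ->
  supported_in (M + `|c|) (fun x => k (c - x)).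
Proof.
move=> hM y hy; apply: hM; have := ler_normB c (c - y).
by rewrite opprB addrC subrK; lra.
Qed.

Lemma continuous_kernel_integrable F k M t : continuous F -> continuous k ->
  supported_in M k -> integrableR (fun s => F s * k (t - s)).
Proof.
move=> cF ck hM; apply: (@supported_integrable _ (M + `|t|)).
  by apply: continuous_mul => //; exact: continuous_reflect.
by move=> s hs; rewrite (supported_reflect (c := t) hM) ?mulr0.
Qed.

Lemma convol_close F e t c d : continuous F -> 0 < e ->
  (forall s, `|s - t| <= e -> `|F s - c| <= d) -> `|convol F (rho e) t - c| <= d.
Proof.
move=> cF e0 H.
have cr := @continuous_rho R e; have sr := @rho_supported R e e0.
have ir := integrableR_reflect t (rho_integrable e0).
have iF := continuous_kernel_integrable t cF cr sr.
have d0 : 0 <= d.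
  by apply: (le_trans (normr_ge0 (F t - c))); apply: H; rewrite subrr normr0 ltW.
have -> : convol F (rho e) t - c = \int[mu]_s ((F s - c) * rho e (t - s)).
  under eq_Rintegral do rewrite mulrBl.
  rewrite RintegralB//; last exact: integrableRZ.
  by rewrite RintegralZl// integral_reflect ?integral_rho ?mulr1//; exact: rho_integrable.
have iD : integrableR (fun s => (F s - c) * rho e (t - s)).
  under eq_fun do rewrite mulrBl.
  by apply: integrableRB => //; exact: integrableRZ.
apply: (le_trans (le_normr_Rintegral measurableT iD)).
rewrite -[leRHS]mulr1 -(integral_rho e0) -(integral_reflect t (rho_integrable e0)) -RintegralZl//.
apply: le_integral_integrableR; [exact: integrableR_norm|exact: integrableRZ|].
move=> s; rewrite normrM (ger0_norm (rho_ge0 _ e0)).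
have [es|es] := leP e `|t - s|; first by rewrite sr// !mulr0.
by rewrite ler_wpM2r ?rho_ge0// H// distrC ltW.
Qed.

(** [is_derive_convol] is about square-integrable functions, whereas a function of time is merely
    continuous. Near a given point, a convolution with a compactly supported kernel does not see the
    truncation. *)
Definition truncate M F x := F x * \1_(`[- M, M]%classic) x.

Lemma truncate_sqintegrable M F : continuous F -> sqintegrable (truncate M F).
Proof.
move=> cF.
have mI : measurable_fun setT (\1_(`[- M, M]%classic) : R -> R).
  by apply: measurable_indic; exact: measurable_itv.
have mT : measurable_fun setT (truncate M F).
  by apply: measurable_funM => //; exact: continuous_measurable_fun.
split=> //.
have := @continuous_compact_integrable R (fun x => F x ^+ 2) `[- M, M] (@segment_compact R (- M) M)
  (continuous_within_itv (continuous_mul cF cF)).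
rewrite integrable_mkcond//; congr integrable; apply/funext => x /=.
rewrite patchE /truncate indicE; case: (x \in _); first by rewrite mulr1.
by rewrite mulr0 expr0n.
Qed.

Lemma convol_truncate F k e M t : supported_in e k -> `|t| + e <= M ->
  convol (truncate M F) k t = convol F k t.
Proof.
move=> hk tM; apply: eq_Rintegral => s _; rewrite /truncate indicE.
have [es|es] := leP e `|t - s|; first by rewrite hk// !mulr0.
rewrite mem_set ?mulr1//= in_itv /= -ler_norml.
by have := ler_normB t (t - s); rewrite opprB addrC subrK; lra.
Qed.

Lemma is_derive_convol_continuous F k dk e t : continuous F -> continuous k ->
  continuous dk -> supported_in e k -> (forall z, is_derive z 1 k (dk z)) ->
  is_derive t 1 (convol F k) (convol F dk t).
Proof.
move=> cF ck cdk hk dk'.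
have hdk := supported_derive_in hk cdk dk'.
have hk' : supported_in (e + 1) k by apply: supported_inW hk; rewrite lerDl.
pose M := `|t| + e + 2.
have h : is_derive t 1 (convol (truncate M F) k) (convol (truncate M F) dk t).
  apply: (@is_derive_convol _ 1) => //; first exact: truncate_sqintegrable.
    exact: supported_exp_decay ck hk.
  exact: supported_exp_decay cdk hdk.
rewrite (convol_truncate _ hdk) in h; last by rewrite /M; lra.
apply: near_eq_is_derive h; near=> s; apply: (convol_truncate _ hk').
have : `|s| < `|t| + 1.
  near: s; have := @norm_continuous _ R t; rewrite /continuous_at => hn.
  by apply: (cvgr_lt _ hn); rewrite ltrDl.
rewrite /M; lra.
Unshelve. all: by end_near. Qed.

(** The hypothesis with p = rho e (s - .) says that the mollification of E has the mollification of
    B as its derivative. By continuity both converge locally uniformly, and [is_derive_limit]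
    applies. *)
Lemma du_Bois_Reymond E B t : continuous E -> continuous B ->
  (forall p dp M, smooth p -> supported_in M p -> (forall s, is_derive s 1 p (dp s)) ->
     \int[mu]_s (dp s * E s + p s * B s) = 0) ->
  is_derive t 1 E (B t).
Proof.
move=> cE cB H.
have key e s : 0 < e -> is_derive s 1 (convol E (rho e)) (convol B (rho e) s).
  move=> e0; have [sdr dr] := smooth_derive (@smooth_rho R e).
  have cr := @continuous_rho R e; have sr := @rho_supported R e e0.
  have cdr := smooth_continuous sdr.
  have sdr' := supported_derive_in sr cdr dr.
  have dp z : is_derive z 1 (fun z => rho e (s - z)) (- derive1 (rho e) (s - z)).
    exact: is_derive_reflect.
  have := H _ _ _ (smooth_reflect s (@smooth_rho R e)) (supported_reflect (c := s) sr) dp.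
  have i1 := continuous_kernel_integrable s cE cdr sdr'.
  have i2 := continuous_kernel_integrable s cB cr sr.
  have -> : \int[mu]_z (- derive1 (rho e) (s - z) * E z + rho e (s - z) * B z) =
      convol B (rho e) s - convol E (derive1 (rho e)) s.
    rewrite -RintegralB//; apply: eq_Rintegral => z _; ring.
  move=> h0; have -> : convol B (rho e) s = convol E (derive1 (rho e)) s by lra.
  exact: is_derive_convol_continuous cE cr cdr sr dr.
have n0 n : 0 < n.+1%:R^-1 :> R by rewrite invr_gt0.
have close F : continuous F -> forall s d, 0 < d -> exists2 c, 0 < c & forall e s', 0 < e ->
    e < c -> `|s' - s| < c -> `|convol F (rho e) s' - F s| <= d.
  move=> cF s d d0; have /cvgr_dist_le/(_ _ d0) := cF s => -[c /= c0 hc].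
  exists (c / 2); first by rewrite divr_gt0.
  move=> e s' e0 ec s'c; apply: convol_close => // r hr; rewrite distrC; apply: hc => /=.
  rewrite distrC; have := ler_normD (r - s') (s' - s); rewrite addrA subrK; lra.
apply: (@is_derive_limit _ (fun n => convol E (rho n.+1%:R^-1))
  (fun n => convol B (rho n.+1%:R^-1))).
  move=> s; apply/cvgrPdist_le => /= d d0; have [c c0 hc] := close E cE s d d0.
  near=> n; rewrite distrC; apply: hc => //; last by rewrite subrr normr0.
  by near: n; exact: (near_infty_natSinv_lt (PosNum c0)).
move=> d d0; have [c c0 hc] := close B cB t d d0.
exists c => //; have [N _ hN] := near_infty_natSinv_lt (PosNum c0).
exists N => n s Nn sc; split; first exact: key.
by apply: hc => //; exact: hN.
Unshelve. all: by end_near. Qed.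

End continuous_mollification.

Section arithmetic.
Context {R : realType}.
Implicit Types (x y S T a b c d : R).

Lemma normD_le x y S T : `|x| <= S -> `|y| <= T -> `|x + y| <= S + T.
Proof. by move=> xS yT; apply: (le_trans (ler_normD _ _)); exact: lerD. Qed.

Lemma normMn_le n x S : `|x| <= S -> `|n%:R * x| <= n%:R * S.
Proof. by move=> xS; rewrite normrM normr_nat ler_wpM2l. Qed.

(** The four error sums in [cutoff_exists]: T stands for the tail and S for a term in which the
    cutoff is differentiated; 7 = 1 + 3 + 3 adds the binomial coefficients of the third
    derivative. *)
Lemma cutoff_arith T S : 0 <= S ->
  [/\ T <= T + 7 * S, T + S <= T + 7 * S, T + S + 2%:R * S <= T + 7 * S &
      T + S + 3%:R * S + 3%:R * S <= T + 7 * S].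
Proof. by move=> S0; split; lra. Qed.

Lemma le_sum4 a b c d : 0 <= a -> 0 <= b -> 0 <= c -> 0 <= d ->
  [/\ a <= a + b + c + d, b <= a + b + c + d, c <= a + b + c + d & d <= a + b + c + d].
Proof. by move=> *; split; lra. Qed.

Lemma mul_lt_le a b c : 0 < a -> a * (b + 1) < c -> a * b <= c.
Proof. by move=> *; nra. Qed.

Lemma le_sum3 a b c : 0 <= a -> 0 <= b -> 0 <= c ->
  [/\ a <= a + b + c, b <= a + b + c & c <= a + b + c].
Proof. by move=> *; split; lra. Qed.

End arithmetic.

(* The common shape of the two equations: (V, W, Z) is (eta, u, u eta) or (u, eta, u^2/2). *)
Section weak_equation.
Context {R : realType}.
Local Notation mu := (@lebesgue_measure R).
Implicit Types (x y z s t c M e d : R).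
Variables (V W Z : R -> R -> R) (a b : R).
Hypotheses (cV : L2curve V) (cW : L2curve W) (cZ : L2curve Z).
Hypothesis weak : forall phi, test_function2 phi ->
  \int[mu]_t (\int[mu]_x
      (V t x * (dt phi t x - b * dx (dx (dt phi)) t x)
       + a * W t x * dx (dx (dx phi)) t x
       + (W t x + Z t x) * dx phi t x)) = 0.

(** Here ki stands for the i-th derivative of k0. With all space derivatives moved to the kernel,
    the equation reads E' = B. *)
Let E (k0 k2 : R -> R) t := \int[mu]_x (V t x * (k0 x - b * k2 x)).
Let B (k1 k3 : R -> R) t := \int[mu]_x (W t x * (a * k3 x + k1 x)) + \int[mu]_x (Z t x * k1 x).

Section test_kernel.
Variables (k0 k1 k2 k3 : R -> R).
Hypotheses (d0 : forall x, is_derive x 1 k0 (k1 x)) (d1 : forall x, is_derive x 1 k1 (k2 x))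
  (d2 : forall x, is_derive x 1 k2 (k3 x)).

(** Test functions p (t) k0 (x) reduce the system to a distributional differential equation in time
    with continuous E and B, to which [du_Bois_Reymond] applies. *)
Lemma pairing_derivative_test M t : smooth k0 -> supported_in M k0 ->
  is_derive t 1 (E k0 k2) (B k1 k3 t).
Proof.
move=> s0 h0.
have s1 := smoothP s0 d0; have s2 := smoothP s1 d1; have s3 := smoothP s2 d2.
have [c0 c1 c2 c3] : [/\ continuous k0, continuous k1, continuous k2 & continuous k3].
  by split; exact: smooth_continuous.
have h1 := supported_derive_in h0 c1 d0; have h2 := supported_derive_in h1 c2 d1.
have h3 := supported_derive_in h2 c3 d2.
have q0 := supported_sqintegrable c0 h0; have q1 := supported_sqintegrable c1 h1.
have q2 := supported_sqintegrable c2 h2; have q3 := supported_sqintegrable c3 h3.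
have qE : sqintegrable (fun x => k0 x - b * k2 x) by apply/sqintegrableB/sqintegrableZ.
have qW : sqintegrable (fun x => a * k3 x + k1 x) by apply: sqintegrableD => //; exact: sqintegrableZ.
apply: du_Bois_Reymond.
- by move=> s; exact: L2curve_pairing.
- by move=> s; rewrite /continuous_at /B; apply: cvgD; exact: L2curve_pairing.
move=> p dp N sp hp dp'.
have := weak (test_function2_tensor sp s0 hp h0).
rewrite (dt_tensor _ dp') (dx_tensor _ d0) (dx_tensor _ d0) (dx_tensor _ d1)
  (dx_tensor _ d1) (dx_tensor _ d2).
move=> <-; apply: eq_Rintegral => s _.
have [sV _] := cV; have [sW _] := cW; have [sZ _] := cZ.
have iV := integrableRM (sV s) qE; have iW := integrableRM (sW s) qW.
have iZ := integrableRM (sZ s) q1.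
rewrite /E /B mulrDr -!RintegralZl// -!RintegralD//; try exact: integrableRZ.
  by apply: eq_Rintegral => x _; ring.
by apply: integrableRD; exact: integrableRZ.
Qed.

End test_kernel.

Section kernel.
Variables (k0 k1 k2 k3 : R -> R).
Hypotheses (d0 : forall x, is_derive x 1 k0 (k1 x)) (d1 : forall x, is_derive x 1 k1 (k2 x))
  (d2 : forall x, is_derive x 1 k2 (k3 x)).
Variables (lam : R).
Hypotheses (l0 : 0 < lam) (s0 : smooth k0).
Hypotheses (e0 : exp_decay lam k0) (e1 : exp_decay lam k1) (e2 : exp_decay lam k2)
  (e3 : exp_decay lam k3).

Let chi x : R := (pre_bump 0)^-1 * pre_bump x.

Let smooth_chi : smooth chi. Proof. exact/smoothZ/smooth_pre_bump. Qed.

Let chi_supp : supported_in 1 chi.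
Proof. by move=> x x1; rewrite /chi (pre_bump_support x1) mulr0. Qed.

Let chi0 : chi 0 = 1.
Proof. by rewrite /chi mulVf// gt_eqF// pre_bump_gt0// normr0. Qed.

Let lh0 : 0 < lam / 2. Proof. by rewrite divr_gt0. Qed.

(** The approximation is chi (x / (n + 1)) k0 together with its three derivatives. Since chi (x / (n
    + 1)) - 1 is only bounded by a multiple of |x| / (n + 1), half of the decay rate is spent on the
    factor |x|. *)
Lemma cutoff_exists : exists (p0 p1 p2 p3 : nat -> R -> R) (Q : R),
  [/\ forall n, smooth (p0 n) /\ supported_in n.+1%:R (p0 n),
      forall n x, [/\ is_derive x 1 (p0 n) (p1 n x), is_derive x 1 (p1 n) (p2 n x)
        & is_derive x 1 (p2 n) (p3 n x)],
      0 <= Q &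
      forall n x, [/\ `|p0 n x - k0 x| <= n.+1%:R^-1 * Q * env (lam / 2) x,
         `|p1 n x - k1 x| <= n.+1%:R^-1 * Q * env (lam / 2) x,
         `|p2 n x - k2 x| <= n.+1%:R^-1 * Q * env (lam / 2) x &
         `|p3 n x - k3 x| <= n.+1%:R^-1 * Q * env (lam / 2) x]].
Proof.
have [sc1 dc0] := smooth_derive smooth_chi; set c1 := derive1 chi in sc1 dc0.
have [sc2 dc1] := smooth_derive sc1; set c2 := derive1 c1 in sc2 dc1.
have [sc3 dc2] := smooth_derive sc2; set c3 := derive1 c2 in sc3 dc2.
have h1 := supported_derive_in chi_supp (smooth_continuous sc1) dc0.
have h2 := supported_derive_in h1 (smooth_continuous sc2) dc1.
have h3 := supported_derive_in h2 (smooth_continuous sc3) dc2.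
have [K1 K10 hK1] := supported_bounded (smooth_continuous sc1) h1.
have [K2 K20 hK2] := supported_bounded (smooth_continuous sc2) h2.
have [K3 K30 hK3] := supported_bounded (smooth_continuous sc3) h3.
have lip x : `|chi x - 1| <= K1 * `|x|.
  rewrite -chi0; have [x0|x0] := leP 0 x.
    have [y _ ->] := MVT_segment x0 (fun x _ => dc0 x)
      (continuous_within_itv (smooth_continuous smooth_chi)).
    by rewrite subr0 normrM ler_wpM2r.
  have [y _ h] := MVT_segment (ltW x0) (fun x _ => dc0 x)
      (continuous_within_itv (smooth_continuous smooth_chi)).
  by rewrite distrC h sub0r normrM normrN ler_wpM2r.
pose K := K1 + K2 + K3.
have [_ [C0 C00 hC0]] := e0; have [_ [C1 C10 hC1]] := e1.
have [_ [C2 C20 hC2]] := e2; have [_ [C3 C30 hC3]] := e3.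
pose C := C0 + C1 + C2 + C3.
pose L := 2 / lam + 7.
have L2 : 0 <= 2 / lam by rewrite divr_ge0// ltW.
have K0 : 0 <= K by rewrite /K; lra.
have Cge0 : 0 <= C by rewrite /C; lra.
pose del n : R := n.+1%:R^-1.
have del0 n : 0 < del n by rewrite invr_gt0.
have del1 n : del n <= 1 by rewrite invf_le1// ler1n.
pose p0 n x := chi (del n * x) * k0 x.
pose p1 n x := del n * c1 (del n * x) * k0 x + chi (del n * x) * k1 x.
pose p2 n x := del n ^+ 2 * c2 (del n * x) * k0 x + 2 * del n * c1 (del n * x) * k1 x
  + chi (del n * x) * k2 x.
pose p3 n x := del n ^+ 3 * c3 (del n * x) * k0 x + 3 * del n ^+ 2 * c2 (del n * x) * k1 x
  + 3 * del n * c1 (del n * x) * k2 x + chi (del n * x) * k3 x.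
have comp f df n x : (forall x, is_derive x 1 f (df x)) ->
    is_derive x 1 (fun x => f (del n * x)) (del n * df (del n * x)).
  move=> hf; rewrite mulrC; apply: is_derive_fcomp (hf _).
  by apply: (is_derive_eq (is_derive_fZ (del n) (is_derive_id x 1))); rewrite mulr1.
have tail n x j C' : 0 <= C' -> C' <= C -> `|j| <= C' * env lam x ->
    `|(chi (del n * x) - 1) * j| <= del n * (K * C) * (2 / lam * env (lam / 2) x).
  move=> C'0 C'C hj; rewrite normrM.
  have hl := lip (del n * x); rewrite normrM (gtr0_norm (del0 n)) in hl.
  (* This is s <= exp s for s = lam |x| / 2. *)
  have xe : `|x| * env lam x <= 2 / lam * env (lam / 2) x.
    have -> : env lam x = env (lam / 2) x * env (lam / 2) x.
      by rewrite /env -expRD; congr expR; field.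
    rewrite mulrA; apply: ler_wpM2r; first exact: env_ge0.
    rewrite /env expRN ler_pdivrMr ?expR_gt0//.
    have := expR_ge1Dx (lam / 2 * `|x|) => h.
    have h' : `|x| = 2 / lam * (lam / 2 * `|x|) by field; rewrite gt_eqF.
    by rewrite {1}h'; apply: ler_wpM2l => //; lra.
  apply: (@le_trans _ _ (K1 * (del n * `|x|) * (C' * env lam x))).
    by apply: ler_pM.
  rewrite (_ : K1 * (del n * `|x|) * (C' * env lam x) = del n * (K1 * C') * (`|x| * env lam x)); last by ring.
  apply: ler_pM => //.
  - by rewrite mulr_ge0 ?mulr_ge0// ltW.
  - by rewrite mulr_ge0// env_ge0.
  - apply: ler_wpM2l; [exact: ltW|apply: ler_pM => //; rewrite /K; lra].
have envh x : env lam x <= env (lam / 2) x.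
  by rewrite /env ler_expR lerN2 ler_wpM2r// ler_pdivrMr// ler_peMr ?ler1n// (ltW l0).
have small n x m c j K' C' : `|c| <= K' -> 0 <= C' -> C' <= C -> K' <= K ->
    `|j| <= C' * env lam x -> (0 < m)%N ->
    `|del n ^+ m * c * j| <= del n * (K * C) * env (lam / 2) x.
  move=> hc C'0 C'C KK hj m0; rewrite !normrM normrX (gtr0_norm (del0 n)).
  have dm : del n ^+ m <= del n.
    by rewrite -{2}(expr1 (del n)); apply: ler_wiXn2l => //; exact: ltW.
  have H1 : `|c| * `|j| <= K * (C * env (lam / 2) x).
    apply: ler_pM => //; first exact: le_trans hc KK.
    by apply: (le_trans hj); apply: ler_pM => //; exact: env_ge0.
  rewrite -!mulrA; apply: ler_pM => //; first by rewrite exprn_ge0// ltW.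
have [C0C C1C C2C C3C] := le_sum4 C00 C10 C20 C30.
have [K1K K2K K3K] := le_sum3 K10 K20 K30.
exists p0, p1, p2, p3, (K * C * L); split.
- move=> n; split.
    apply: smoothM => //; have := smooth_comp_affine (del n) 0 smooth_chi.
    by congr smooth; apply/funext => x; rewrite addr0.
  move=> x nx; rewrite /p0 chi_supp ?mul0r// normrM (gtr0_norm (del0 n)).
  by rewrite /del ler_pdivlMl// mulr1.
- move=> n x; have E0 := comp _ _ n x dc0; have E1 := comp _ _ n x dc1.
  have E2 := comp _ _ n x dc2.
  split.
  + by apply: (is_derive_eq (is_derive_fM E0 (d0 x))).
  + apply: (is_derive_eq (is_derive_fD (is_derive_fM (is_derive_fZ (del n) E1) (d0 x))
      (is_derive_fM E0 (d1 x)))).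
    rewrite /p2; ring.
  + apply: (is_derive_eq (is_derive_fD (is_derive_fD
      (is_derive_fM (is_derive_fZ (del n ^+ 2) E2) (d0 x))
      (is_derive_fM (is_derive_fZ (2 * del n) E1) (d1 x))) (is_derive_fM E0 (d2 x)))).
    rewrite /p3; ring.
- by rewrite !mulr_ge0//; rewrite /L; lra.
move=> n x.
have T0 := tail n x _ C0 C00 C0C (hC0 x); have T1 := tail n x _ C1 C10 C1C (hC1 x).
have T2 := tail n x _ C2 C20 C2C (hC2 x); have T3 := tail n x _ C3 C30 C3C (hC3 x).
have S10 := small n x 1%N _ _ _ _ (hK1 (del n * x)) C00 C0C K1K (hC0 x) isT.
have S11 := small n x 1%N _ _ _ _ (hK1 (del n * x)) C10 C1C K1K (hC1 x) isT.
have S12 := small n x 1%N _ _ _ _ (hK1 (del n * x)) C20 C2C K1K (hC2 x) isT.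
have S20 := small n x 2%N _ _ _ _ (hK2 (del n * x)) C00 C0C K2K (hC0 x) isT.
have S21 := small n x 2%N _ _ _ _ (hK2 (del n * x)) C10 C1C K2K (hC1 x) isT.
have S30 := small n x 3%N _ _ _ _ (hK3 (del n * x)) C00 C0C K3K (hC0 x) isT.
rewrite expr1 in S10 S11 S12.
have P0 : 0 <= del n * (K * C) * env (lam / 2) x.
  by rewrite !mulr_ge0 ?env_ge0//; exact: ltW.
rewrite -/(del n).
have -> : del n * (K * C * L) * env (lam / 2) x =
    del n * (K * C) * (2 / lam * env (lam / 2) x) + 7 * (del n * (K * C) * env (lam / 2) x).
  by rewrite /L; ring.
have [B0 B1 B2 B3] := cutoff_arith (del n * (K * C) * (2 / lam * env (lam / 2) x)) P0.
have nD := @normD_le R; have nM := @normMn_le R.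
split.
- have -> : p0 n x - k0 x = (chi (del n * x) - 1) * k0 x by rewrite /p0; ring.
  exact: le_trans T0 B0.
- have -> : p1 n x - k1 x = (chi (del n * x) - 1) * k1 x + del n * c1 (del n * x) * k0 x.
    by rewrite /p1; ring.
  exact: le_trans (nD _ _ _ _ T1 S10) B1.
- have -> : p2 n x - k2 x = (chi (del n * x) - 1) * k2 x + del n ^+ 2 * c2 (del n * x) * k0 x
      + 2%:R * (del n * c1 (del n * x) * k1 x) by rewrite /p2; ring.
  exact: le_trans (nD _ _ _ _ (nD _ _ _ _ T2 S20) (nM 2%N _ _ S11)) B2.
- have -> : p3 n x - k3 x = (chi (del n * x) - 1) * k3 x + del n ^+ 3 * c3 (del n * x) * k0 x
      + 3%:R * (del n ^+ 2 * c2 (del n * x) * k1 x) + 3%:R * (del n * c1 (del n * x) * k2 x).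
    by rewrite /p3; ring.
  exact: le_trans (nD _ _ _ _ (nD _ _ _ _ (nD _ _ _ _ T3 S30) (nM 3%N _ _ S21)) (nM 3%N _ _ S12)) B3.
Qed.

Lemma pairing_close f g h D c : sqintegrable f -> sqintegrable g -> sqintegrable h ->
  sqintegrable D -> 0 <= c -> (forall x, `|g x - h x| <= c * D x) ->
  `|\int[mu]_x (f x * g x) - \int[mu]_x (f x * h x)| <= c * (L2norm f * L2norm D).
Proof.
move=> sf sg sh sD c0 H; rewrite -RintegralB//; try exact: integrableRM.
under eq_Rintegral do rewrite -mulrBr.
have sgh := sqintegrableB sg sh.
apply: (le_trans (cauchy_schwarz sf sgh)).
rewrite mulrCA; apply: ler_wpM2l; first exact: L2norm_ge0.
rewrite -[c]ger0_norm// -L2normZ//; apply: le_L2norm => //; first exact: sqintegrableZ.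
by move=> x; apply: (le_trans (H x)); exact: ler_norm.
Qed.

(** The distributional equation only admits compactly supported kernels. The cut-off kernels have
    errors of order 1 / (n + 1) times the norms of V, W and Z; those of W and Z are bounded for
    times near t, so that [is_derive_limit] applies. *)
Lemma pairing_derivative t : is_derive t 1 (E k0 k2) (B k1 k3 t).
Proof.
have [p0 [p1 [p2 [p3 [Q [hp dp Q0 close]]]]]] := cutoff_exists.
pose D := env (lam / 2).
have sD : sqintegrable D by apply: (exp_decay_sqintegrable lh0); exact: exp_decay_env.
have [sV _] := cV; have [sW _] := cW; have [sZ _] := cZ.
have [q0 q1] := (exp_decay_sqintegrable l0 e0, exp_decay_sqintegrable l0 e1).
have [q2 q3] := (exp_decay_sqintegrable l0 e2, exp_decay_sqintegrable l0 e3).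
have sp n : [/\ sqintegrable (p0 n), sqintegrable (p1 n), sqintegrable (p2 n)
    & sqintegrable (p3 n)].
  have [s0' h0] := hp n.
  have D0 x : is_derive x 1 (p0 n) (p1 n x) by case: (dp n x).
  have D1 x : is_derive x 1 (p1 n) (p2 n x) by case: (dp n x).
  have D2 x : is_derive x 1 (p2 n) (p3 n x) by case: (dp n x).
  have s1 := smoothP s0' D0; have s2 := smoothP s1 D1; have s3 := smoothP s2 D2.
  have h1 := supported_derive_in h0 (smooth_continuous s1) D0.
  have h2 := supported_derive_in h1 (smooth_continuous s2) D1.
  have h3 := supported_derive_in h2 (smooth_continuous s3) D2.
  split; [exact: supported_sqintegrable (smooth_continuous s0') h0
    |exact: supported_sqintegrable (smooth_continuous s1) h1
    |exact: supported_sqintegrable (smooth_continuous s2) h2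
    |exact: supported_sqintegrable (smooth_continuous s3) h3].
have n0 n : 0 < n.+1%:R^-1 :> R by rewrite invr_gt0.
have EC n s : `|E (p0 n) (p2 n) s - E k0 k2 s| <=
    n.+1%:R^-1 * (Q * (1 + `|b|) * (L2norm (V s) * L2norm D)).
  have [? ? ? ?] := sp n.
  rewrite [leRHS]mulrA; apply: (@pairing_close (V s) (fun x => p0 n x - b * p2 n x)
    (fun x => k0 x - b * k2 x)) => //.
  - by apply/sqintegrableB/sqintegrableZ.
  - by apply/sqintegrableB/sqintegrableZ.
  - by rewrite !mulr_ge0 ?addr_ge0// ltW.
  move=> x; have [c0 _ c2 _] := close n x.
  rewrite (_ : p0 n x - b * p2 n x - _ = (p0 n x - k0 x) - b * (p2 n x - k2 x)); last by ring.
  apply: (le_trans (ler_normB _ _)); rewrite normrM.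
  have c2b := ler_wpM2l (normr_ge0 b) c2.
  apply: (le_trans (lerD c0 c2b)); rewrite le_eqVlt; apply/orP; left; apply/eqP; rewrite /D; ring.
have BC n s : `|B (p1 n) (p3 n) s - B k1 k3 s| <=
    n.+1%:R^-1 * (Q * (1 + `|a|) * ((L2norm (W s) + L2norm (Z s)) * L2norm D)).
  have [? ? ? ?] := sp n.
  have a0 := normr_ge0 a.
  have H1 : `|\int[mu]_x (W s x * (a * p3 n x + p1 n x)) - \int[mu]_x (W s x * (a * k3 x + k1 x))|
     <= n.+1%:R^-1 * (Q * (1 + `|a|)) * (L2norm (W s) * L2norm D).
    apply: (@pairing_close (W s) (fun x => a * p3 n x + p1 n x)
      (fun x => a * k3 x + k1 x)) => //.
    - by apply: sqintegrableD => //; exact: sqintegrableZ.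
    - by apply: sqintegrableD => //; exact: sqintegrableZ.
    - by rewrite !mulr_ge0 ?addr_ge0// ltW.
    move=> x; have [_ c1 _ c3] := close n x.
    rewrite (_ : a * p3 n x + p1 n x - _ = a * (p3 n x - k3 x) + (p1 n x - k1 x)); last by ring.
    apply: (le_trans (ler_normD _ _)); rewrite normrM.
    have c3a := ler_wpM2l a0 c3.
    apply: (le_trans (lerD c3a c1)); rewrite le_eqVlt; apply/orP; left; apply/eqP; rewrite /D; ring.
  have H2 : `|\int[mu]_x (Z s x * p1 n x) - \int[mu]_x (Z s x * k1 x)|
     <= n.+1%:R^-1 * (Q * (1 + `|a|)) * (L2norm (Z s) * L2norm D).
    apply: pairing_close => //; first by rewrite !mulr_ge0 ?addr_ge0// ltW.
    move=> x; have [_ c1 _ _] := close n x.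
    apply: (le_trans c1); apply: ler_wpM2r; first exact: env_ge0.
    apply: ler_wpM2l; first exact: ltW.
    by rewrite ler_peMr// lerDl.
  rewrite /B opprD addrACA; apply: (le_trans (ler_normD _ _)).
  apply: (le_trans (lerD H1 H2)); rewrite le_eqVlt; apply/orP; left; apply/eqP; ring.
have D0 := L2norm_ge0 D.
apply: (@is_derive_limit _ (fun n => E (p0 n) (p2 n)) (fun n => B (p1 n) (p3 n))).
  move=> s; apply/cvgrPdist_le => /= d d0'.
  set c := Q * (1 + `|b|) * (L2norm (V s) * L2norm D).
  have c0 : 0 <= c by rewrite !mulr_ge0 ?addr_ge0 ?L2norm_ge0.
  have dc : 0 < d / (c + 1) by rewrite divr_gt0// ltr_wpDl.
  near=> n; rewrite distrC; apply: (le_trans (EC n s)); rewrite -/c.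
  have : n.+1%:R^-1 < d / (c + 1) by near: n; exact: (near_infty_natSinv_lt (PosNum dc)).
  rewrite ltr_pdivlMr ?ltr_wpDl// => h; exact: (mul_lt_le (n0 n) h).
move=> d d0'.
have cB : continuous (B k1 k3).
  move=> s; rewrite /continuous_at /B; apply: cvgD; apply: L2curve_pairing => //.
  by apply: sqintegrableD => //; exact: sqintegrableZ.
have d20 : 0 < d / 2 by rewrite divr_gt0.
have /cvgr_dist_le/(_ _ d20) := cB t => -[r1 /= r10 hr1].
have [r2 r20 hr2] := L2curve_bounded t cW; have [r3 r30 hr3] := L2curve_bounded t cZ.
set c := Q * (1 + `|a|) * ((L2norm (W t) + 1 + (L2norm (Z t) + 1)) * L2norm D).
have c0 : 0 <= c by rewrite !mulr_ge0 ?addr_ge0 ?L2norm_ge0.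
have dc : 0 < d / 2 / (c + 1) by rewrite divr_gt0// ltr_wpDl.
have [N _ hN] := near_infty_natSinv_lt (PosNum dc).
exists (Num.min r1 (Num.min r2 r3)); first by rewrite !lt_min r10 r20.
exists N => n s Nn; rewrite !lt_min => /and3P[s1 s2 s3]; split.
  have [s0' h0] := hp n.
  by apply: (@pairing_derivative_test _ _ _ _ _ _ _ n.+1%:R) => // x; case: (dp n x).
have A1 : `|B (p1 n) (p3 n) s - B k1 k3 s| <= d / 2.
  apply: (le_trans (BC n s)); apply: (@le_trans _ _ (n.+1%:R^-1 * c)).
    apply: ler_wpM2l; first exact: ltW.
    apply: ler_wpM2l; first by rewrite !mulr_ge0 ?addr_ge0.
    by apply: ler_wpM2r => //; apply: lerD; [exact: hr2|exact: hr3].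
  have := hN n Nn; rewrite /= ltr_pdivlMr ?ltr_wpDl// => h; exact: (mul_lt_le (n0 n) h).
have A2 : `|B k1 k3 s - B k1 k3 t| <= d / 2.
  by rewrite distrC; apply: hr1; rewrite /= distrC.
have := ler_normD (B (p1 n) (p3 n) s - B k1 k3 s) (B k1 k3 s - B k1 k3 t).
rewrite addrA subrK; lra.
Unshelve. all: by end_near. Qed.

End kernel.

Lemma exp_decay_reflect lam k x : 0 < lam -> exp_decay lam k ->
  exp_decay lam (fun y => k (x - y)).
Proof.
move=> l0 [ck [C C0 hC]]; split; first exact: continuous_reflect.
exists (C * expR (lam * `|x|)); first by rewrite mulr_ge0// expR_ge0.
move=> y; apply: (le_trans (hC _)); rewrite -mulrA; apply: ler_wpM2l => //.
have -> : env lam y = env lam (- y) by rewrite /env normrN.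
by apply: env_shift => //; rewrite opprK addrAC addrK.
Qed.

(** The pairing with y -> k0 (x - y): each differentiation in y changes the sign, so the odd
    derivatives on the right produce the minus. *)
Lemma convol_time_derivative lam k0 k1 k2 k3 x t : 0 < lam -> smooth k0 ->
  exp_decay lam k0 -> exp_decay lam k1 -> exp_decay lam k2 -> exp_decay lam k3 ->
  (forall x, is_derive x 1 k0 (k1 x)) -> (forall x, is_derive x 1 k1 (k2 x)) ->
  (forall x, is_derive x 1 k2 (k3 x)) ->
  is_derive t 1 (fun s => convol (V s) (fun z => k0 z - b * k2 z) x)
    (- (convol (W t) (fun z => a * k3 z + k1 z) x + convol (Z t) k1 x)).
Proof.
move=> l0 s0 e0 e1 e2 e3 d0 d1 d2.
have N1 : exp_decay lam (fun y => - k1 (x - y)).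
  have := exp_decayZ (-1) (exp_decay_reflect x l0 e1).
  by congr exp_decay; apply/funext => y; rewrite mulN1r.
have N3 : exp_decay lam (fun y => - k3 (x - y)).
  have := exp_decayZ (-1) (exp_decay_reflect x l0 e3).
  by congr exp_decay; apply/funext => y; rewrite mulN1r.
have D0 y : is_derive y 1 (fun y => k0 (x - y)) (- k1 (x - y)) by exact: is_derive_reflect.
have D1 y : is_derive y 1 (fun y => - k1 (x - y)) (k2 (x - y)).
  by rewrite -[k2 _]opprK; apply/is_derive_fN/is_derive_reflect.
have D2 y : is_derive y 1 (fun y => k2 (x - y)) (- k3 (x - y)) by exact: is_derive_reflect.
apply: (is_derive_eq (pairing_derivative D0 D1 D2 l0 (smooth_reflect x s0)
  (exp_decay_reflect x l0 e0) N1 (exp_decay_reflect x l0 e2) N3 t)).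
have [sW _] := cW; have [sZ _] := cZ.
have q1 := sqintegrable_reflect x (exp_decay_sqintegrable l0 e1).
have q3 := sqintegrable_reflect x (exp_decay_sqintegrable l0 e3).
have qq : sqintegrable (fun y => a * k3 (x - y) + k1 (x - y)).
  by apply: sqintegrableD => //; exact: sqintegrableZ.
rewrite /B opprD /convol; congr (_ + _).
  rewrite -mulN1r -RintegralZl//; last exact: integrableRM.
  by apply: eq_Rintegral => y _; ring.
rewrite -mulN1r -RintegralZl//; last exact: integrableRM.
by apply: eq_Rintegral => y _; ring.
Qed.

End weak_equation.

(** * Curves in H^1 and their products *)

Section H1_curves.
Context {R : realType}.
Local Notation mu := (@lebesgue_measure R).
Implicit Types (f g k h : R -> R) (x y z s t c M e d b : R) (u ux eta etax : R -> R -> R).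

Lemma integral_ae f g : measurable_fun setT f -> measurable_fun setT g ->
  {ae mu, forall x, f x = g x} -> \int[mu]_x f x = \int[mu]_x g x.
Proof.
move=> mf mg fg; rewrite /Rintegral; congr fine; apply: ae_eq_integral => //.
- exact/measurable_EFinP.
- exact/measurable_EFinP.
- by apply: (ae_imp fg) => x -> .
Qed.

Lemma L2norm_ae f g : measurable_fun setT f -> measurable_fun setT g ->
  {ae mu, forall x, f x = g x} -> L2norm f = L2norm g.
Proof.
move=> mf mg fg; congr Num.sqrt; apply: integral_ae; try exact: measurable_funX.
by apply: (ae_imp fg) => x ->.
Qed.

(** Truncating f at the levels c and -c changes it on a null set only and makes the bound hold
    everywhere, as the pointwise comparison lemmas require. *)
Lemma sqintegrable_mul_ae f g c : measurable_fun setT f -> 0 <= c ->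
  {ae mu, forall x, `|f x| <= c} -> sqintegrable g ->
  sqintegrable (fun x => f x * g x) /\ L2norm (fun x => f x * g x) <= c * L2norm g.
Proof.
move=> mf c0 fc sg; have [mg g2] := sg.
pose f' x := Num.max (- c) (Num.min c (f x)).
have f'c x : `|f' x| <= c.
  rewrite ler_norml /f' le_max lexx /= ge_max ge_min lexx /=.
  by rewrite andbT; apply: (le_trans _ c0); rewrite oppr_le0.
have mf' : measurable_fun setT f'.
  by apply: measurable_maxr => //; exact: measurable_minr.
have ff' : {ae mu, forall x, f' x = f x}.
  apply: (ae_imp fc) => x; rewrite ler_norml => /andP[h1 h2].
  by rewrite /f' (min_idPr h2) (max_idPr h1).
have sfg' : sqintegrable (fun x => f' x * g x).
  apply: (le_sqintegrable _ (sqintegrableZ c sg)); first exact: measurable_funM.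
  by move=> x; rewrite !normrM (ger0_norm c0) ler_wpM2r.
have mfg : measurable_fun setT (fun x => f x * g x) by exact: measurable_funM.
have fg' : {ae mu, forall x, f' x * g x = f x * g x} by apply: (ae_imp ff') => x ->.
split; last first.
  rewrite -(L2norm_ae sfg'.1 mfg fg') -[c]ger0_norm// -L2normZ//.
  apply: le_L2norm => //; first exact: sqintegrableZ.
  by move=> x; rewrite !normrM (ger0_norm c0) ler_wpM2r.
split=> //; have /integrableP[m1 i1] := sfg'.2; apply/integrableP; split.
  by apply/measurable_EFinP; exact: measurable_funX.
apply: le_lt_trans i1; rewrite le_eqVlt; apply/orP; left; apply/eqP.
apply: ae_eq_integral => //.
- by apply: measurableT_comp => //; apply/measurable_EFinP; exact: measurable_funX.
- exact: measurableT_comp.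
- by apply: (ae_imp fg') => x /= -> .
Qed.

Definition H1curve u ux :=
  [/\ L2curve u, L2curve ux & forall t, L2_weak_derivative (u t) (ux t)].

(** The constant of the Sobolev embedding found in [convol_rho_sup]. *)
Definition sup_cst : R := 2 + L2norm (@rho R 1).

Lemma sup_cst_ge0 : 0 <= sup_cst.
Proof. by rewrite addr_ge0// L2norm_ge0. Qed.

(** At times s and t the products differ by u_s (eta_s - eta_t) + eta_t (u_s - u_t), and u_s, eta_t
    are bounded by the Sobolev embedding. *)
Lemma H1curve_mul u ux eta etax : H1curve u ux -> H1curve eta etax ->
  L2curve (fun t x => u t x * eta t x).
Proof.
move=> [cu cux wu] [ce cex we].
have [su hu] := cu; have [sux hux] := cux; have [se he] := ce; have [sex hex] := cex.
pose Ku t := sup_cst * (L2norm (u t) + L2norm (ux t)).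
pose Ke t := sup_cst * (L2norm (eta t) + L2norm (etax t)).
have Ku0 t : 0 <= Ku t by rewrite mulr_ge0 ?sup_cst_ge0// addr_ge0 ?L2norm_ge0.
have Ke0 t : 0 <= Ke t by rewrite mulr_ge0 ?sup_cst_ge0// addr_ge0 ?L2norm_ge0.
have bu t := H1_sup_ae (su t) (wu t).
have be t := H1_sup_ae (se t) (we t).
have mu_ s g sg := @sqintegrable_mul_ae (u s) g (Ku s) (su s).1 (Ku0 s) (bu s) sg.
have me_ s g sg := @sqintegrable_mul_ae (eta s) g (Ke s) (se s).1 (Ke0 s) (be s) sg.
split=> t; first by have [] := mu_ t _ (se t).
have lim : (Ku s * L2norm (fun x => eta s x - eta t x) +
    Ke t * L2norm (fun x => u s x - u t x)) @[s --> t] --> (0 : R).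
  have KL : Ku s @[s --> t] --> Ku t.
    apply: cvgM; first exact: cvg_cst.
    by apply: cvgD; exact: L2curve_norm.
  rewrite -[X in _ --> X]addr0 -[X in _ --> X + _](mulr0 (Ku t)) -[X in _ --> _ + X](mulr0 (Ke t)).
  by apply: cvgD; apply: cvgM; [exact: KL|exact: he|exact: cvg_cst|exact: hu].
apply: (cvg0_le _ lim) => s; rewrite ger0_norm ?L2norm_ge0//.
have [s1 n1] := mu_ s _ (sqintegrableB (se s) (se t)).
have [s2 n2] := me_ t _ (sqintegrableB (su s) (su t)).
apply: (le_trans _ (lerD n1 n2)); apply: (le_trans _ (L2normD s1 s2)).
rewrite le_eqVlt; apply/orP; left; apply/eqP; congr L2norm; apply/funext => x; ring.
Qed.

Lemma wderivP f : H1 f -> L2_weak_derivative f (wderiv f).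
Proof. by move=> [_ h]; exact: (xgetPex (cst 0) h). Qed.

Lemma H1_sqintegrable f : H1 f -> sqintegrable f /\ sqintegrable (wderiv f).
Proof. by move=> h; split; [case: h => /Lfun2P|case: (wderivP h) => /Lfun2P]. Qed.

Lemma H1B f g : H1 f -> H1 g -> H1 (fun x => f x - g x).
Proof.
move=> hf hg; have [sf _] := H1_sqintegrable hf; have [sg _] := H1_sqintegrable hg.
split; first by apply/Lfun2P; exact: sqintegrableB.
exists (fun x => wderiv f x - wderiv g x).
by apply: L2_weak_derivativeB => //; exact: wderivP.
Qed.

Definition quad f g x : R := f x ^+ 2 + wderiv f x ^+ 2 + g x ^+ 2 + wderiv g x ^+ 2.

Lemma quad_ge0 f g x : 0 <= quad f g x.
Proof. by rewrite !addr_ge0 ?sqr_ge0. Qed.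

Lemma quad_integrable f g : H1 f -> H1 g -> integrableR (quad f g).
Proof.
move=> /H1_sqintegrable[[_ f2] [_ f2']] /H1_sqintegrable[[_ g2] [_ g2']].
by do 3 apply: integrableRD => //.
Qed.

Lemma le_H1xH1_norm f g h : H1 f -> H1 g -> sqintegrable h ->
  (forall x, h x ^+ 2 <= quad f g x) -> L2norm h <= H1xH1_norm setT f g.
Proof.
move=> hf hg [_ h2] hq; rewrite /L2norm /H1xH1_norm ler_sqrt; last first.
  by apply: Rintegral_ge0 => x _; exact: quad_ge0.
by apply: le_integral_integrableR => //; exact: quad_integrable.
Qed.

Lemma C_H1xH1_curve u eta : C_H1xH1 u eta ->
  H1curve u (fun t => wderiv (u t)) /\ H1curve eta (fun t => wderiv (eta t)).
Proof.
move=> [hH hC].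
have hu t : H1 (u t) by case: (hH t).
have he t : H1 (eta t) by case: (hH t).
have bnd t (F : R -> R) : (forall s, 0 <= F s) ->
    (forall s, F s <= H1xH1_norm setT (fun x => u s x - u t x) (fun x => eta s x - eta t x)) ->
    F s @[s --> t] --> 0.
  by move=> F0 hF; apply: (cvg0_le _ (hC t)) => s; rewrite ger0_norm.
(* [wderiv] chooses a representative separately for each function, so the two sides agree only
   almost everywhere, by uniqueness of the weak derivative. *)
have wB (v : R -> R -> R) s t : (forall t, H1 (v t)) ->
    L2norm (fun x => wderiv (v s) x - wderiv (v t) x) =
    L2norm (wderiv (fun x => v s x - v t x)).
  move=> hv; have [s1 [m1 _]] := H1_sqintegrable (hv s); have [s2 [m2 _]] := H1_sqintegrable (hv t).
  have [s3 [m3 _]] := H1_sqintegrable (H1B (hv s) (hv t)).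
  apply: L2norm_ae => //; first exact: measurable_funB.
  apply: (weak_derivative_unique s3); last exact: wderivP (H1B _ _).
  by apply: L2_weak_derivativeB => //; exact: wderivP.
have sub f g x : [/\ f x ^+ 2 <= quad f g x, wderiv f x ^+ 2 <= quad f g x,
    g x ^+ 2 <= quad f g x & wderiv g x ^+ 2 <= quad f g x].
  have := sqr_ge0 (f x); have := sqr_ge0 (wderiv f x).
  have := sqr_ge0 (g x); have := sqr_ge0 (wderiv g x).
  by rewrite /quad; split; lra.
split; split.
- split=> t; first by case: (H1_sqintegrable (hu t)).
  apply: bnd => s; first exact: L2norm_ge0.
  have hus := H1B (hu s) (hu t); have hes := H1B (he s) (he t).
  apply: le_H1xH1_norm => //; first by case: (H1_sqintegrable hus).
  by move=> x; case: (sub (fun x => u s x - u t x) (fun x => eta s x - eta t x) x).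
- split=> t; first by case: (H1_sqintegrable (hu t)).
  apply: bnd => s; first exact: L2norm_ge0.
  have hus := H1B (hu s) (hu t); have hes := H1B (he s) (he t).
  rewrite wB//; apply: le_H1xH1_norm => //; first by case: (H1_sqintegrable hus).
  by move=> x; case: (sub (fun x => u s x - u t x) (fun x => eta s x - eta t x) x).
- by move=> t; exact: wderivP.
- split=> t; first by case: (H1_sqintegrable (he t)).
  apply: bnd => s; first exact: L2norm_ge0.
  have hus := H1B (hu s) (hu t); have hes := H1B (he s) (he t).
  apply: le_H1xH1_norm => //; first by case: (H1_sqintegrable hes).
  by move=> x; case: (sub (fun x => u s x - u t x) (fun x => eta s x - eta t x) x).
- split=> t; first by case: (H1_sqintegrable (he t)).
  apply: bnd => s; first exact: L2norm_ge0.
  have hus := H1B (hu s) (hu t); have hes := H1B (he s) (he t).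
  rewrite wB//; apply: le_H1xH1_norm => //; first by case: (H1_sqintegrable hes).
  by move=> x; case: (sub (fun x => u s x - u t x) (fun x => eta s x - eta t x) x).
- by move=> t; exact: wderivP.
Qed.

Lemma convolZDr f k1 k2 c1 c2 x : sqintegrable f -> sqintegrable k1 -> sqintegrable k2 ->
  convol f (fun z => c1 * k1 z + c2 * k2 z) x = c1 * convol f k1 x + c2 * convol f k2 x.
Proof.
move=> sf s1 s2; have i1 := convol_integrable x sf s1; have i2 := convol_integrable x sf s2.
rewrite /convol -!RintegralZl// -RintegralD//; try exact: integrableRZ.
by apply: eq_Rintegral => y _; ring.
Qed.

End H1_curves.

(** * Evolution equations of the mollified solution *)

Section mollified_equation.
Context {R : realType}.
Local Notation mu := (@lebesgue_measure R).
Implicit Types (x y z s t c M e d : R).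
Variables (V W Z : R -> R -> R) (be C e : R).
Hypotheses (be0 : 0 < be) (ee : 0 < e <= 1).
Hypotheses (cV : L2curve V) (cW : L2curve W) (cZ : L2curve Z).
Hypothesis weak : forall phi, test_function2 phi ->
  \int[mu]_t (\int[mu]_x
      (V t x * (dt phi t x - be ^+ 2 * dx (dx (dt phi)) t x)
       + (- C * be ^+ 2) * W t x * dx (dx (dx phi)) t x
       + (W t x + Z t x) * dx phi t x)) = 0.

Let lam0 : 0 < be^-1. Proof. by rewrite invr_gt0. Qed.
Let e0 : 0 < e. Proof. by case/andP: ee. Qed.
Let ka := kappa be e.
Let dka := dkappa be e.
Let r0 := @rho R e.
Let r1 := derive1 r0.
Let r2 := derive1 r1.
Let r3 := derive1 r2.

Let sr1 : smooth r1. Proof. by have [] := smooth_derive (@smooth_rho R e). Qed.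
Let dr0 x : is_derive x 1 r0 (r1 x).
Proof. by have [_] := smooth_derive (@smooth_rho R e); exact. Qed.
Let sr2 : smooth r2. Proof. by have [] := smooth_derive sr1. Qed.
Let dr1 x : is_derive x 1 r1 (r2 x). Proof. by have [_] := smooth_derive sr1; exact. Qed.
Let er0 : exp_decay be^-1 r0.
Proof. exact: (supported_exp_decay lam0 (@continuous_rho R e) (rho_supported e0)). Qed.
Let hr1 : supported_in (e + 1) r1.
Proof. exact: (supported_derive_in (rho_supported e0) (smooth_continuous sr1) dr0). Qed.
Let hr2 : supported_in (e + 1 + 1) r2.
Proof. exact: (supported_derive_in hr1 (smooth_continuous sr2) dr1). Qed.
Let er1 : exp_decay be^-1 r1.
Proof. exact: (supported_exp_decay lam0 (smooth_continuous sr1) hr1). Qed.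
Let er2 : exp_decay be^-1 r2.
Proof. exact: (supported_exp_decay lam0 (smooth_continuous sr2) hr2). Qed.
Let eka : exp_decay be^-1 ka. Proof. exact: exp_decay_kappa. Qed.
Let edka : exp_decay be^-1 dka. Proof. exact: exp_decay_dkappa. Qed.
Let k2 z := be ^- 2 * (ka z - r0 z).
Let k3 z := be ^- 2 * (dka z - r1 z).
Let k4 z := be ^- 2 * (k2 z - r2 z).
Let ek2 : exp_decay be^-1 k2. Proof. exact/exp_decayZ/exp_decayB. Qed.
Let ek3 : exp_decay be^-1 k3. Proof. exact/exp_decayZ/exp_decayB. Qed.
Let ek4 : exp_decay be^-1 k4. Proof. exact/exp_decayZ/exp_decayB. Qed.
Let dk0 x : is_derive x 1 ka (dka x). Proof. exact: is_derive_kappa. Qed.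
Let dk1 x : is_derive x 1 dka (k2 x). Proof. exact: is_derive_dkappa. Qed.
Let dk2 x : is_derive x 1 k2 (k3 x). Proof. exact/is_derive_fZ/is_derive_fB. Qed.
Let dk3 x : is_derive x 1 k3 (k4 x). Proof. exact/is_derive_fZ/is_derive_fB. Qed.
Let bn0 : be != 0. Proof. by rewrite gt_eqF. Qed.
Let sq k (h : exp_decay be^-1 k) := exp_decay_sqintegrable lam0 h.

(** The kernel is [kappa]: as kappa - be^2 kappa'' = rho, the pairing on the left is the
    mollification itself, and on the right -C be^2 kappa''' + kappa' = C rho' + (1 - C) kappa'.
    Testing with [kappa] thus inverts the operator in front of the time derivative. *)
Lemma mollified_dt t x : is_derive t 1 (fun s => convol (V s) (rho e) x)
  (- (C * convol (W t) (derive1 (rho e)) x + (1 - C) * convol (W t) (dkappa be e) x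
      + convol (Z t) (dkappa be e) x)).
Proof.
have H := convol_time_derivative cV cW cZ weak x t lam0 (smooth_kappa be e0)
  eka edka ek2 ek3 dk0 dk1 dk2.
have E1 : (fun z => ka z - be ^+ 2 * k2 z) = rho e.
  by apply/funext => z; rewrite /k2 /r0; field.
have E2 : (fun z => - C * be ^+ 2 * k3 z + dka z) = (fun z => C * r1 z + (1 - C) * dka z).
  by apply/funext => z; rewrite /k3; field.
rewrite E1 E2 convolZDr// in H; [exact: cW.1|exact: sq|exact: sq].
Qed.

(** The same computation with kappa' as the kernel. Then kappa'' appears on the right, and it is
    be^-2 (kappa - rho). *)
Lemma mollified_dtx t x : is_derive t 1 (fun s => convol (V s) (derive1 (rho e)) x)
  (- (C * convol (W t) (derive1 (derive1 (rho e))) x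
      + (1 - C) * (be ^- 2 * (convol (W t) (kappa be e) x - convol (W t) (rho e) x))
      + be ^- 2 * (convol (Z t) (kappa be e) x - convol (Z t) (rho e) x))).
Proof.
have H := convol_time_derivative cV cW cZ weak x t lam0 (smooth_dkappa be0 e0)
  edka ek2 ek3 ek4 dk1 dk2 dk3.
have E1 : (fun z => dka z - be ^+ 2 * k3 z) = derive1 (rho e).
  by apply/funext => z; rewrite /k3 /r1 /r0; field.
have E2 : (fun z => - C * be ^+ 2 * k4 z + k2 z) = (fun z => C * r2 z + (1 - C) * k2 z).
  by apply/funext => z; rewrite /k4; field.
have E3 : k2 = (fun z => be ^- 2 * ka z + (- be ^- 2) * r0 z).
  by apply/funext => z; rewrite /k2; ring.
have [sW _] := cW; have [sZ _] := cZ.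
rewrite E1 E2 convolZDr// in H; [|exact: sq|exact: sq].
rewrite E3 !convolZDr// in H; try exact: sq.
rewrite [X in is_derive _ _ _ X](_ : _ = - (C * convol (W t) r2 x + (1 - C) *
  (be ^- 2 * convol (W t) ka x + - be ^- 2 * convol (W t) r0 x) +
  (be ^- 2 * convol (Z t) ka x + - be ^- 2 * convol (Z t) r0 x)))//.
by rewrite /r2 /r1 /ka /r0; ring.
Qed.

Lemma mollified_dx (Y : R -> R) x : sqintegrable Y ->
  [/\ is_derive x 1 (convol Y (rho e)) (convol Y (derive1 (rho e)) x),
      is_derive x 1 (convol Y (derive1 (rho e))) (convol Y (derive1 (derive1 (rho e))) x),
      is_derive x 1 (convol Y (kappa be e)) (convol Y (dkappa be e) x) &
      is_derive x 1 (convol Y (dkappa be e))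
        (be ^- 2 * (convol Y (kappa be e) x - convol Y (rho e) x))].
Proof.
move=> sY; split.
- exact: (is_derive_convol lam0 x sY er0 er1 dr0).
- exact: (is_derive_convol lam0 x sY er1 er2 dr1).
- exact: (is_derive_convol lam0 x sY eka edka dk0).
have E3 : k2 = (fun z => be ^- 2 * ka z + (- be ^- 2) * r0 z).
  by apply/funext => z; rewrite /k2; ring.
apply: (is_derive_eq (is_derive_convol lam0 x sY edka ek2 dk1)).
rewrite E3 convolZDr//; try exact: sq.
by rewrite /ka /r0; ring.
Qed.

End mollified_equation.

Ltac sum_of_squares_ge0 :=
  repeat apply: addr_ge0; repeat (first [exact: sqr_ge0 | lra | nra | apply: mulr_ge0]).

(** * The energy inequality *)

Section energy_algebra.
Context {R : realType}.
Implicit Types (A C om sg : R).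

(** The left side is -be times the time derivative of the energy density, and the bracket on the
    right is D of the flux. The last two terms are present because the mollified products [M1] and
    [M2] differ from U N and U^2/2. *)
Lemma energy_identity (A C U U1 U2 N N1 N2 q0 q1 r0 r1 m0 m1 n0 n1 M1 M2 F G DF DG DDF DDG : R) :
  F = C * N + (1 - C) * r0 + m0 -> G = A * U + (1 - A) * q0 + n0 ->
  DF = C * N1 + (1 - C) * r1 + m1 -> DG = A * U1 + (1 - A) * q1 + n1 ->
  DDF = C * N2 + (1 - C) * (r0 - N) + (m0 - M2) ->
  DDG = A * U2 + (1 - A) * (q0 - U) + (n0 - M1) ->
  (U + U * N) * DF + (N + 2^-1 * U ^+ 2) * DG + A * U1 * DDF + C * N1 * DDG =
  (DF * G + F * DG - (DDF * DG + DF * DDG) + A * (U2 * DF + U1 * DDF)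
    + C * (N2 * DG + N1 * DDG))
  + (U * N - M1) * DF + (2^-1 * U ^+ 2 - M2) * DG.
Proof. by move=> -> -> -> -> -> ->; ring. Qed.

(** Twice the quadratic part of the energy, up to total derivatives: in (q0 - q2)^2 + A (q1 - q3)^2
    the product -2 q0 q2 is traded for 2 q1^2, and -2 q1 q3 for 2 q2^2. *)
Definition dissipation (A C q0 q1 q2 q3 r0 r1 r2 r3 : R) : R :=
  (q0 ^+ 2 + (2 + A) * q1 ^+ 2 + (1 + 2 * A) * q2 ^+ 2 + A * q3 ^+ 2) +
  (r0 ^+ 2 + (2 + C) * r1 ^+ 2 + (1 + 2 * C) * r2 ^+ 2 + C * r3 ^+ 2).

(** The discriminant condition for a binary quadratic form. The square is completed after
    multiplication by a; if a = 0, the condition forces c = 0. *)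
Lemma norm_young2 (c x y a b : R) : 0 <= a -> 0 <= b -> c ^+ 2 <= 4 * (a * b) ->
  `|c * (x * y)| <= a * x ^+ 2 + b * y ^+ 2.
Proof.
move=> a0 b0 ab.
have [an|an] := eqVneq a 0.
  have c0 : c = 0.
    by apply/eqP; rewrite -sqrf_eq0 eq_le sqr_ge0 andbT; move: ab; rewrite an mul0r mulr0.
  by rewrite c0 mul0r normr0 addr_ge0// mulr_ge0// sqr_ge0.
have ap : 0 < a by rewrite lt0r an.
have key d : d ^+ 2 <= 4 * (a * b) -> d * (x * y) <= a * x ^+ 2 + b * y ^+ 2.
  move=> dab; rewrite -subr_ge0 -(pmulr_rge0 _ ap).
  have -> : a * (a * x ^+ 2 + b * y ^+ 2 - d * (x * y)) =
    (a * x - 2^-1 * d * y) ^+ 2 + (a * b - 4^-1 * d ^+ 2) * y ^+ 2 by field.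
  by rewrite addr_ge0 ?sqr_ge0// mulr_ge0 ?sqr_ge0//; lra.
rewrite ler_norml key// andbT lerNl -mulNr.
by apply: key; rewrite sqrrN.
Qed.

Section coefficients.
Variables (A C : R).
Hypotheses (A0 : 0 <= A) (C0 : 0 <= C) (AC2 : A + C <= 2).

Lemma AC_le1 : A * C <= 1.
Proof.
have [A0' C0' AC2'] : [/\ 0 <= A, 0 <= C & A + C <= 2] by [].
have h : (A + C) ^+ 2 <= 2 ^+ 2 by rewrite lerXn2r ?nnegrE ?addr_ge0.
by have := sqr_ge0 (A - C); nra.
Qed.

(** After integration by parts the linear flux couples r_i only with q_i, so one discriminant
    condition for each i is enough. These four follow from A + C <= 2 and A C <= 1; the factor 3/4
    leaves the margin that absorbs everything else. *)
Lemma quad_flux_le (sg q0 q1 q2 q3 r0 r1 r2 r3 : R) : `|sg| = 1 ->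
  sg * (r0 * q0 + (2 * (A + C) - 1) * (r1 * q1) + 3 * (A * C) * (r2 * q2)
     + A * C * (r3 * q3)) <=
  3 / 4 * dissipation A C q0 q1 q2 q3 r0 r1 r2 r3.
Proof.
have [A0' C0' AC2'] : [/\ 0 <= A, 0 <= C & A + C <= 2] by [].
move=> sg1.
have AC0 : 0 <= A * C by exact: mulr_ge0.
have AC1 := AC_le1.
have h0 : `|1 * (r0 * q0)| <= 3 / 4 * r0 ^+ 2 + 3 / 4 * q0 ^+ 2.
  by apply: norm_young2; lra.
have h1 : `|(2 * (A + C) - 1) * (r1 * q1)| <=
    3 / 4 * (2 + C) * r1 ^+ 2 + 3 / 4 * (2 + A) * q1 ^+ 2.
  apply: norm_young2; [lra|lra|].
  have h : 0 <= (2 - (A + C)) * (A + C) by apply: mulr_ge0; lra.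
  by move: AC0 h; nra.
have h2 : `|3 * (A * C) * (r2 * q2)| <=
    3 / 4 * (1 + 2 * C) * r2 ^+ 2 + 3 / 4 * (1 + 2 * A) * q2 ^+ 2.
  apply: norm_young2; [lra|lra|].
  have : (A * C) ^+ 2 <= A * C by rewrite expr2; nra.
  rewrite exprMn; nra.
have h3 : `|A * C * (r3 * q3)| <= 3 / 4 * C * r3 ^+ 2 + 3 / 4 * A * q3 ^+ 2.
  apply: norm_young2; [lra|lra|].
  have : (A * C) ^+ 2 <= A * C by rewrite expr2; nra.
  lra.
apply: (le_trans (ler_norm _)); rewrite normrM sg1 mul1r -[r0 * q0]mul1r.
apply: (le_trans (ler_normD _ _)); apply: (le_trans (lerD (ler_normD _ _) (lexx _))).
apply: (le_trans (lerD (lerD (ler_normD _ _) (lexx _)) (lexx _))).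
apply: (le_trans (lerD (lerD (lerD h0 h1) h2) h3)).
by rewrite /dissipation le_eqVlt; apply/orP; left; apply/eqP; field.
Qed.

Section one_component.
Variables (B q0 q1 q2 q3 : R).
Hypotheses (B0 : 0 <= B) (B2 : B <= 2).
Local Notation S := (q0 ^+ 2 + (2 + B) * q1 ^+ 2 + (1 + 2 * B) * q2 ^+ 2 + B * q3 ^+ 2).

(** Adding the square with the opposite sign removes the mixed product, and the remaining
    coefficients are nonnegative for 0 <= B <= 2. The next three bounds are obtained in the same
    way. *)
Lemma comp_U : (q0 - q2) ^+ 2 <= 2 * S.
Proof.
have [B0' B2'] : 0 <= B /\ B <= 2 by [].
have p0 := sqr_ge0 q0; have p1 := sqr_ge0 q1; have p2 := sqr_ge0 q2; have p3 := sqr_ge0 q3.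
have h := sqr_ge0 (q0 + q2).
have -> : 2 * S = (q0 - q2) ^+ 2 + (q0 + q2) ^+ 2 + (2 * (2 + B) * q1 ^+ 2 + 4 * B * q2 ^+ 2 + 2 * B * q3 ^+ 2).
  by ring.
have : 0 <= 2 * (2 + B) * q1 ^+ 2 + 4 * B * q2 ^+ 2 + 2 * B * q3 ^+ 2.
  by sum_of_squares_ge0.
by lra.
Qed.

Lemma comp_G : (q0 - B * q2) ^+ 2 <= 2 * S.
Proof.
have [B0' B2'] : 0 <= B /\ B <= 2 by [].
have p0 := sqr_ge0 q0; have p1 := sqr_ge0 q1; have p2 := sqr_ge0 q2; have p3 := sqr_ge0 q3.
have h := sqr_ge0 (q0 + B * q2).
have -> : 2 * S = (q0 - B * q2) ^+ 2 + (q0 + B * q2) ^+ 2 +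
   (2 * (2 + B) * q1 ^+ 2 + 2 * (1 + 2 * B - B ^+ 2) * q2 ^+ 2 + 2 * B * q3 ^+ 2).
  by ring.
have : 0 <= 2 * (2 + B) * q1 ^+ 2 + 2 * (1 + 2 * B - B ^+ 2) * q2 ^+ 2 + 2 * B * q3 ^+ 2.
  by sum_of_squares_ge0.
by lra.
Qed.

Lemma comp_DG : (q1 - B * q3) ^+ 2 <= 4 * S.
Proof.
have [B0' B2'] : 0 <= B /\ B <= 2 by [].
have p0 := sqr_ge0 q0; have p1 := sqr_ge0 q1; have p2 := sqr_ge0 q2; have p3 := sqr_ge0 q3.
have h := sqr_ge0 (q1 + B * q3).
have -> : 4 * S = (q1 - B * q3) ^+ 2 + (q1 + B * q3) ^+ 2 +
   (4 * q0 ^+ 2 + (6 + 4 * B) * q1 ^+ 2 + 4 * (1 + 2 * B) * q2 ^+ 2 + (2 * (2 - B) * B) * q3 ^+ 2).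
  by ring.
have : 0 <= 4 * q0 ^+ 2 + (6 + 4 * B) * q1 ^+ 2 + 4 * (1 + 2 * B) * q2 ^+ 2 + (2 * (2 - B) * B) * q3 ^+ 2.
  by sum_of_squares_ge0.
by lra.
Qed.

Lemma comp_U1 : B * (q1 - q3) ^+ 2 <= 2 * S.
Proof.
have [B0' B2'] : 0 <= B /\ B <= 2 by [].
have p0 := sqr_ge0 q0; have p1 := sqr_ge0 q1; have p2 := sqr_ge0 q2; have p3 := sqr_ge0 q3.
have h : 0 <= B * (q1 + q3) ^+ 2 by rewrite mulr_ge0// sqr_ge0.
have -> : 2 * S = B * (q1 - q3) ^+ 2 + B * (q1 + q3) ^+ 2 +
   (2 * q0 ^+ 2 + 4 * q1 ^+ 2 + 2 * (1 + 2 * B) * q2 ^+ 2).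
  by ring.
have : 0 <= 2 * q0 ^+ 2 + 4 * q1 ^+ 2 + 2 * (1 + 2 * B) * q2 ^+ 2.
  by sum_of_squares_ge0.
by lra.
Qed.

(** Needed, like [cross_le], where D falls on the weight instead of on a correction: such terms
    carry the small factor [om], so a bound with constant 1 is enough. *)
Lemma comp_X1 : `|q0 * q1 + B * (q1 * q2)| <= S.
Proof.
have [B0' B2'] : 0 <= B /\ B <= 2 by [].
have p0 := sqr_ge0 q0; have p1 := sqr_ge0 q1; have p2 := sqr_ge0 q2; have p3 := sqr_ge0 q3.
have h1 : `|1 * (q0 * q1)| <= 2^-1 * q0 ^+ 2 + 2^-1 * q1 ^+ 2 by apply: norm_young2; lra.
have h2 : `|B * (q1 * q2)| <= 1 * q1 ^+ 2 + 1 * q2 ^+ 2 by apply: norm_young2; nra.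
rewrite -[q0 * q1]mul1r; apply: (le_trans (ler_normD _ _)); apply: (le_trans (lerD h1 h2)).
rewrite -subr_ge0 (_ : _ - _ = 2^-1 * q0 ^+ 2 + (2^-1 + B) * q1 ^+ 2 + 2 * B * q2 ^+ 2 + B * q3 ^+ 2).
  by sum_of_squares_ge0.
by field.
Qed.

Lemma comp_q0 : 0 <= S /\ q0 ^+ 2 <= S.
Proof.
have [B0' B2'] : 0 <= B /\ B <= 2 by [].
have p0 := sqr_ge0 q0; have p1 := sqr_ge0 q1; have p2 := sqr_ge0 q2; have p3 := sqr_ge0 q3.
have h : 0 <= (2 + B) * q1 ^+ 2 + (1 + 2 * B) * q2 ^+ 2 + B * q3 ^+ 2.
  by sum_of_squares_ge0.
by lra.
Qed.

End one_component.

Lemma cross_le (q0 q1 q2 q3 r0 r1 r2 r3 : R) :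
  `|A * C * (q1 * r2 + q2 * r1) + A * (r0 * q1) + C * (r1 * q0)| <=
  dissipation A C q0 q1 q2 q3 r0 r1 r2 r3.
Proof.
have [A0' C0' AC2'] : [/\ 0 <= A, 0 <= C & A + C <= 2] by [].
have AC0 : 0 <= A * C by exact: mulr_ge0.
have AC1 := AC_le1.
have p0 := sqr_ge0 q0; have p1 := sqr_ge0 q1; have p2 := sqr_ge0 q2; have p3 := sqr_ge0 q3.
have s0 := sqr_ge0 r0; have s1 := sqr_ge0 r1; have s2 := sqr_ge0 r2; have s3 := sqr_ge0 r3.
have h1 : `|A * C * (q1 * r2)| <= 2^-1 * q1 ^+ 2 + 2^-1 * r2 ^+ 2 by apply: norm_young2; nra.
have h2 : `|A * C * (q2 * r1)| <= 2^-1 * q2 ^+ 2 + 2^-1 * r1 ^+ 2 by apply: norm_young2; nra.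
have h3 : `|A * (r0 * q1)| <= 1 * r0 ^+ 2 + 1 * q1 ^+ 2 by apply: norm_young2; nra.
have h4 : `|C * (r1 * q0)| <= 1 * r1 ^+ 2 + 1 * q0 ^+ 2 by apply: norm_young2; nra.
rewrite mulrDr; apply: (le_trans (ler_normD _ _)).
apply: (le_trans (lerD (ler_normD _ _) (lexx _))).
apply: (le_trans (lerD (lerD (ler_normD _ _) (lexx _)) (lexx _))).
apply: (le_trans (lerD (lerD (lerD h1 h2) h3) h4)).
rewrite -subr_ge0 /dissipation (_ : _ - _ = (2^-1 + A) * q1 ^+ 2 + (2^-1 + 2 * A) * q2 ^+ 2
   + A * q3 ^+ 2 + (2^-1 + C) * r1 ^+ 2 + (2^-1 + 2 * C) * r2 ^+ 2 + C * r3 ^+ 2); last by field.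
by sum_of_squares_ge0.
Qed.

(* The difference is the part of the flux containing m and n, which is of higher order. *)
Lemma nonlinear_flux_le (F0 G0 DF0 DG0 U1 N1 m0 m1 n0 n1 Sq Sr : R) :
  F0 ^+ 2 <= 2 * Sr -> G0 ^+ 2 <= 2 * Sq -> DF0 ^+ 2 <= 4 * Sr -> DG0 ^+ 2 <= 4 * Sq ->
  A * U1 ^+ 2 <= 2 * Sq -> C * N1 ^+ 2 <= 2 * Sr ->
  `|((F0 + m0) * (G0 + n0) - (DF0 + m1) * (DG0 + n1) + A * U1 * (DF0 + m1)
     + C * N1 * (DG0 + n1)) -
    (F0 * G0 - DF0 * DG0 + A * U1 * DF0 + C * N1 * DG0)| <=
  3 / 32 * (Sq + Sr) + 65 * (m0 ^+ 2 + m1 ^+ 2 + n0 ^+ 2 + n1 ^+ 2).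
Proof.
have [A0' C0' AC2'] : [/\ 0 <= A, 0 <= C & A + C <= 2] by [].
move=> hF hG hDF hDG hU hN.
have p0 := sqr_ge0 m0; have p1 := sqr_ge0 m1; have p2 := sqr_ge0 n0; have p3 := sqr_ge0 n1.
have A2 : A <= 2 by lra.
have C2 : C <= 2 by lra.
(* The weights 1/64 and 1/128 are chosen so that each of F0, DF0 and N1 costs 1/32 of Sr, and each
   of G0, DG0 and U1 costs 1/32 of Sq, which adds up to 3/32. The largest resulting coefficient, at
   m1^2 and n1^2, is 64 + 1/2. *)
have h1 : `|1 * (F0 * n0)| <= 64^-1 * F0 ^+ 2 + 16 * n0 ^+ 2 by apply: norm_young2; lra.
have h2 : `|1 * (m0 * G0)| <= 16 * m0 ^+ 2 + 64^-1 * G0 ^+ 2 by apply: norm_young2; lra.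
have h3 : `|1 * (m0 * n0)| <= 2^-1 * m0 ^+ 2 + 2^-1 * n0 ^+ 2 by apply: norm_young2; lra.
have h4 : `|- 1 * (DF0 * n1)| <= 128^-1 * DF0 ^+ 2 + 32 * n1 ^+ 2 by apply: norm_young2; lra.
have h5 : `|- 1 * (m1 * DG0)| <= 32 * m1 ^+ 2 + 128^-1 * DG0 ^+ 2 by apply: norm_young2; lra.
have h6 : `|- 1 * (m1 * n1)| <= 2^-1 * m1 ^+ 2 + 2^-1 * n1 ^+ 2 by apply: norm_young2; lra.
have h7 : `|A * (U1 * m1)| <= 64^-1 * A * U1 ^+ 2 + 16 * A * m1 ^+ 2 by apply: norm_young2; nra.
have h8 : `|C * (N1 * n1)| <= 64^-1 * C * N1 ^+ 2 + 16 * C * n1 ^+ 2 by apply: norm_young2; nra.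
have h7' : 16 * A * m1 ^+ 2 <= 32 * m1 ^+ 2 by apply: ler_wpM2r => //; lra.
have h8' : 16 * C * n1 ^+ 2 <= 32 * n1 ^+ 2 by apply: ler_wpM2r => //; lra.
rewrite (_ : _ - _ = 1 * (F0 * n0) + 1 * (m0 * G0) + 1 * (m0 * n0) + - 1 * (DF0 * n1)
  + - 1 * (m1 * DG0) + - 1 * (m1 * n1) + A * (U1 * m1) + C * (N1 * n1)); last by ring.
do 7 (apply: (le_trans (ler_normD _ _)); rewrite -lerBrDr).
move: hF hG hDF hDG hU hN p0 p1 p2 p3 h1 h2 h3 h4 h5 h6 h7 h8 h7' h8'.
set a1 := `|_|; set a2 := `|_ * (m0 * G0)|.
lra.
Qed.

End coefficients.

End energy_algebra.

(** * The pointwise energy inequality *)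

Section pointwise.
Context {R : realType}.

Definition flux (A C U1 N1 F G DF DG : R) : R :=
  F * G - DF * DG + A * U1 * DF + C * N1 * DG.

Definition energy_density (A C U U1 N N1 : R) : R :=
  2^-1 * (U ^+ 2 + N ^+ 2 + A * U1 ^+ 2 + C * N1 ^+ 2 + U ^+ 2 * N).

(* Here q0, q1, q2, q3 stand for q, Dq, D^2 q, D^3 q, and similarly for r, m, n; since q2 = q0 - U,
   D maps q2 to q3 = q1 - U1. The quantities corr1, corr2 and corr3, with derivatives dcorr1, dcorr2
   and dcorr3 under D, complete the squares in the energy, in the linear flux and in m, n. *)
Definition corr1 (A C q0 q1 q2 r0 r1 r2 : R) : R :=
  q0 * q1 + A * (q1 * q2) + (r0 * r1 + C * (r1 * r2)).
Definition dcorr1 (A C q0 q1 q2 q3 r0 r1 r2 r3 : R) : R :=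
  q1 ^+ 2 + q0 * q2 + A * (q2 ^+ 2 + q1 * q3) + (r1 ^+ 2 + r0 * r2 + C * (r2 ^+ 2 + r1 * r3)).
Definition corr2 (A C q0 q1 q2 r0 r1 r2 : R) : R :=
  A * C * (q1 * r2 + q2 * r1) + A * (r0 * q1) + C * (r1 * q0).
Definition dcorr2 (A C q0 q1 q2 q3 r0 r1 r2 r3 : R) : R :=
  A * C * (q2 * r2 + q1 * r3 + (q3 * r1 + q2 * r2)) + A * (r1 * q1 + r0 * q2)
  + C * (r2 * q0 + r1 * q1).
Definition corr3 (m0 m1 n0 n1 : R) : R := m0 * m1 + n0 * n1.
Definition dcorr3 (m0 m1 m2 n0 n1 n2 : R) : R := m1 ^+ 2 + m0 * m2 + (n1 ^+ 2 + n0 * n2).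

Lemma corr3_le (m0 m1 n0 n1 : R) :
  `|corr3 m0 m1 n0 n1| <= 2^-1 * (m0 ^+ 2 + m1 ^+ 2 + n0 ^+ 2 + n1 ^+ 2).
Proof.
have h1 : `|1 * (m0 * m1)| <= 2^-1 * m0 ^+ 2 + 2^-1 * m1 ^+ 2 by apply: norm_young2; lra.
have h2 : `|1 * (n0 * n1)| <= 2^-1 * n0 ^+ 2 + 2^-1 * n1 ^+ 2 by apply: norm_young2; lra.
rewrite /corr3 -[m0 * m1]mul1r -[n0 * n1]mul1r.
by apply: (le_trans (ler_normD _ _)); lra.
Qed.

Lemma cubic_le (U N d : R) : `|N| <= d -> - (U ^+ 2 * N) <= d * U ^+ 2.
Proof.
by rewrite ler_norml => /andP[h _]; have := sqr_ge0 U; rewrite -mulrN mulrC; nra.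
Qed.

(** From M = U^2/2 - e follows M^2 <= 2 (U^2/2)^2 + 2 e^2, and one factor U^2 is small. The next
    lemma treats M = U N - e in the same manner. *)
Lemma quadratic_source_le (U M e d : R) : `|U| <= d -> e = 2^-1 * U ^+ 2 - M ->
  M ^+ 2 <= 2^-1 * (d ^+ 2 * U ^+ 2) + 2 * e ^+ 2.
Proof.
move=> Us ->; have U2 : U ^+ 2 <= d ^+ 2.
  by rewrite -(real_normK (num_real U)) lerXn2r// nnegrE (le_trans _ Us).
have h : U ^+ 2 * U ^+ 2 <= d ^+ 2 * U ^+ 2 by apply: ler_wpM2r => //; exact: sqr_ge0.
have h2 := sqr_ge0 (U ^+ 2 - M).
rewrite -subr_ge0 (_ : _ - _ = 2^-1 * (d ^+ 2 * U ^+ 2 - U ^+ 2 * U ^+ 2) + (U ^+ 2 - M) ^+ 2);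
  last by field.
by rewrite addr_ge0// mulr_ge0// subr_ge0.
Qed.

Lemma product_source_le (U N M e d : R) : `|N| <= d -> e = U * N - M ->
  M ^+ 2 <= 2 * (d ^+ 2 * U ^+ 2) + 2 * e ^+ 2.
Proof.
move=> Ns ->; have N2 : N ^+ 2 <= d ^+ 2.
  by rewrite -(real_normK (num_real N)) lerXn2r// nnegrE (le_trans _ Ns).
have h : N ^+ 2 * U ^+ 2 <= d ^+ 2 * U ^+ 2 by apply: ler_wpM2r => //; exact: sqr_ge0.
have h2 := sqr_ge0 (2 * (U * N) - M).
rewrite -subr_ge0 (_ : _ - _ = 2 * (d ^+ 2 * U ^+ 2 - N ^+ 2 * U ^+ 2) + (2 * (U * N) - M) ^+ 2);
  last by ring.
by rewrite addr_ge0// mulr_ge0// subr_ge0.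
Qed.

(** The budget is the quarter of Sq + Sr left by [quad_flux_le]. From it are paid 3/32 for the
    nonlinear flux, 3/96 for the terms with [om] on [corr1] and [corr2], 1/64 for the cubic term and
    less than 1/16 for 130 (M1^2 + M2^2). The squares of m and n, with coefficient 65 from the
    nonlinear flux and 260/192 from [om], are absorbed by the -130 that [dcorr3] provides. *)
Lemma pointwise_le (A C sg om U U1 N N1 q0 q1 r0 r1 m0 m1 n0 n1 M1 M2 F G DF DG : R) :
  0 <= A -> 0 <= C -> A + C <= 2 -> `|sg| = 1 -> `|om| <= 96^-1 ->
  `|U| <= 128^-1 -> `|N| <= 128^-1 ->
  F = C * N + (1 - C) * r0 + m0 -> G = A * U + (1 - A) * q0 + n0 ->
  DF = C * N1 + (1 - C) * r1 + m1 -> DG = A * U1 + (1 - A) * q1 + n1 ->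
  - 2 * energy_density A C U U1 N N1 + sg * flux A C U1 N1 F G DF DG
  + sg * (om * corr2 A C q0 q1 (q0 - U) r0 r1 (r0 - N)
          + dcorr2 A C q0 q1 (q0 - U) (q1 - U1) r0 r1 (r0 - N) (r1 - N1))
  - 2 * (om * corr1 A C q0 q1 (q0 - U) r0 r1 (r0 - N)
          + dcorr1 A C q0 q1 (q0 - U) (q1 - U1) r0 r1 (r0 - N) (r1 - N1))
  - 260 * (om * corr3 m0 m1 n0 n1 + dcorr3 m0 m1 (m0 - M2) n0 n1 (n0 - M1)) <=
  260 * ((U * N - M1) ^+ 2 + (2^-1 * U ^+ 2 - M2) ^+ 2).
Proof.
move=> A0 C0 AC2 sg1 om1 Us Ns -> -> -> ->.
have A2 : A <= 2 by lra.
have C2 : C <= 2 by lra.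
set q2 := q0 - U; set q3 := q1 - U1; set r2 := r0 - N; set r3 := r1 - N1.
have EU : U = q0 - q2 by rewrite /q2; ring.
have EU1 : U1 = q1 - q3 by rewrite /q3; ring.
have EN : N = r0 - r2 by rewrite /r2; ring.
have EN1 : N1 = r1 - r3 by rewrite /r3; ring.
pose Sq := q0 ^+ 2 + (2 + A) * q1 ^+ 2 + (1 + 2 * A) * q2 ^+ 2 + A * q3 ^+ 2.
pose Sr := r0 ^+ 2 + (2 + C) * r1 ^+ 2 + (1 + 2 * C) * r2 ^+ 2 + C * r3 ^+ 2.
pose F0 := r0 - C * r2; pose G0 := q0 - A * q2.
pose DF0 := r1 - C * r3; pose DG0 := q1 - A * q3.
have := quad_flux_le A0 C0 AC2 q0 q1 q2 q3 r0 r1 r2 r3 sg1.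
set Q := (X in sg * X) => hQ.
have hU : U ^+ 2 <= 2 * Sq by rewrite EU; exact: comp_U.
have hN : N ^+ 2 <= 2 * Sr by rewrite EN; exact: comp_U.
have hG : G0 ^+ 2 <= 2 * Sq by exact: comp_G.
have hF : F0 ^+ 2 <= 2 * Sr by exact: comp_G.
have hDG : DG0 ^+ 2 <= 4 * Sq by exact: comp_DG.
have hDF : DF0 ^+ 2 <= 4 * Sr by exact: comp_DG.
have hU1 : A * U1 ^+ 2 <= 2 * Sq by rewrite EU1; exact: comp_U1.
have hN1 : C * N1 ^+ 2 <= 2 * Sr by rewrite EN1; exact: comp_U1.
have := nonlinear_flux_le A0 C0 AC2 m0 m1 n0 n1 hF hG hDF hDG hU1 hN1.
set NL := (X in `|X| <= _) => hNL.
pose Sm := m0 ^+ 2 + m1 ^+ 2 + n0 ^+ 2 + n1 ^+ 2.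
have hX2 := cross_le A0 C0 AC2 q0 q1 q2 q3 r0 r1 r2 r3.
have hX1q := comp_X1 q0 q1 q2 q3 A0 A2; have hX1r := comp_X1 r0 r1 r2 r3 C0 C2.
have hX3 : `|corr3 m0 m1 n0 n1| <= 2^-1 * Sm.
  exact: corr3_le.
have [Sq0 _] := comp_q0 q0 q1 q2 q3 A0 A2; have [Sr0 _] := comp_q0 r0 r1 r2 r3 C0 C2.
have Sm0 : 0 <= Sm by rewrite /Sm !addr_ge0 ?sqr_ge0.
have prod_le (x y b c : R) : `|x| <= b -> `|y| <= c -> x * y <= b * c.
  move=> xb yc; apply: (le_trans (ler_norm _)); rewrite normrM.
  by apply: ler_pM.
(* An exact identity: the three total derivatives turn the energy into Sq + Sr, the linear flux into
   Q, and the products involving m and n into squares. What follows is estimation term by term. *)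
have key : - 2 * energy_density A C U U1 N N1 +
  sg * flux A C U1 N1 (C * N + (1 - C) * r0 + m0) (A * U + (1 - A) * q0 + n0)
     (C * N1 + (1 - C) * r1 + m1) (A * U1 + (1 - A) * q1 + n1)
  + sg * (om * corr2 A C q0 q1 q2 r0 r1 r2 + dcorr2 A C q0 q1 q2 q3 r0 r1 r2 r3)
  - 2 * (om * corr1 A C q0 q1 q2 r0 r1 r2 + dcorr1 A C q0 q1 q2 q3 r0 r1 r2 r3)
  - 260 * (om * corr3 m0 m1 n0 n1 + dcorr3 m0 m1 (m0 - M2) n0 n1 (n0 - M1)) =
  - (Sq + Sr) - U ^+ 2 * N + sg * Q + sg * NL + sg * om * corr2 A C q0 q1 q2 r0 r1 r2
  - 2 * (om * (q0 * q1 + A * (q1 * q2))) - 2 * (om * (r0 * r1 + C * (r1 * r2)))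
  - 260 * (om * corr3 m0 m1 n0 n1)
  - 130 * (Sm + m1 ^+ 2 + n1 ^+ 2 + (m0 - M2) ^+ 2 + (n0 - M1) ^+ 2) + 130 * (M1 ^+ 2 + M2 ^+ 2).
  rewrite /energy_density /flux /corr1 /corr2 /dcorr1 /dcorr2 /dcorr3 /Q /NL /F0 /G0 /DF0 /DG0
    /Sm /Sq /Sr /q2 /q3 /r2 /r3.
  by field.
rewrite key.
have B1 := cubic_le U Ns.
have B2 := @quadratic_source_le U M2 _ _ Us erefl.
have B3 := @product_source_le U N M1 _ _ Ns erefl.
rewrite (expr2 128^-1) -mulrA in B2 B3.
have sgn : `|sg| <= 1 by rewrite sg1.
have B4 := prod_le _ _ _ _ sgn hNL.
have som : `|sg * om| <= 96^-1 by rewrite normrM sg1 mul1r.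
have B5 := prod_le _ _ _ _ som hX2.
have omN : `|- om| <= 96^-1 by rewrite normrN.
have B6 := prod_le _ _ _ _ omN hX1q.
have B7 := prod_le _ _ _ _ omN hX1r.
have B8 := prod_le _ _ _ _ omN hX3.
have P1 := sqr_ge0 m1; have P2 := sqr_ge0 n1.
have P3 := sqr_ge0 (m0 - M2); have P4 := sqr_ge0 (n0 - M1).
have hDis : dissipation A C q0 q1 q2 q3 r0 r1 r2 r3 = Sq + Sr by [].
rewrite hDis in hQ B5.
rewrite !mulNr in B6 B7 B8.
rewrite -/Sm -/Sq -/Sr -/(corr2 A C q0 q1 q2 r0 r1 r2) in B4 B5 B6 B7 B8 Sq0 Sr0.
clear hN key hX1q hX1r hX2 hX3 hNL hF hG hDF hDG hU1 hN1 EU EU1 EN EN1 prod_le hDis som omN sgn.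
move: B1 B2 B3 B4 B5 B6 B7 B8 P1 P2 P3 P4 hQ hU Sq0 Sr0 Sm0.
move: (sg * NL) (sg * Q) (sg * om * corr2 A C q0 q1 q2 r0 r1 r2) (om * corr3 m0 m1 n0 n1)
  (om * (q0 * q1 + A * (q1 * q2))) (om * (r0 * r1 + C * (r1 * r2))) => x1 x2 x3 x4 x5 x6.
move: ((m0 - M2) ^+ 2) ((n0 - M1) ^+ 2) (m1 ^+ 2) (n1 ^+ 2) (M1 ^+ 2) (M2 ^+ 2)
  ((2^-1 * U ^+ 2 - M2) ^+ 2) ((U * N - M1) ^+ 2) (U ^+ 2 * N) (U ^+ 2) Sq Sr Sm.
move=> y1 y2 y3 y4 y5 y6 y7 y8 y9 y10 y11 y12 y13 *.
lra.
Qed.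

End pointwise.

Section local_bounds.
Context {R : realType}.
Implicit Types (f g : R -> R -> R) (t x d M : R).

(** Uniform in space and locally uniform in time, as differentiation under an integral in space
    requires. *)
Definition locally_bounded f := forall t0, exists2 d, 0 < d & exists M,
  forall t x, `|t - t0| < d -> `|f t x| <= M.

Lemma locally_boundedD f g : locally_bounded f -> locally_bounded g ->
  locally_bounded (fun t x => f t x + g t x).
Proof.
move=> hf hg t0; have [d1 p1 [M1 h1]] := hf t0; have [d2 p2 [M2 h2]] := hg t0.
exists (Num.min d1 d2); first by rewrite lt_min p1.
exists (M1 + M2) => t x; rewrite lt_min => /andP[a b].
by apply: (le_trans (ler_normD _ _)); apply: lerD; [exact: h1|exact: h2].
Qed.

Lemma locally_boundedM f g : locally_bounded f -> locally_bounded g ->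
  locally_bounded (fun t x => f t x * g t x).
Proof.
move=> hf hg t0; have [d1 p1 [M1 h1]] := hf t0; have [d2 p2 [M2 h2]] := hg t0.
exists (Num.min d1 d2); first by rewrite lt_min p1.
exists (M1 * M2) => t x; rewrite lt_min => /andP[a b].
by rewrite normrM; apply: ler_pM => //; [exact: h1|exact: h2].
Qed.

Lemma locally_bounded_cst c : locally_bounded (fun _ _ => c).
Proof. by move=> t0; exists 1 => //; exists `|c|. Qed.

Lemma locally_boundedN f : locally_bounded f -> locally_bounded (fun t x => - f t x).
Proof.
by move=> hf t0; have [d p [M h]] := hf t0; exists d => //; exists M => t x; rewrite normrN; exact: h.
Qed.

Lemma continuous_fD (f g : R -> R) : continuous f -> continuous g -> continuous (fun x => f x + g x).
Proof. by move=> cf cg x; apply: continuousD; [exact: cf|exact: cg]. Qed.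

Lemma continuous_fN (f : R -> R) : continuous f -> continuous (fun x => - f x).
Proof. by move=> cf x; apply: continuousN; exact: cf. Qed.

Lemma locally_bounded_sqr f : locally_bounded f -> locally_bounded (fun t x => f t x ^+ 2).
Proof. by move=> hf; exact: (locally_boundedM hf hf). Qed.

Lemma continuous_sqr (f : R -> R) : continuous f -> continuous (fun x => f x ^+ 2).
Proof. by move=> cf; exact: (continuous_mul cf cf). Qed.

Lemma continuous_fcst (c : R) : continuous (fun _ : R => c : R).
Proof. by move=> x; exact: cst_continuous. Qed.

Lemma normM_le (a b p i j : R) : `|a| <= i * p -> `|b| <= j * p -> `|a * b| <= (i * j) * p ^+ 2.
Proof. by move=> ha hb; rewrite normrM expr2 mulrACA; exact: ler_pM. Qed.

Lemma normZ_le (c a k x : R) : `|c| <= k -> `|a| <= x -> `|c * a| <= k * x.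
Proof. by move=> ha hb; rewrite normrM; exact: ler_pM. Qed.

Lemma normB_le (a b x y : R) : `|a| <= x -> `|b| <= y -> `|a - b| <= x + y.
Proof. by move=> ha hb; apply: (le_trans (ler_normB _ _)); exact: lerD. Qed.

End local_bounds.

(* Syntax-directed, since unification up to conversion is too slow on these large polynomials. *)
Ltac locally_bounded_tac := repeat lazymatch goal with
  | |- locally_bounded (fun _ _ => ?c) => exact: locally_bounded_cst
  | |- locally_bounded (fun t x => @Algebra.add _ (@?f t x) (@?g t x)) => apply: locally_boundedD
  | |- locally_bounded (fun t x => @Algebra.opp _ (@?f t x)) => apply: locally_boundedN
  | |- locally_bounded (fun t x => @GRing.mul _ (@?f t x) (@?g t x)) => apply: locally_boundedM
  | |- locally_bounded (fun t x => @GRing.exp _ (@?f t x) 2) => apply: locally_bounded_sqr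
  | |- _ => assumption
  end.

Ltac continuous_tac := repeat lazymatch goal with
  | |- continuous (fun _ => ?c) => exact: continuous_fcst
  | |- continuous (fun x => @Algebra.add _ (@?f x) (@?g x)) => apply: continuous_fD
  | |- continuous (fun x => @Algebra.opp _ (@?f x)) => apply: continuous_fN
  | |- continuous (fun x => @GRing.mul _ (@?f x) (@?g x)) => apply: continuous_mul
  | |- continuous (fun x => @GRing.exp _ (@?f x) 2) => apply: continuous_sqr
  | |- _ => assumption
  end.

(** * Integrating a pointwise balance law over a segment *)

Section balance.
Context {R : realType}.
Local Notation mu := (@lebesgue_measure R).
Implicit Types t x p q : R.

Lemma continuous_segment_integrable (f : R -> R) p q : continuous f ->
  mu.-integrable `[p, q] (EFin \o f).
Proof.
move=> cf; exact: (continuous_compact_integrable (@segment_compact R p q)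
  (continuous_within_itv cf)).
Qed.

Lemma is_derive_integral_segment (f df : R -> R -> R) p q t :
  (forall t x, is_derive t 1 (f^~ x) (df t x)) -> (forall t, continuous (f t)) ->
  (forall t0, exists2 d, 0 < d & exists M,
     forall s x, `|s - t0| < d -> `[p, q]%classic x -> `|df s x| <= M) ->
  is_derive t 1 (fun t => \int[mu]_(x in `[p, q]) f t x) (\int[mu]_(x in `[p, q]) df t x).
Proof.
move=> fd cf bd; have [d d0 [M hM]] := bd t.
have mI : measurable (`[p, q] : set R) by exact: measurable_itv.
have tI : `]t - d, t + d[ t by rewrite /= in_itv /=; apply/andP; split; lra.
have hf (s : R) : `]t - d, t + d[ s -> mu.-integrable `[p, q] (EFin \o f s).
  by move=> _; exact: continuous_segment_integrable.
have hd (s x : R) : `]t - d, t + d[ s -> `[p, q] x -> derivable (f^~ x) s 1.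
  by move=> _ _; case: (fd s x).
have M0 (y : R) : 0 <= (fun _ : R => `|M|) y by [].
have hi : mu.-integrable `[p, q] (EFin \o (fun _ : R => `|M|)).
  by apply: continuous_segment_integrable; exact: continuous_fcst.
have hb (s x : R) : `]t - d, t + d[ s -> `[p, q] x -> `|partial1of2 f s x| <= `|M|.
  rewrite /= in_itv /= => /andP[a b] xI.
  rewrite /partial1of2 (is_derive_derive1 (fd s x)) (le_trans _ (ler_norm _))// hM//.
  by rewrite ltr_distl a.
have h1 := @derivable_under_integral R _ _ mu f _ mI t _ _ tI hf hd _ M0 hi hb.
have h2 := @differentiation_under_integral R _ _ mu f _ mI t _ _ tI hf hd _ M0 hi hb.
apply: DeriveDef => //; rewrite -derive1E h2.
by apply: eq_Rintegral => x _; exact: (is_derive_derive1 (fd t x)).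
Qed.

Lemma integral_by_parts_segment (z dz Y dY : R -> R) p q : p < q ->
  (forall x, is_derive x 1 z (dz x)) -> (forall x, is_derive x 1 Y (dY x)) ->
  continuous dz -> continuous dY -> z p = 0 -> z q = 0 ->
  \int[mu]_(x in `[p, q]) (z x * dY x) = - \int[mu]_(x in `[p, q]) (dz x * Y x).
Proof.
move=> pq zd Yd cz cY zp zq.
have dLR (f df : R -> R) : (forall x, is_derive x 1 f (df x)) -> derivable_oo_LRcontinuous f p q.
  move=> fd; have cf : continuous f by move=> x; exact: is_derive_continuous (fd x).
  split; first by move=> x _; case: (fd x).
    by apply: cvg_at_right_filter; exact: cf.
  by apply: cvg_at_left_filter; exact: cf.
rewrite (@Rintegration_by_parts R z Y dz dY)//.
- by rewrite zp zq !mul0r subrr sub0r.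
- exact: continuous_within_itv.
- exact: dLR zd.
- by move=> x _; exact: is_derive_derive1 (zd x).
- exact: continuous_within_itv.
- exact: dLR Yd.
- by move=> x _; exact: is_derive_derive1 (Yd x).
Qed.

Definition cutoff (L x : R) := 1 - L ^- 2 * x ^+ 2.

Lemma is_derive_cutoff L x : is_derive x 1 (cutoff L) (- (2 * L ^- 2 * x)).
Proof.
apply: (is_derive_eq (is_derive_fB (is_derive_fcst x 1)
  (is_derive_fZ (L ^- 2) (is_derive_fX 2 (is_derive_id x 1))))).
by rewrite /=; ring.
Qed.

Lemma continuous_cutoff L : continuous (cutoff L).
Proof. by move=> x; exact: is_derive_continuous (is_derive_cutoff L x). Qed.

Lemma cutoff_ge0_le1 L x : `[- L, L]%classic x -> 0 <= cutoff L x <= 1.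
Proof.
rewrite /= in_itv /= -ler_norml => xL.
have [->|L0] := eqVneq L 0; first by rewrite /cutoff expr0n /= invr0 mul0r subr0 ler01 lexx.
have h : x ^+ 2 <= L ^+ 2.
  by rewrite -(real_normK (num_real x)) lerXn2r// ?nnegrE (le_trans _ xL).
have Lp : 0 < L ^- 2 by rewrite invr_gt0 exprn_even_gt0.
rewrite /cutoff subr_ge0 lerBlDr lerDl mulr_ge0 ?sqr_ge0 ?(ltW Lp)// andbT.
by rewrite mulrC ler_pdivrMr ?mul1r// exprn_even_gt0.
Qed.

Lemma le_integral_segment (f S : R -> R) (K KS p q : R) :
  continuous f -> integrableR S -> (forall x, 0 <= S x) -> 0 <= K ->
  \int[mu]_x S x <= KS -> (forall x, `[p, q]%classic x -> f x <= K * S x) ->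
  \int[mu]_(x in `[p, q]) f x <= K * KS.
Proof.
move=> cf iS S0 K0 SK fS.
have mI : measurable (`[p, q] : set R) by exact: measurable_itv.
have iSI : mu.-integrable `[p, q] (EFin \o S) by exact: integrableS iS.
apply: (@le_trans _ _ (\int[mu]_(x in `[p, q]) (K * S x))).
  apply: le_Rintegral => //; first exact: continuous_segment_integrable.
  exact: (@integrableZl _ _ _ mu _ mI K _ iSI).
rewrite RintegralZl// ler_wpM2l// (le_trans _ SK)// /Rintegral fine_le//.
- exact: integrable_fin_num.
- exact: integrable_fin_num.
- apply: ge0_subset_integral => //; first by case/integrableP: iS.
  by move=> x _ /=; rewrite lee_fin.
Qed.

(** The mean value theorem in time is applied to the localized integral, so the differential
    inequality is used at a single intermediate time and nothing is integrated over time.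
    Integration by parts then puts the derivative on the cutoff, whose slope is at most 2 / L. *)
Lemma local_balance (g dg Y dY S : R -> R -> R) (s2 be d K KS T L : R) :
  0 < be -> `|s2| = 1 -> 0 < L -> 0 <= T -> 0 <= d -> 0 <= K ->
  (forall t x, is_derive t 1 (g^~ x) (dg t x)) -> (forall t, continuous (g t)) ->
  (forall t, continuous (dg t)) -> locally_bounded dg ->
  (forall t x, is_derive x 1 (Y t) (dY t x)) -> (forall t, continuous (dY t)) ->
  (forall t, 0 <= s2 * t <= T -> [/\ integrableR (S t), \int[mu]_x S t x <= KS &
     forall x, [/\ 0 <= S t x, `|Y t x| <= K * S t x &
       be * (s2 * dg t x) <= be * dY t x + d * K * S t x]]) ->
  \int[mu]_(x in `[- L, L]) (cutoff L x * g (s2 * T) x) <=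
  \int[mu]_(x in `[- L, L]) (cutoff L x * g 0 x) + T * ((2 / L + d / be) * K * KS).
Proof.
move=> be0 s21 L0 T0 d0 K0 gd cg cdg bdg Yd cY hS.
have LL : - L < L by lra.
have mI : measurable (`[- L, L] : set R) by exact: measurable_itv.
have s2s2 : s2 * s2 = 1 by rewrite -expr2 -(real_normK (num_real s2)) s21 expr1n.
pose h t x := cutoff L x * g t x; pose dh t x := cutoff L x * dg t x.
have hcut x : `[- L, L]%classic x -> `|cutoff L x| <= 1.
  by move=> /cutoff_ge0_le1 /andP[a b]; rewrite ger0_norm.
pose X t := \int[mu]_(x in `[- L, L]) h t x.
have dX t : is_derive t 1 X (\int[mu]_(x in `[- L, L]) dh t x).
  apply: (@is_derive_integral_segment h dh).
  - by move=> s; apply: continuous_mul => //; exact: continuous_cutoff.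
  - move=> s; have [e e0 [M hM]] := bdg s; exists e => //; exists M => r x rs xI.
    by rewrite normrM -[leRHS]mul1r ler_pM ?hcut ?hM.
(* Time runs in the direction [s2]; the summand 0 gives the shape expected by
   [is_derive_comp_affine]. *)
pose Xr t := X (s2 * t + 0).
have dXr t : is_derive t 1 Xr (s2 * \int[mu]_(x in `[- L, L]) dh (s2 * t + 0) x).
  exact: is_derive_comp_affine.
have [|t tT hm] := @MVT_segment R Xr _ 0 T T0 (fun x _ => dXr x).
  by apply: continuous_within_itv => x; exact: is_derive_continuous (dXr x).
have -> : \int[mu]_(x in `[- L, L]) (cutoff L x * g (s2 * T) x) = Xr T.
  by rewrite /Xr addr0.
have -> : \int[mu]_(x in `[- L, L]) (cutoff L x * g 0 x) = Xr 0.
  by rewrite /Xr mulr0 addr0.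
rewrite -lerBlDl hm subr0 mulrC ler_wpM2l// addr0.
set t' := s2 * t.
have tT' : 0 <= s2 * t' <= T.
  by rewrite /t' mulrA s2s2 mul1r; move: tT; rewrite in_itv.
have [iS SK pS] := hS _ tT'.
rewrite -(ler_pM2l be0).
have ch : continuous (dh t') by apply: continuous_mul => //; exact: continuous_cutoff.
have cdY : continuous (fun x => cutoff L x * dY t' x).
  by apply: continuous_mul => //; exact: continuous_cutoff.
have e1 : be * (s2 * \int[mu]_(x in `[- L, L]) dh t' x) =
    be * (\int[mu]_(x in `[- L, L]) (cutoff L x * dY t' x)) +
    \int[mu]_(x in `[- L, L]) (be * (s2 * dh t' x) - be * (cutoff L x * dY t' x)).
  rewrite RintegralB//; last 2 first.
  - apply: continuous_segment_integrable; apply: continuous_mul; first exact: continuous_fcst.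
    by apply: continuous_mul => //; exact: continuous_fcst.
  - apply: continuous_segment_integrable; apply: continuous_mul => //; exact: continuous_fcst.
  rewrite !RintegralZl//; last 3 first.
  - exact: continuous_segment_integrable.
  - exact: continuous_segment_integrable.
  - apply: continuous_segment_integrable.
    by apply: continuous_mul => //; exact: continuous_fcst.
  by rewrite addrC subrK.
have cY' : continuous (Y t') by move=> x; exact: is_derive_continuous (Yd t' x).
have cdc : continuous (fun x => - (2 * L ^- 2 * x)).
  move=> x; apply: continuousN; apply: continuousM; first exact: cst_continuous.
  exact: id.
(* The boundary terms vanish because the cutoff is zero at L and -L. *)
have e2 := integral_by_parts_segment LL (is_derive_cutoff L) (Yd t') cdc (cY t').
rewrite e1 e2; last 2 first.
- by rewrite /cutoff sqrrN mulVf ?subrr// gt_eqF// exprn_gt0.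
- by rewrite /cutoff mulVf ?subrr// gt_eqF// exprn_gt0.
have b1 : - (\int[mu]_(x in `[- L, L]) (- (2 * L ^- 2 * x) * Y t' x)) <= (2 / L * K) * KS.
  have <- : \int[mu]_(x in `[- L, L]) (-1 * (- (2 * L ^- 2 * x) * Y t' x)) =
      - \int[mu]_(x in `[- L, L]) (- (2 * L ^- 2 * x) * Y t' x).
    rewrite RintegralZl ?mulN1r//.
    by apply: continuous_segment_integrable; exact: continuous_mul.
  apply: (@le_integral_segment _ (S t')) => //.
  - by apply: continuous_mul; [exact: continuous_fcst|exact: continuous_mul].
  - by move=> x; case: (pS x).
  - by rewrite mulr_ge0// divr_ge0// ltW.
  move=> x; rewrite /= in_itv /= -ler_norml => xL; have [S0 YS _] := pS x.
  apply: (le_trans (ler_norm _)); rewrite mulN1r normrN normrM normrN.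
  rewrite -[leRHS]mulrA; apply: ler_pM => //.
  rewrite !normrM [`|2|]ger0_norm// [`|L ^- 2|]ger0_norm; last by rewrite invr_ge0 exprn_ge0// ltW.
  rewrite -mulrA ler_wpM2l// ler_pdivrMl ?exprn_gt0//.
  by rewrite expr2 mulfK // gt_eqF.
have b2 : \int[mu]_(x in `[- L, L]) (be * (s2 * dh t' x) - be * (cutoff L x * dY t' x)) <=
    (d * K) * KS.
  apply: (@le_integral_segment _ (S t')) => //.
  - apply: continuous_fD; last apply: continuous_fN.
      apply: continuous_mul; first exact: continuous_fcst.
      by apply: continuous_mul => //; exact: continuous_fcst.
    by apply: continuous_mul => //; exact: continuous_fcst.
  - by move=> x; case: (pS x).
  - exact: mulr_ge0.
  move=> x xL; have [S0 YS h3] := pS x; have /andP[c0 c1] := cutoff_ge0_le1 xL.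
  have -> : be * (s2 * dh t' x) - be * (cutoff L x * dY t' x) =
    cutoff L x * (be * (s2 * dg t' x) - be * dY t' x) by rewrite /dh; ring.
  have h4 : be * (s2 * dg t' x) - be * dY t' x <= d * K * S t' x by rewrite lerBlDl.
  apply: (le_trans (ler_wpM2l c0 h4)); rewrite -[leRHS]mul1r ler_wpM2r//.
  by rewrite !mulr_ge0.
have b1' := ler_wpM2l (ltW be0) b1.
have -> : be * ((2 / L + d / be) * K * KS) = be * (2 / L * K * KS) + d * K * KS.
  by field; rewrite !gt_eqF.
exact: lerD.
Qed.

End balance.

Section bounds.
Context {R : realType}.
Implicit Types (A C p a b f g h k s be w Mw d : R).

Lemma coefficient_le A C : 0 <= A -> 0 <= C -> A + C <= 2 -> 0 <= A <= 2.
Proof. by move=> A0 C0 h; apply/andP; split=> //; lra. Qed.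

Lemma energy_cst_ge0 k : 0 <= k -> 0 <= 48 + 560 * k :> R.
Proof. by move=> k0; lra. Qed.

Lemma linear_flux_le p k f g h : 0 <= k <= 2 -> `|f| <= p -> `|g| <= p -> `|h| <= p ->
  `|k * f + (1 - k) * g + h| <= 4 * p.
Proof.
move=> /andP[k0 k2] h1 h2 h3.
have h4 : `|k * f| <= 2 * p by apply: normZ_le => //; rewrite ger0_norm.
have h5 : `|(1 - k) * g| <= 1 * p by apply: normZ_le => //; rewrite ler_norml; lra.
by apply: (le_trans (ler_normD _ _)); have := ler_normD (k * f) ((1 - k) * g); lra.
Qed.

(** The sum is 48 = 16 + 16 + 8 + 8, with A, C <= 2 and the bounds 4 p of [linear_flux_le]. *)
Lemma flux_le A C p U1 N1 F G DF DG : 0 <= A <= 2 -> 0 <= C <= 2 ->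
  `|U1| <= p -> `|N1| <= p -> `|F| <= 4 * p -> `|G| <= 4 * p -> `|DF| <= 4 * p ->
  `|DG| <= 4 * p -> `|flux A C U1 N1 F G DF DG| <= 48 * p ^+ 2.
Proof.
move=> /andP[A0 A2] /andP[C0 C2] hU hN hF hG hDF hDG.
have hAU : `|A * U1| <= 2 * p by apply: normZ_le => //; rewrite ger0_norm.
have hCN : `|C * N1| <= 2 * p by apply: normZ_le => //; rewrite ger0_norm.
have j1 := normM_le hF hG; have j2 := normM_le hDF hDG.
have j3 := normM_le hAU hDF; have j4 := normM_le hCN hDG.
have := normD_le (normD_le (normB_le j1 j2) j3) j4.
by move=> h; apply: (le_trans h); lra.
Qed.

(** The contributions are 20 from [corr2], 2 times 10 from [corr1] and 260 times 2 from [corr3]. *)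
Lemma correction_le A C p s q0 q1 q2 r0 r1 r2 m0 m1 n0 n1 : 0 <= A <= 2 -> 0 <= C <= 2 ->
  `|s| <= 1 -> [/\ `|q0| <= p, `|q1| <= p & `|q2| <= 2 * p] ->
  [/\ `|r0| <= p, `|r1| <= p & `|r2| <= 2 * p] ->
  [/\ `|m0| <= p, `|m1| <= p, `|n0| <= p & `|n1| <= p] ->
  `|s * corr2 A C q0 q1 q2 r0 r1 r2 + 2 * corr1 A C q0 q1 q2 r0 r1 r2
    + 260 * corr3 m0 m1 n0 n1| <= 560 * p ^+ 2.
Proof.
move=> /andP[A0 A2] /andP[C0 C2] s1; rewrite -(mul1r p) !mulrA mulr1.
move=> [hq0 hq1 hq2] [hr0 hr1 hr2] [hm0 hm1 hn0 hn1].
have hA : `|A| <= 2 by rewrite ger0_norm.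
have hC : `|C| <= 2 by rewrite ger0_norm.
have hX2 := normD_le (normD_le (normZ_le (normZ_le hA hC)
  (normD_le (normM_le hq1 hr2) (normM_le hq2 hr1)))
  (normZ_le hA (normM_le hr0 hq1))) (normZ_le hC (normM_le hr1 hq0)).
have hX1 := normD_le (normD_le (normM_le hq0 hq1) (normZ_le hA (normM_le hq1 hq2)))
  (normD_le (normM_le hr0 hr1) (normZ_le hC (normM_le hr1 hr2))).
have hX3 := normD_le (normM_le hm0 hm1) (normM_le hn0 hn1).
have n2 : `|2 : R| <= 2 by rewrite ger0_norm.
have n260 : `|260 : R| <= 260 by rewrite (ger0_norm (ler0n _ _)) lexx.
have := normD_le (normD_le (normZ_le s1 hX2) (normZ_le n2 hX1)) (normZ_le n260 hX3).
by move=> h; apply: (le_trans h); lra.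
Qed.

Lemma sqr_small_le d p (e : R) : 0 <= d <= 1 -> 0 <= p -> `|e| <= d * p -> e ^+ 2 <= d * p ^+ 2.
Proof.
move=> /andP[d0 d1] p0 he; apply: (@le_trans _ _ ((d * p) ^+ 2)).
  by rewrite -(real_normK (num_real e)) lerXn2r// nnegrE ?(le_trans _ he)// mulr_ge0.
by rewrite exprMn ler_wpM2r ?sqr_ge0// expr2 -[leRHS]mul1r ler_wpM2r.
Qed.

(** The constant is the one that bounds [Y] in [energy_balance], so that a single constant serves
    both hypotheses of [local_balance]. *)
Lemma source_le be w Mw d p (e1 e2 f g : R) : 0 <= d <= 1 -> 0 <= p -> 0 < be -> 0 <= w <= Mw ->
  `|e1| <= d * p -> `|e2| <= d * p -> `|f| <= 4 * p -> `|g| <= 4 * p ->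
  `|e1 * f + e2 * g| + 260 * (be * w * (e1 ^+ 2 + e2 ^+ 2)) <=
  d * (48 + 560 * (be * Mw)) * p ^+ 2.
Proof.
move=> d01 p0 be0 /andP[w0 wM] h1 h2 hf hg; have /andP[d0 d1] := d01.
have h3 := normD_le (normM_le h1 hf) (normM_le h2 hg).
have h4 := lerD (sqr_small_le d01 p0 h1) (sqr_small_le d01 p0 h2).
have dp : 0 <= d * p ^+ 2 by rewrite mulr_ge0 ?sqr_ge0.
have h5 : be * w * (e1 ^+ 2 + e2 ^+ 2) <= be * Mw * (d * p ^+ 2 + d * p ^+ 2).
  apply: ler_pM h4; first by rewrite mulr_ge0// ltW.
    by rewrite addr_ge0 ?sqr_ge0.
  by rewrite ler_wpM2l// ltW.
have z : 0 <= be * Mw * (d * p ^+ 2) by rewrite mulr_ge0// mulr_ge0 ?(ltW be0)// (le_trans w0).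
apply: (@le_trans _ _ (8 * (d * p ^+ 2) + 260 * (be * Mw * (d * p ^+ 2 + d * p ^+ 2)))).
  by apply: lerD; [apply: (le_trans h3); lra|exact: (ler_wpM2l (ler0n _ _) h5)].
move: dp z; set u := d * p ^+ 2; set v := be * Mw * u => u0 v0.
have -> : d * (48 + 560 * (be * Mw)) * p ^+ 2 = 48 * u + 560 * v by rewrite /v /u; ring.
have -> : be * Mw * (u + u) = 2 * v by rewrite /v; ring.
by lra.
Qed.

End bounds.

(** * Energy balance for smooth fields *)

Section energy.
Context {R : realType}.
Local Notation mu := (@lebesgue_measure R).
Implicit Types t x y : R.
Variables (be A C : R).
Hypotheses (be0 : 0 < be) (A0 : 0 <= A) (C0 : 0 <= C) (AC2 : A + C <= 2).
(* The index counts the derivatives D = be d/dx, hence the factors be^-1 below; M1 and M2 are the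
   mollified products u eta and u^2/2, which differ from U N and U^2/2. *)
Variables U U1 U2 N N1 N2 q0 q1 r0 r1 m0 m1 n0 n1 M1 M2 : R -> R -> R.

Let F t x := C * N t x + (1 - C) * r0 t x + m0 t x.
Let G t x := A * U t x + (1 - A) * q0 t x + n0 t x.
Let DF t x := C * N1 t x + (1 - C) * r1 t x + m1 t x.
Let DG t x := A * U1 t x + (1 - A) * q1 t x + n1 t x.
Let DDF t x := C * N2 t x + (1 - C) * (r0 t x - N t x) + (m0 t x - M2 t x).
Let DDG t x := A * U2 t x + (1 - A) * (q0 t x - U t x) + (n0 t x - M1 t x).

Hypotheses (hxU : forall t x, is_derive x 1 (U t) (be^-1 * U1 t x))
  (hxU1 : forall t x, is_derive x 1 (U1 t) (be^-1 * U2 t x))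
  (hxN : forall t x, is_derive x 1 (N t) (be^-1 * N1 t x))
  (hxN1 : forall t x, is_derive x 1 (N1 t) (be^-1 * N2 t x))
  (hxq0 : forall t x, is_derive x 1 (q0 t) (be^-1 * q1 t x))
  (hxq1 : forall t x, is_derive x 1 (q1 t) (be^-1 * (q0 t x - U t x)))
  (hxr0 : forall t x, is_derive x 1 (r0 t) (be^-1 * r1 t x))
  (hxr1 : forall t x, is_derive x 1 (r1 t) (be^-1 * (r0 t x - N t x)))
  (hxm0 : forall t x, is_derive x 1 (m0 t) (be^-1 * m1 t x))
  (hxm1 : forall t x, is_derive x 1 (m1 t) (be^-1 * (m0 t x - M2 t x)))
  (hxn0 : forall t x, is_derive x 1 (n0 t) (be^-1 * n1 t x))
  (hxn1 : forall t x, is_derive x 1 (n1 t) (be^-1 * (n0 t x - M1 t x))).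
Hypotheses (htU : forall t x, is_derive t 1 (U^~ x) (- (be^-1 * DF t x)))
  (htU1 : forall t x, is_derive t 1 (U1^~ x) (- (be^-1 * DDF t x)))
  (htN : forall t x, is_derive t 1 (N^~ x) (- (be^-1 * DG t x)))
  (htN1 : forall t x, is_derive t 1 (N1^~ x) (- (be^-1 * DDG t x))).
Hypotheses (cU2 : forall t, continuous (U2 t)) (cN2 : forall t, continuous (N2 t))
  (cM1 : forall t, continuous (M1 t)) (cM2 : forall t, continuous (M2 t)).
Hypotheses (bU : locally_bounded U) (bU1 : locally_bounded U1) (bU2 : locally_bounded U2)
  (bN : locally_bounded N) (bN1 : locally_bounded N1) (bN2 : locally_bounded N2)
  (bq0 : locally_bounded q0) (bq1 : locally_bounded q1)
  (br0 : locally_bounded r0) (br1 : locally_bounded r1)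
  (bm0 : locally_bounded m0) (bm1 : locally_bounded m1)
  (bn0 : locally_bounded n0) (bn1 : locally_bounded n1)
  (bM1 : locally_bounded M1) (bM2 : locally_bounded M2).

Variables (chi w om : R -> R) (Mw : R).
Hypotheses (dchi : forall y, is_derive y 1 chi (w y))
  (dw : forall y, is_derive y 1 w (om y * w y))
  (chi01 : forall y, 0 <= chi y <= 1) (w0 : forall y, 0 <= w y <= Mw)
  (om_le : forall y, be * `|om y| <= 96^-1) (com : continuous om).
Variables (s1 s2 c : R).
Hypotheses (s1E : `|s1| = 1) (s2E : `|s2| = 1).

(** [s2] is the direction of time and [s1] the side: at t = s2 T the argument is s1 x - 2 T - c, a
    front moving outwards at speed 2. *)
Let ph t x := chi (s1 * x + (- 2 * s2 * t - c)).
Let wt t x := w (s1 * x + (- 2 * s2 * t - c)).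
Let ot t x := om (s1 * x + (- 2 * s2 * t - c)).
Let en t x := energy_density A C (U t x) (U1 t x) (N t x) (N1 t x).

Let s2s2 : s2 * s2 = 1.
Proof. by rewrite -expr2 -(real_normK (num_real s2)) s2E expr1n. Qed.
Let bn : be != 0. Proof. by rewrite gt_eqF. Qed.

Let dphx t x : is_derive x 1 (ph t) (s1 * wt t x).
Proof. exact: (@is_derive_comp_affine _ chi x s1 (- 2 * s2 * t - c) _ (dchi _)). Qed.

Let dwtx t x : is_derive x 1 (wt t) (s1 * (ot t x * wt t x)).
Proof. exact: (@is_derive_comp_affine _ w x s1 (- 2 * s2 * t - c) _ (dw _)). Qed.

Let dpht t x : is_derive t 1 (ph^~ x) (- 2 * s2 * wt t x).
Proof.
have -> : ph^~ x = fun t => chi ((- 2 * s2) * t + (s1 * x - c)).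
  by apply/funext => z; rewrite /ph; congr chi; ring.
have -> : wt t x = w ((- 2 * s2) * t + (s1 * x - c)) by rewrite /wt; congr w; ring.
exact: (@is_derive_comp_affine _ chi t (- 2 * s2) (s1 * x - c) _ (dchi _)).
Qed.

Let is_derive_sqr (f : R -> R) (z df : R) : is_derive z 1 f df ->
  is_derive z 1 (fun y => f y ^+ 2) (2 * f z * df).
Proof.
move=> hf; apply: (is_derive_eq (is_derive_fM hf hf)); ring.
Qed.

Let ent t x := - (be^-1 * ((U t x + U t x * N t x) * DF t x
   + (N t x + 2^-1 * U t x ^+ 2) * DG t x + A * U1 t x * DDF t x + C * N1 t x * DDG t x)).

Let dent t x : is_derive t 1 (en^~ x) (ent t x).
Proof.
apply: (is_derive_eq (is_derive_fZ 2^-1 (is_derive_fD (is_derive_fD (is_derive_fD (is_derive_fD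
  (is_derive_sqr (htU t x)) (is_derive_sqr (htN t x)))
  (is_derive_fZ A (is_derive_sqr (htU1 t x)))) (is_derive_fZ C (is_derive_sqr (htN1 t x))))
  (is_derive_fM (is_derive_sqr (htU t x)) (htN t x))))).
by rewrite /ent; field.
Qed.

Let gt t x := - 2 * s2 * wt t x * en t x + ph t x * ent t x.

Let dgt t x : is_derive t 1 (fun t => ph t x * en t x) (gt t x).
Proof. exact: (is_derive_fM (dpht t x) (dent t x)). Qed.

Let dF t x : is_derive x 1 (F t) (be^-1 * DF t x).
Proof.
apply: (is_derive_eq (is_derive_fD (is_derive_fD (is_derive_fZ C (hxN t x))
  (is_derive_fZ (1 - C) (hxr0 t x))) (hxm0 t x))).
by rewrite /DF; ring.
Qed.

Let dG t x : is_derive x 1 (G t) (be^-1 * DG t x).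
Proof.
apply: (is_derive_eq (is_derive_fD (is_derive_fD (is_derive_fZ A (hxU t x))
  (is_derive_fZ (1 - A) (hxq0 t x))) (hxn0 t x))).
by rewrite /DG; ring.
Qed.

Let dDF t x : is_derive x 1 (DF t) (be^-1 * DDF t x).
Proof.
apply: (is_derive_eq (is_derive_fD (is_derive_fD (is_derive_fZ C (hxN1 t x))
  (is_derive_fZ (1 - C) (hxr1 t x))) (hxm1 t x))).
by rewrite /DDF; ring.
Qed.

Let dDG t x : is_derive x 1 (DG t) (be^-1 * DDG t x).
Proof.
apply: (is_derive_eq (is_derive_fD (is_derive_fD (is_derive_fZ A (hxU1 t x))
  (is_derive_fZ (1 - A) (hxq1 t x))) (hxn1 t x))).
by rewrite /DDG; ring.
Qed.

Let J t x := flux A C (U1 t x) (N1 t x) (F t x) (G t x) (DF t x) (DG t x).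
Let J' t x := DF t x * G t x + F t x * DG t x - (DDF t x * DG t x + DF t x * DDG t x)
  + A * (U2 t x * DF t x + U1 t x * DDF t x) + C * (N2 t x * DG t x + N1 t x * DDG t x).

Let dJ t x : is_derive x 1 (J t) (be^-1 * J' t x).
Proof.
apply: (is_derive_eq (is_derive_fD (is_derive_fD (is_derive_fB
  (is_derive_fM (dF t x) (dG t x)) (is_derive_fM (dDF t x) (dDG t x)))
  (is_derive_fM (is_derive_fZ A (hxU1 t x)) (dDF t x)))
  (is_derive_fM (is_derive_fZ C (hxN1 t x)) (dDG t x)))).
by rewrite /J'; ring.
Qed.

Let q2 t x := q0 t x - U t x.
Let q3 t x := q1 t x - U1 t x.
Let r2 t x := r0 t x - N t x.
Let r3 t x := r1 t x - N1 t x.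
Let m2 t x := m0 t x - M2 t x.
Let n2 t x := n0 t x - M1 t x.

Let dq2 t x : is_derive x 1 (q2 t) (be^-1 * q3 t x).
Proof. by apply: (is_derive_eq (is_derive_fB (hxq0 t x) (hxU t x))); rewrite /q3; ring. Qed.
Let dr2 t x : is_derive x 1 (r2 t) (be^-1 * r3 t x).
Proof. by apply: (is_derive_eq (is_derive_fB (hxr0 t x) (hxN t x))); rewrite /r3; ring. Qed.

Let X1 t x := corr1 A C (q0 t x) (q1 t x) (q2 t x) (r0 t x) (r1 t x) (r2 t x).
Let X2 t x := corr2 A C (q0 t x) (q1 t x) (q2 t x) (r0 t x) (r1 t x) (r2 t x).
Let X3 t x := corr3 (m0 t x) (m1 t x) (n0 t x) (n1 t x).
Let X1' t x := dcorr1 A C (q0 t x) (q1 t x) (q2 t x) (q3 t x) (r0 t x) (r1 t x) (r2 t x) (r3 t x).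
Let X2' t x := dcorr2 A C (q0 t x) (q1 t x) (q2 t x) (q3 t x) (r0 t x) (r1 t x) (r2 t x) (r3 t x).
Let X3' t x := dcorr3 (m0 t x) (m1 t x) (m2 t x) (n0 t x) (n1 t x) (n2 t x).

Let dX1 t x : is_derive x 1 (X1 t) (be^-1 * X1' t x).
Proof.
apply: (is_derive_eq (is_derive_fD (is_derive_fD (is_derive_fM (hxq0 t x) (hxq1 t x))
  (is_derive_fZ A (is_derive_fM (hxq1 t x) (dq2 t x))))
  (is_derive_fD (is_derive_fM (hxr0 t x) (hxr1 t x))
  (is_derive_fZ C (is_derive_fM (hxr1 t x) (dr2 t x)))))).
by rewrite /X1' /dcorr1 -/(q2 t x) -/(r2 t x); ring.
Qed.

Let dX2 t x : is_derive x 1 (X2 t) (be^-1 * X2' t x).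
Proof.
apply: (is_derive_eq (is_derive_fD (is_derive_fD (is_derive_fZ (A * C)
  (is_derive_fD (is_derive_fM (hxq1 t x) (dr2 t x)) (is_derive_fM (dq2 t x) (hxr1 t x))))
  (is_derive_fZ A (is_derive_fM (hxr0 t x) (hxq1 t x))))
  (is_derive_fZ C (is_derive_fM (hxr1 t x) (hxq0 t x))))).
by rewrite /X2' /dcorr2 -/(q2 t x) -/(r2 t x); ring.
Qed.

Let dX3 t x : is_derive x 1 (X3 t) (be^-1 * X3' t x).
Proof.
apply: (is_derive_eq (is_derive_fD (is_derive_fM (hxm0 t x) (hxm1 t x))
  (is_derive_fM (hxn0 t x) (hxn1 t x)))).
by rewrite /X3' /dcorr3 -/(m2 t x) -/(n2 t x); ring.
Qed.

Let X t x := - (s1 * s2) * X2 t x + 2 * X1 t x + 260 * X3 t x.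
Let X' t x := - (s1 * s2) * X2' t x + 2 * X1' t x + 260 * X3' t x.
(** The total flux in space: the transported energy, and the corrections multiplied by the
    derivative of the weight. Where D falls on [ph], the flux reappears with the factor [wt] and the
    sign s1 s2. *)
Let Y t x := - s2 * (ph t x * J t x) + be * (wt t x * X t x).
Let Y' t x := - s2 * (s1 * wt t x * J t x + ph t x * (be^-1 * J' t x))
  + be * (s1 * (ot t x * wt t x) * X t x + wt t x * (be^-1 * X' t x)).

Let dX t x : is_derive x 1 (X t) (be^-1 * X' t x).
Proof.
apply: (is_derive_eq (is_derive_fD (is_derive_fD (is_derive_fZ (- (s1 * s2)) (dX2 t x))
  (is_derive_fZ 2 (dX1 t x))) (is_derive_fZ 260 (dX3 t x)))).
by rewrite /X'; ring.
Qed.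

Let dY t x : is_derive x 1 (Y t) (Y' t x).
Proof.
exact: (is_derive_fD (is_derive_fZ (- s2) (is_derive_fM (dphx t x) (dJ t x)))
  (is_derive_fZ be (is_derive_fM (dwtx t x) (dX t x)))).
Qed.

Let E1 t x := U t x * N t x - M1 t x.
Let E2 t x := 2^-1 * U t x ^+ 2 - M2 t x.

(** The flux derivatives multiplied by [ph] cancel by [energy_identity]. All that remains, up to the
    mollification error, has the factor be wt, and [pointwise_le] applies with sg = s1 s2 and with
    be s1 ot, the logarithmic D-derivative of [wt], in the role of om. *)
Lemma energy_pointwise t x : `|U t x| <= 128^-1 -> `|N t x| <= 128^-1 ->
  be * (s2 * gt t x) <= be * Y' t x + `|E1 t x * DF t x + E2 t x * DG t x|
    + 260 * (be * wt t x * (E1 t x ^+ 2 + E2 t x ^+ 2)).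
Proof.
move=> Us Ns.
have sg1 : `|s1 * s2| = 1 by rewrite normrM s1E s2E mulr1.
have om1 : `|be * s1 * ot t x| <= 96^-1.
  by rewrite !normrM s1E mulr1 (gtr0_norm be0) om_le.
have key := pointwise_le (M1 t x) (M2 t x) A0 C0 AC2 sg1 om1 Us Ns (erefl (F t x)) (erefl (G t x))
  (erefl (DF t x)) (erefl (DG t x)) (q1 := q1 t x) (r1 := r1 t x) (m1 := m1 t x) (n1 := n1 t x)
  (U1 := U1 t x) (N1 := N1 t x).
have /andP[wt0 _] := w0 (s1 * x + (- 2 * s2 * t - c)).
have W0 : 0 <= be * wt t x by apply: mulr_ge0 => //; exact: ltW.
have := ler_wpM2l W0 key.
set LHS := (X in _ * X <= _); set RHS := (X in _ <= _ * X) => h.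
have id := energy_identity (erefl (F t x)) (erefl (G t x)) (erefl (DF t x)) (erefl (DG t x))
  (erefl (DDF t x)) (erefl (DDG t x)) (U := U t x) (U1 := U1 t x) (U2 := U2 t x)
  (N := N t x) (N1 := N1 t x) (N2 := N2 t x).
have e1 : be * ent t x = - (J' t x + (E1 t x * DF t x + E2 t x * DG t x)).
  rewrite /ent mulrN mulrA divff// mul1r id /J' /E1 /E2; ring.
have e2 : be * (s2 * gt t x) - be * Y' t x =
    be * wt t x * LHS - s2 * (ph t x * (E1 t x * DF t x + E2 t x * DG t x)).
  have -> : be * (s2 * gt t x) = - 2 * (s2 * s2) * (be * wt t x) * en t x + s2 * ph t x * (be * ent t x).
    by rewrite /gt; ring.
  rewrite s2s2 e1.
  have -> : be * Y' t x = be * wt t x * (- (s1 * s2) * J t x) - s2 * ph t x * J' t x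
      + be * wt t x * (be * s1 * ot t x * X t x + X' t x).
    by rewrite /Y'; field.
  rewrite /LHS /X /X' /en /J /X1 /X2 /X3 /X1' /X2' /X3' /q2 /q3 /r2 /r3 /m2 /n2.
  by ring.
have h3 : - (s2 * (ph t x * (E1 t x * DF t x + E2 t x * DG t x))) <=
    `|E1 t x * DF t x + E2 t x * DG t x|.
  apply: (le_trans (ler_norm _)); rewrite normrN !normrM s2E mul1r.
  have /andP[p0 p1] := chi01 (s1 * x + (- 2 * s2 * t - c)).
  by rewrite -[leRHS]mul1r ler_wpM2r// ger0_norm.
have e4 : be * wt t x * RHS = 260 * (be * wt t x * (E1 t x ^+ 2 + E2 t x ^+ 2)).
  by rewrite /RHS /E1 /E2; ring.
rewrite e4 in h; clear key id e1 e4.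
have := lerD h h3; rewrite -e2; lra.
Qed.

Let cont (f df : R -> R -> R) : (forall t x, is_derive x 1 (f t) (df t x)) ->
  forall t, continuous (f t).
Proof. by move=> fd t x; exact: is_derive_continuous (fd t x). Qed.

Let continuous_gt t : continuous (gt t).
Proof.
have c1 := cont (t := t) hxU; have c2 := cont (t := t) hxU1; have c3 := cont (t := t) hxN; have c4 := cont (t := t) hxN1.
have c5 := cont (t := t) hxq0; have c6 := cont (t := t) hxq1; have c7 := cont (t := t) hxr0; have c8 := cont (t := t) hxr1.
have c9 := cont (t := t) hxm0; have c10 := cont (t := t) hxm1; have c11 := cont (t := t) hxn0; have c12 := cont (t := t) hxn1.
have c13 := @cU2 t; have c14 := @cN2 t; have c15 := @cM1 t; have c16 := @cM2 t.
have c17 := cont (t := t) dphx; have c18 := cont (t := t) dwtx.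
rewrite /gt /en /ent /energy_density /DF /DG /DDF /DDG.
continuous_tac.
Qed.

Let continuous_Y' t : continuous (Y' t).
Proof.
have c1 := cont (t := t) hxU; have c2 := cont (t := t) hxU1; have c3 := cont (t := t) hxN; have c4 := cont (t := t) hxN1.
have c5 := cont (t := t) hxq0; have c6 := cont (t := t) hxq1; have c7 := cont (t := t) hxr0; have c8 := cont (t := t) hxr1.
have c9 := cont (t := t) hxm0; have c10 := cont (t := t) hxm1; have c11 := cont (t := t) hxn0; have c12 := cont (t := t) hxn1.
have c13 := @cU2 t; have c14 := @cN2 t; have c15 := @cM1 t; have c16 := @cM2 t.
have c17 := cont (t := t) dphx; have c18 := cont (t := t) dwtx.
have c19 : continuous (ot t).
  move=> x; apply: continuous_comp; last exact: com.
  exact: is_derive_continuous (is_derive_affine x s1 _).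
rewrite /Y' /J /flux /J' /X /X' /X1 /X2 /X3 /corr1 /corr2 /corr3 /X1' /X2' /X3' /dcorr1 /dcorr2
  /dcorr3 /F /G /DF /DG /DDF /DDG /q2 /q3 /r2 /r3 /m2 /n2.
continuous_tac.
Qed.

Let bounded_gt : locally_bounded gt.
Proof.
have b1 : locally_bounded ph.
  move=> t0; exists 1 => //; exists 1 => t x _.
  by have /andP[? ?] := chi01 (s1 * x + (- 2 * s2 * t - c)); rewrite ger0_norm.
have b2 : locally_bounded wt.
  move=> t0; exists 1 => //; exists Mw => t x _.
  by have /andP[? ?] := w0 (s1 * x + (- 2 * s2 * t - c)); rewrite ger0_norm.
rewrite /gt /en /ent /energy_density /DF /DG /DDF /DDG.
locally_bounded_tac.
Qed.

(** A single function [P] bounds all fields, since the boundary term and the mollification error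
    need only crude bounds quadratic in [P]; they disappear in the limit. *)
Lemma energy_balance (P : R -> R -> R) (d KS T L : R) : 0 < L -> 0 <= T -> 0 <= d <= 1 ->
  (forall t, 0 <= s2 * t <= T ->
    [/\ integrableR (fun x => P t x ^+ 2), \int[mu]_x (P t x ^+ 2) <= KS &
     forall x, [/\ `|U t x| <= 128^-1, `|N t x| <= 128^-1,
       `|U t x * N t x - M1 t x| <= d * P t x, `|2^-1 * U t x ^+ 2 - M2 t x| <= d * P t x &
       forall f, f \in [:: U t x; U1 t x; N t x; N1 t x; q0 t x; q1 t x; r0 t x; r1 t x;
         m0 t x; m1 t x; n0 t x; n1 t x] -> `|f| <= P t x]]) ->
  \int[mu]_(x in `[- L, L]) (cutoff L x * (ph (s2 * T) x * en (s2 * T) x)) <=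
  \int[mu]_(x in `[- L, L]) (cutoff L x * (ph 0 x * en 0 x))
    + T * ((2 / L + d / be) * (48 + 560 * (be * Mw)) * KS).
Proof.
move=> L0 T0 d01 hP; have /andP[d0 d1] := d01.
have Mw0 : 0 <= Mw by have /andP[a b] := w0 0; exact: le_trans b.
have bMw : 0 <= be * Mw by rewrite mulr_ge0// ltW.
set K := 48 + 560 * (be * Mw).
have K0 : 0 <= K := energy_cst_ge0 bMw.
have cg t : continuous (fun x => ph t x * en t x).
  have c1 := cont (t := t) hxU; have c2 := cont (t := t) hxU1.
  have c3 := cont (t := t) hxN; have c4 := cont (t := t) hxN1; have c5 := cont (t := t) dphx.
  rewrite /en /energy_density; continuous_tac.
suff hS t : 0 <= s2 * t <= T -> [/\ integrableR (fun x => P t x ^+ 2), \int[mu]_x (P t x ^+ 2) <= KS &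
     forall x, [/\ 0 <= P t x ^+ 2, `|Y t x| <= K * P t x ^+ 2 &
       be * (s2 * gt t x) <= be * Y' t x + d * K * P t x ^+ 2]].
  exact: (@local_balance R (fun t x => ph t x * en t x) gt Y Y' (fun t x => P t x ^+ 2) s2 be d K KS
    T L be0 s2E L0 T0 d0 K0 dgt cg continuous_gt bounded_gt dY continuous_Y' hS).
move=> tT; have [iP PKS hPx] := hP t tT; split=> // x.
have [Us Ns e1 e2 hf] := hPx x.
have P0 : 0 <= P t x by apply: (le_trans (normr_ge0 (U t x))); apply: hf; rewrite inE eqxx.
have ph01 := chi01 (s1 * x + (- 2 * s2 * t - c)).
have wt01 := w0 (s1 * x + (- 2 * s2 * t - c)).
set p := P t x in hf e1 e2 P0 *.
have A02 : 0 <= A <= 2 := coefficient_le A0 C0 AC2.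
have C02 : 0 <= C <= 2 by apply: (coefficient_le C0 A0); rewrite addrC.
have [hU hU1 hN] : [/\ `|U t x| <= p, `|U1 t x| <= p & `|N t x| <= p].
  by split; apply: hf; rewrite !inE eqxx ?orbT.
have [hN1 hq0 hq1] : [/\ `|N1 t x| <= p, `|q0 t x| <= p & `|q1 t x| <= p].
  by split; apply: hf; rewrite !inE eqxx ?orbT.
have [hr0 hr1 hm0] : [/\ `|r0 t x| <= p, `|r1 t x| <= p & `|m0 t x| <= p].
  by split; apply: hf; rewrite !inE eqxx ?orbT.
have [hm1 hn0 hn1] : [/\ `|m1 t x| <= p, `|n0 t x| <= p & `|n1 t x| <= p].
  by split; apply: hf; rewrite !inE eqxx ?orbT.
have hF := linear_flux_le C02 hN hr0 hm0; have hG := linear_flux_le A02 hU hq0 hn0.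
have hDF := linear_flux_le C02 hN1 hr1 hm1; have hDG := linear_flux_le A02 hU1 hq1 hn1.
have hq2 : `|q2 t x| <= 2 * p by rewrite mulr_natl mulr2n; exact: normB_le.
have hr2 : `|r2 t x| <= 2 * p by rewrite mulr_natl mulr2n; exact: normB_le.
have hJ : `|J t x| <= 48 * p ^+ 2 := flux_le A02 C02 hU1 hN1 hF hG hDF hDG.
have s12 : `|- (s1 * s2)| <= 1 by rewrite normrN normrM s1E s2E mulr1.
have hX : `|X t x| <= 560 * p ^+ 2.
  exact: (correction_le A02 C02 s12 (And3 hq0 hq1 hq2) (And3 hr0 hr1 hr2) (And4 hm0 hm1 hn0 hn1)).
have hs2 : `|- s2| <= 1 by rewrite normrN s2E.
have hph : `|ph t x| <= 1 by case/andP: ph01 => ? ?; rewrite ger0_norm.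
have hwt : `|wt t x| <= Mw by case/andP: wt01 => ? ?; rewrite ger0_norm.
have hbe : `|be| <= be by rewrite gtr0_norm.
split; first exact: sqr_ge0.
  have := normD_le (normZ_le hs2 (normZ_le hph hJ)) (normZ_le hbe (normZ_le hwt hX)).
  move=> h; apply: (le_trans h); rewrite le_eqVlt; apply/orP; left; apply/eqP.
  by rewrite /K; ring.
apply: (le_trans (energy_pointwise Us Ns)); rewrite -addrA lerD2l.
exact: (source_le d01 P0 be0 wt01 e1 e2 hDF hDG).
Qed.

End energy.

(** * Convolution estimates and the commutator with products *)

Section convolution_bounds.
Context {R : realType}.
Local Notation mu := (@lebesgue_measure R).
Implicit Types (f g k h : R -> R) (x y z s t c M e d : R) (V : R -> R -> R).

Lemma is_derive_convol_supported f k M x : sqintegrable f -> smooth k -> supported_in M k ->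
  is_derive x 1 (convol f k) (convol f (derive1 k) x).
Proof.
move=> sf sk hM; have [sdk dk] := smooth_derive sk.
have h1 := supported_derive_in hM (smooth_continuous sdk) dk.
exact: (is_derive_convol ltr01 x sf (supported_exp_decay ltr01 (smooth_continuous sk) hM)
  (supported_exp_decay ltr01 (smooth_continuous sdk) h1) dk).
Qed.

Lemma locally_bounded_convol V k : L2curve V -> sqintegrable k ->
  locally_bounded (fun t x => convol (V t) k x).
Proof.
move=> cV sk t0; have [sV _] := cV; have [d d0 hd] := L2curve_bounded t0 cV.
exists d => //; exists ((L2norm (V t0) + 1) * L2norm k) => t x td.
by apply: (le_trans (convol_le x (sV t) sk)); rewrite ler_wpM2r ?L2norm_ge0 ?hd.
Qed.

Lemma le_integral_ae f g : integrableR f -> integrableR g ->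
  {ae mu, forall x, f x <= g x} -> \int[mu]_x f x <= \int[mu]_x g x.
Proof.
move=> sf sg fg.
have mf := integrableR_measurable sf; have mg := integrableR_measurable sg.
have mm : measurable_fun setT (fun x => Num.max (f x) (g x)) by exact: measurable_maxr.
have im : integrableR (fun x => Num.max (f x) (g x)).
  apply: (le_integrableR mm (integrableRD (integrableR_norm sf) (integrableR_norm sg))) => x.
  have := normr_ge0 (f x); have := normr_ge0 (g x); rewrite /Num.max; case: ifP => _; lra.
rewrite -(integral_ae mm mg); last by apply: (ae_imp fg) => x h; apply/max_idPr.
by apply: le_integral_integrableR => // x; rewrite le_max lexx.
Qed.

Lemma convol_dominated f g k h x c : sqintegrable f -> sqintegrable g -> sqintegrable k ->
  sqintegrable h -> 0 <= c -> {ae mu, forall y, `|f y| <= g y} -> (forall z, `|k z| <= c * h z) ->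
  `|convol f k x| <= c * convol g h x.
Proof.
move=> sf sg sk sh c0 fg kh; have i1 := convol_integrable x sf sk.
have i2 := convol_integrable x sg sh.
apply: (le_trans (le_normr_Rintegral measurableT i1)); rewrite -RintegralZl//.
apply: le_integral_ae; [exact: integrableR_norm|exact: integrableRZ|].
by apply: (ae_imp fg) => y hy; rewrite normrM mulrCA; exact: ler_pM.
Qed.

(** The difference is the integral of (G - g y) f y rho e (x - y). On the support |x - y| < e,
    [H1_convol_close_ae] bounds G - g y by sqrt (e + 4 e) times the norm of dg. *)
Lemma convol_mul_close f g dg e x : sqintegrable f -> sqintegrable g -> L2_weak_derivative g dg ->
  sqintegrable (fun y => f y * g y) -> 0 < e ->
  `|convol f (rho e) x * convol g (rho e) x - convol (fun y => f y * g y) (rho e) x| <=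
  Num.sqrt (5 * e) * L2norm dg * convol (fun y => `|f y|) (rho e) x.
Proof.
move=> sf sg wg sfg e0; have sr := sqintegrable_rho e0.
have i1 := convol_integrable x sf sr; have i2 := convol_integrable x sfg sr.
have i3 := convol_integrable x (sqintegrable_norm sf) sr.
set G := convol g (rho e) x.
have -> : convol f (rho e) x * G - convol (fun y => f y * g y) (rho e) x =
    \int[mu]_y (G * (f y * rho e (x - y)) - f y * g y * rho e (x - y)).
  rewrite RintegralB//; last exact: integrableRZ.
  by rewrite RintegralZl// mulrC.
apply: (le_trans (le_normr_Rintegral measurableT (integrableRB (integrableRZ G i1) i2))).
rewrite -RintegralZl//; apply: le_integral_ae.
- exact/integrableR_norm/integrableRB/i2/integrableRZ.
- exact: integrableRZ.
apply: (ae_imp (H1_convol_close_ae x sg wg e0)) => y hy.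
have -> : G * (f y * rho e (x - y)) - f y * g y * rho e (x - y) =
  (G - g y) * (f y * rho e (x - y)) by ring.
rewrite normrM [`|f y * _|]normrM (ger0_norm (rho_ge0 _ e0)) distrC.
have [xy|xy] := leP e `|x - y|.
  by rewrite (rho_supported e0 xy) !mulr0.
apply: ler_wpM2r; first by rewrite mulr_ge0// rho_ge0.
apply: (le_trans hy); apply: ler_wpM2r; first exact: L2norm_ge0.
by rewrite ler_sqrt; lra.
Qed.

End convolution_bounds.

(* By the Sobolev embedding this gives |f| <= 1/128, the smallness required by [pointwise_le]. *)
Definition small_H1 {R : realType} (f g : R -> R) := sup_cst * (L2norm f + L2norm g) <= 128^-1.

(** * Energy balance for the mollified solution *)

Section mollified_energy.
Context {R : realType}.
Local Notation mu := (@lebesgue_measure R).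
Implicit Types (x y z s t c M d : R).
Variables (be A C : R).
Hypotheses (be0 : 0 < be) (A0 : 0 <= A) (C0 : 0 <= C) (AC2 : A + C <= 2).
Variables (u ux eta etax : R -> R -> R).
Hypotheses (hu : H1curve u ux) (he : H1curve eta etax).
Hypothesis weak_eta : forall phi, test_function2 phi ->
  \int[mu]_t (\int[mu]_x
      (eta t x * (dt phi t x - be ^+ 2 * dx (dx (dt phi)) t x)
       + (- A * be ^+ 2) * u t x * dx (dx (dx phi)) t x
       + (u t x + u t x * eta t x) * dx phi t x)) = 0.
Hypothesis weak_u : forall phi, test_function2 phi ->
  \int[mu]_t (\int[mu]_x
      (u t x * (dt phi t x - be ^+ 2 * dx (dx (dt phi)) t x)
       + (- C * be ^+ 2) * eta t x * dx (dx (dx phi)) t x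
       + (eta t x + 2^-1 * u t x ^+ 2) * dx phi t x)) = 0.

Let v t x := 2^-1 * u t x ^+ 2.
Let w t x := u t x * eta t x.

Let cu : L2curve u. Proof. by case: hu. Qed.
Let cux : L2curve ux. Proof. by case: hu. Qed.
Let ceta : L2curve eta. Proof. by case: he. Qed.
Let cetax : L2curve etax. Proof. by case: he. Qed.
Let cv : L2curve v. Proof. exact: (L2curveZ 2^-1 (H1curve_mul hu hu)). Qed.
Let cw : L2curve w. Proof. exact: (H1curve_mul hu he). Qed.
Let wu t : L2_weak_derivative (u t) (ux t). Proof. by case: hu. Qed.
Let we t : L2_weak_derivative (eta t) (etax t). Proof. by case: he. Qed.
Let su t : sqintegrable (u t). Proof. by case: cu. Qed.
Let sux t : sqintegrable (ux t). Proof. by case: cux. Qed.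
Let se t : sqintegrable (eta t). Proof. by case: ceta. Qed.
Let sex t : sqintegrable (etax t). Proof. by case: cetax. Qed.
Let sv t : sqintegrable (v t). Proof. by case: cv. Qed.
Let sw t : sqintegrable (w t). Proof. by case: cw. Qed.

Definition total_size t x := `|u t x| + `|ux t x| + `|eta t x| + `|etax t x|.

Let sf t : sqintegrable (total_size t).
Proof. by apply/sqintegrableD/sqintegrable_norm/sex; apply/sqintegrableD/sqintegrable_norm/se;
  apply/sqintegrableD/sqintegrable_norm/sux; exact/sqintegrable_norm/su. Qed.

Definition small_at t := small_H1 (u t) (ux t) /\ small_H1 (eta t) (etax t).

(** A crude bound is enough, as the total size only enters error terms. It follows from [sup_cst] >=
    2, which makes each pair of norms at most 1/2. *)
Lemma total_size_small t : small_at t -> \int[mu]_x (total_size t x ^+ 2) <= 1.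
Proof.
move=> [h1 h2].
have [n1 n2] : L2norm (u t) + L2norm (ux t) <= 2^-1 /\ L2norm (eta t) + L2norm (etax t) <= 2^-1.
  have k0 : 2 <= sup_cst :> R by rewrite lerDl L2norm_ge0.
  have a1 : 0 <= L2norm (u t) + L2norm (ux t) by rewrite addr_ge0 ?L2norm_ge0.
  have a2 : 0 <= L2norm (eta t) + L2norm (etax t) by rewrite addr_ge0 ?L2norm_ge0.
  have := ler_wpM2r a1 k0; have := ler_wpM2r a2 k0; rewrite /small_H1 in h1 h2.
  by split; lra.
rewrite -sqr_L2norm expr_le1 ?L2norm_ge0//.
have normL2 f : sqintegrable f -> L2norm (fun x => `|f x|) = L2norm f.
  by move=> _; congr Num.sqrt; apply: eq_Rintegral => x _; rewrite real_normK ?num_real.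
have s1 := sqintegrableD (sqintegrable_norm (su t)) (sqintegrable_norm (sux t)).
have s2 := sqintegrableD s1 (sqintegrable_norm (se t)).
have := L2normD s2 (sqintegrable_norm (sex t)); have := L2normD s1 (sqintegrable_norm (se t)).
have := L2normD (sqintegrable_norm (su t)) (sqintegrable_norm (sux t)).
by rewrite !normL2// /total_size; lra.
Qed.

Variable e : R.
Hypothesis ee : 0 < e <= 1.
Let e0 : 0 < e. Proof. by case/andP: ee. Qed.
Let lam0 : 0 < be^-1. Proof. by rewrite invr_gt0. Qed.
Let bn : be != 0. Proof. by rewrite gt_eqF. Qed.
Let ka := kappa be e.
Let dka := dkappa be e.
Let srho : sqintegrable (@rho R e). Proof. exact: sqintegrable_rho. Qed.
Let ska : sqintegrable ka.
Proof. exact: (exp_decay_sqintegrable lam0 (exp_decay_kappa be0 ee)). Qed.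
Let sdka : sqintegrable dka.
Proof. exact: (exp_decay_sqintegrable lam0 (exp_decay_dkappa be0 ee)). Qed.
Let sdrho : smooth (derive1 (@rho R e)).
Proof. by have [] := smooth_derive (@smooth_rho R e). Qed.
Let drho x : is_derive x 1 (rho e) (derive1 (rho e) x).
Proof. by have [_] := smooth_derive (@smooth_rho R e); exact. Qed.
Let ddrho x : is_derive x 1 (derive1 (rho e)) (derive1 (derive1 (rho e)) x).
Proof. by have [_] := smooth_derive sdrho; exact. Qed.
Let rhoS : supported_in e (@rho R e). Proof. exact: rho_supported. Qed.
Let drhoS : supported_in (e + 1) (derive1 (@rho R e)).
Proof. exact: (supported_derive_in rhoS (smooth_continuous sdrho) drho). Qed.
Let sqdrho : sqintegrable (derive1 (@rho R e)).
Proof. exact: supported_sqintegrable (smooth_continuous sdrho) drhoS. Qed.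

Let U t x := convol (u t) (rho e) x.
Let U1 t x := be * convol (ux t) (rho e) x.
Let U2 t x := be ^+ 2 * convol (ux t) (derive1 (rho e)) x.
Let N t x := convol (eta t) (rho e) x.
Let N1 t x := be * convol (etax t) (rho e) x.
Let N2 t x := be ^+ 2 * convol (etax t) (derive1 (rho e)) x.
Let q0 t x := convol (u t) ka x.
Let q1 t x := be * convol (u t) dka x.
Let r0 t x := convol (eta t) ka x.
Let r1 t x := be * convol (eta t) dka x.
Let m0 t x := convol (v t) ka x.
Let m1 t x := be * convol (v t) dka x.
Let n0 t x := convol (w t) ka x.
Let n1 t x := be * convol (w t) dka x.
Let M1 t x := convol (w t) (rho e) x.
Let M2 t x := convol (v t) (rho e) x.

Let E1 g dg x : sqintegrable g -> L2_weak_derivative g dg ->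
  convol g (derive1 (rho e)) x = convol dg (rho e) x.
Proof. move=> sg wg; exact: (convol_weak_derivative x sg wg (@smooth_rho R e) rhoS drho). Qed.
Let E2 g dg x : sqintegrable g -> L2_weak_derivative g dg ->
  convol g (derive1 (derive1 (rho e))) x = convol dg (derive1 (rho e)) x.
Proof. move=> sg wg; exact: (convol_weak_derivative x sg wg sdrho drhoS ddrho). Qed.

Let dxrho g dg x : sqintegrable g -> L2_weak_derivative g dg ->
  is_derive x 1 (convol g (rho e)) (be^-1 * (be * convol dg (rho e) x)).
Proof.
move=> sg wg; rewrite mulKf// -(E1 x sg wg).
exact: (is_derive_convol_supported x sg (@smooth_rho R e) rhoS).
Qed.
Let dxdrho g x : sqintegrable g -> is_derive x 1 (fun x => be * convol g (rho e) x)
  (be^-1 * (be ^+ 2 * convol g (derive1 (rho e)) x)).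
Proof.
move=> sg; rewrite expr2 -mulrA mulKf//.
exact: is_derive_fZ (is_derive_convol_supported x sg (@smooth_rho R e) rhoS).
Qed.
Let dxka g x : sqintegrable g -> is_derive x 1 (convol g ka) (be^-1 * (be * convol g dka x)).
Proof. by move=> sg; rewrite mulKf//; case: (mollified_dx be0 ee x sg). Qed.
Let dxdka g x : sqintegrable g -> is_derive x 1 (fun x => be * convol g dka x)
  (be^-1 * (convol g ka x - convol g (rho e) x)).
Proof.
move=> sg; case: (mollified_dx be0 ee x sg) => _ _ _ h.
by apply: (is_derive_eq (is_derive_fZ be h)); field.
Qed.

Let dtU t x : is_derive t 1 (U^~ x) (- (be^-1 * (C * N1 t x + (1 - C) * r1 t x + m1 t x))).
Proof.
apply: (is_derive_eq (mollified_dt be0 ee cu ceta cv weak_u t x)).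
by rewrite (E1 x (se t) (we t)) /N1 /r1 /m1; field.
Qed.
Let dtN t x : is_derive t 1 (N^~ x) (- (be^-1 * (A * U1 t x + (1 - A) * q1 t x + n1 t x))).
Proof.
apply: (is_derive_eq (mollified_dt be0 ee ceta cu cw weak_eta t x)).
by rewrite (E1 x (su t) (wu t)) /U1 /q1 /n1; field.
Qed.
Let dtU1 t x : is_derive t 1 (U1^~ x) (- (be^-1 *
  (C * N2 t x + (1 - C) * (r0 t x - N t x) + (m0 t x - M2 t x)))).
Proof.
have -> : U1^~ x = fun s => be * convol (u s) (derive1 (rho e)) x.
  by apply/funext => s; rewrite /U1 (E1 x (su s) (wu s)).
apply: (is_derive_eq (is_derive_fZ be (mollified_dtx be0 ee cu ceta cv weak_u t x))).
by rewrite (E2 x (se t) (we t)) /N2 /r0 /m0 /N /M2 /ka; field.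
Qed.
Let dtN1 t x : is_derive t 1 (N1^~ x) (- (be^-1 *
  (A * U2 t x + (1 - A) * (q0 t x - U t x) + (n0 t x - M1 t x)))).
Proof.
have -> : N1^~ x = fun s => be * convol (eta s) (derive1 (rho e)) x.
  by apply/funext => s; rewrite /N1 (E1 x (se s) (we s)).
apply: (is_derive_eq (is_derive_fZ be (mollified_dtx be0 ee ceta cu cw weak_eta t x))).
by rewrite (E2 x (su t) (wu t)) /U2 /q0 /n0 /U /M1 /ka; field.
Qed.

(** A nonnegative kernel dominating the mollifier, [ka] and be |dka| simultaneously, so that one
    convolution bounds all fields. *)
Let k z := rho e z + ka z.
Let ka0 z : 0 <= ka z. Proof. exact: kappa_ge0. Qed.
Let rho0 z : 0 <= rho e z. Proof. exact: rho_ge0. Qed.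
Let sk : sqintegrable k. Proof. exact: sqintegrableD. Qed.
Let P t x := (1 + be) * convol (total_size t) k x.

Let Q t x := convol (total_size t) k x.

Let Q0 t x : 0 <= Q t x.
Proof.
by apply: Rintegral_ge0 => y _; rewrite mulr_ge0 ?addr_ge0.
Qed.

Let QP t x : Q t x <= P t x.
Proof. by rewrite /P mulrDl mul1r lerDl mulr_ge0 ?Q0// ltW. Qed.

Let boundQ t x g h c : sqintegrable g -> sqintegrable h -> 0 <= c ->
  {ae mu, forall y, `|g y| <= total_size t y} -> (forall z, `|h z| <= c * k z) ->
  `|convol g h x| <= c * Q t x.
Proof. by move=> sg sh c0 gt hk; exact: (convol_dominated x sg (sf t)). Qed.

Let bound_rho t x g : sqintegrable g -> {ae mu, forall y, `|g y| <= total_size t y} ->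
  `|convol g (rho e) x| <= P t x /\ `|be * convol g (rho e) x| <= P t x.
Proof.
move=> sg gt; have hk z : `|rho e z| <= 1 * k z by rewrite mul1r ger0_norm// lerDl.
have := boundQ x sg srho ler01 gt hk; rewrite mul1r => h; split; first exact: le_trans (QP t x).
rewrite normrM gtr0_norm// (le_trans (ler_wpM2l (ltW be0) h))// /P ler_wpM2r ?Q0//.
by rewrite lerDr.
Qed.

Let bound_ka t x g : sqintegrable g -> {ae mu, forall y, `|g y| <= total_size t y} ->
  `|convol g ka x| <= P t x /\ `|be * convol g dka x| <= P t x.
Proof.
move=> sg gt; have hk z : `|ka z| <= 1 * k z by rewrite mul1r ger0_norm// lerDr.
have hdk z : `|dka z| <= be^-1 * k z.
  by rewrite ler_pdivlMl// (le_trans (dkappa_le be0 z ee))// lerDr.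
have h := boundQ x sg ska ler01 gt hk; rewrite mul1r in h.
have h' := boundQ x sg sdka (ltW lam0) gt hdk.
split; first exact: le_trans (QP t x).
by rewrite normrM gtr0_norm// -ler_pdivlMl// (le_trans h')// ler_wpM2l ?(ltW lam0).
Qed.

Let ae_all (p : R -> Prop) : (forall y, p y) -> {ae mu, forall y, p y}.
Proof. by move=> hp; exact: aeW. Qed.

Let u_le t : {ae mu, forall y, `|u t y| <= total_size t y}.
Proof. by apply: ae_all => y; rewrite /total_size -!addrA lerDl !addr_ge0. Qed.
Let ux_le t : {ae mu, forall y, `|ux t y| <= total_size t y}.
Proof. by apply: ae_all => y; rewrite /total_size -!addrA addrCA lerDl !addr_ge0. Qed.
Let eta_le t : {ae mu, forall y, `|eta t y| <= total_size t y}.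
Proof. by apply: ae_all => y; rewrite /total_size addrAC lerDr !addr_ge0. Qed.
Let etax_le t : {ae mu, forall y, `|etax t y| <= total_size t y}.
Proof. by apply: ae_all => y; rewrite /total_size lerDr !addr_ge0. Qed.

Let u_le1 t : small_at t -> {ae mu, forall y, `|u t y| <= 1}.
Proof.
move=> [h _]; apply: (ae_imp (H1_sup_ae (su t) (wu t))) => y hy; apply: (le_trans hy).
by apply: (le_trans h); lra.
Qed.

(** Since |u| <= 1 almost everywhere, the quadratic sources are bounded linearly, and the function
    [P] that controls q and r also controls m and n. *)
Let v_le t : small_at t -> {ae mu, forall y, `|v t y| <= total_size t y}.
Proof.
move=> h; apply: (ae_imp (ae_and (u_le1 h) (u_le t))) => y [h1 h2].
rewrite /v normrM ger0_norm// expr2 normrM; apply: (le_trans _ h2).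
by have := normr_ge0 (u t y); nra.
Qed.

Let w_le t : small_at t -> {ae mu, forall y, `|w t y| <= total_size t y}.
Proof.
move=> h; apply: (ae_imp (ae_and (u_le1 h) (eta_le t))) => y [h1 h2].
by rewrite /w normrM; apply: (le_trans _ h2); rewrite ler_piMl.
Qed.

Let U_small t x : small_at t -> `|U t x| <= 128^-1.
Proof. by move=> [h _]; exact: le_trans (convol_rho_sup x (su t) (wu t) ee) h. Qed.
Let N_small t x : small_at t -> `|N t x| <= 128^-1.
Proof. by move=> [_ h]; exact: le_trans (convol_rho_sup x (se t) (we t) ee) h. Qed.

Let norm_small (f g : R -> R) : small_H1 f g -> L2norm g <= 1.
Proof.
rewrite /small_H1 => h; have k0 : 2 <= sup_cst :> R by rewrite lerDl L2norm_ge0.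
have a1 : 0 <= L2norm f + L2norm g by rewrite addr_ge0 ?L2norm_ge0.
by have := ler_wpM2r a1 k0; have := L2norm_ge0 f; have := L2norm_ge0 g; lra.
Qed.

Let product_close t x g dg : small_H1 g dg -> sqintegrable g -> L2_weak_derivative g dg ->
  sqintegrable (fun y => u t y * g y) ->
  `|U t x * convol g (rho e) x - convol (fun y => u t y * g y) (rho e) x| <=
  Num.sqrt (5 * e) * P t x.
Proof.
move=> hg sg wg sug; apply: (le_trans (convol_mul_close x (su t) sg wg sug e0)).
have hb : `|convol (fun y => `|u t y|) (rho e) x| <= P t x.
  apply: (bound_rho x (sqintegrable_norm (su t)) _).1.
  by apply: (ae_imp (u_le t)) => y; rewrite normr_id.
rewrite -mulrA ler_wpM2l ?sqrtr_ge0//; apply: (le_trans _ hb).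
apply: (le_trans (ler_wpM2l (L2norm_ge0 _) (ler_norm _))).
by rewrite ler_piMl// (norm_small hg).
Qed.

Let UN_close t x : small_at t -> `|U t x * N t x - M1 t x| <= Num.sqrt (5 * e) * P t x.
Proof. by move=> [_ h]; exact: (product_close x h (se t) (we t) (sw t)). Qed.

Let UU_close t x : small_at t -> `|2^-1 * U t x ^+ 2 - M2 t x| <= Num.sqrt (5 * e) * P t x.
Proof.
move=> [h _]; have [suu _] := H1curve_mul hu hu.
have -> : M2 t x = 2^-1 * convol (fun y => u t y * u t y) (rho e) x.
  rewrite /M2 /convol -RintegralZl//; last exact: (convol_integrable x (suu t) srho).
  by apply: eq_Rintegral => y _; rewrite /v expr2 !mulrA.
rewrite -mulrBr normrM ger0_norm// expr2.
have h1 := product_close x h (su t) (wu t) (suu t).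
by apply: (le_trans _ h1); rewrite ler_piMl//; lra.
Qed.

(** A bound for the mass of [k] that does not depend on e, so that the error constant stays fixed as
    e tends to 0. *)
Definition kernel_mass : R := 1 + kappa_cst be * \int[mu]_x env be^-1 x.

Let k_mass : 0 <= \int[mu]_x k x <= kernel_mass.
Proof.
have ika := exp_decay_integrable lam0 (exp_decay_kappa be0 ee).
have ienv := integrable_env lam0.
apply/andP; split; first by apply: Rintegral_ge0 => x _; rewrite addr_ge0.
rewrite RintegralD//; last exact: rho_integrable.
rewrite integral_rho// lerD2l -RintegralZl//; apply: le_integral_integrableR => //.
  exact: integrableRZ.
by move=> x; exact: kappa_le.
Qed.

Let P_measurable t : measurable_fun setT (P t).
Proof.
apply: measurable_funM => //; apply: continuous_measurable_fun.
have -> : convol (total_size t) k = fun x => 1 * convol (total_size t) (rho e) x + 1 * convol (total_size t) ka x.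
  apply/funext => x; rewrite -(convolZDr 1 1 x (sf t) srho ska); congr convol.
  by apply/funext => z; rewrite !mul1r.
have c1 : continuous (convol (total_size t) (rho e)).
  by move=> x; exact: is_derive_continuous (is_derive_convol_supported x (sf t) (@smooth_rho R e) rhoS).
have c2 : continuous (convol (total_size t) ka).
  by move=> x; exact: is_derive_continuous (dxka x (sf t)).
continuous_tac.
Qed.

(** Young's inequality, as [young_weighted] with the constant weight 1. The supremum of the kernel,
    of order 1 / e, is required to be finite but does not enter the estimate. *)
Let P_integrable t : small_at t -> integrableR (fun x => P t x ^+ 2) /\
  \int[mu]_x (P t x ^+ 2) <= ((1 + be) * kernel_mass) ^+ 2.
Proof.
move=> ht; have [Cr Cr0 hCr] := @rho_le R.
have ik : integrableR k.
  by apply: integrableRD; [exact: rho_integrable|exact: exp_decay_integrable (exp_decay_kappa be0 ee)].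
have kb z : 0 <= k z <= Cr / e + kappa_cst be.
  rewrite addr_ge0//= lerD ?hCr//; apply: (le_trans (kappa_le be0 z ee)).
  by rewrite ler_piMr ?env_le1// mulr_ge0 ?expR_ge0// ltW.
have := @young_weighted R (total_size t) k k (fun=> 1) (Q t) _ 1 (sf t) ik kb ik.
have mQ : measurable_fun setT (Q t).
  have -> : Q t = fun x => (1 + be)^-1 * P t x.
    by apply/funext => x; rewrite /P mulKf// gt_eqF// addr_gt0.
  exact: measurable_funM.
case=> //.
- by move=> z; case/andP: (kb z).
- by move=> z; rewrite ler01 lexx.
- move=> x; rewrite ger0_norm ?Q0// le_eqVlt; apply/orP; left; apply/eqP.
  apply: eq_Rintegral => y _; congr (_ * _); rewrite ger0_norm// !addr_ge0//.
move=> iQ; rewrite (_ : (fun x => 1 * Q t x ^+ 2) = fun x => Q t x ^+ 2) in iQ *; last first.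
  by apply/funext => x; rewrite mul1r.
under [X in _ * X]eq_Rintegral do rewrite mul1r.
move=> hQ.
have -> : (fun x => P t x ^+ 2) = fun x => (1 + be) ^+ 2 * Q t x ^+ 2.
  by apply/funext => x; rewrite /P exprMn.
split; first exact: integrableRZ.
rewrite RintegralZl// exprMn ler_wpM2l ?sqr_ge0//; apply: (le_trans hQ).
have /andP[k0 k1] := k_mass.
rewrite -[leRHS]mulr1 expr2; apply: ler_pM; rewrite ?mulr_ge0 ?integral_sqr_ge0//.
  exact: ler_pM.
exact: total_size_small.
Qed.

(* be * convol (ux t) (rho e) is D applied to the mollification of u t. *)
Definition mollified_density t x := energy_density A C (convol (u t) (rho e) x)
  (be * convol (ux t) (rho e) x) (convol (eta t) (rho e) x) (be * convol (etax t) (rho e) x).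

Variables (chi dchi om : R -> R) (Mw : R).
Hypotheses (hchi : forall y, is_derive y 1 chi (dchi y))
  (hdchi : forall y, is_derive y 1 dchi (om y * dchi y))
  (chi01 : forall y, 0 <= chi y <= 1) (dchi0 : forall y, 0 <= dchi y <= Mw)
  (om_le : forall y, be * `|om y| <= 96^-1) (com : continuous om).

Lemma mollified_energy_balance s1 s2 c T L : `|s1| = 1 -> `|s2| = 1 -> e <= 5^-1 ->
  0 < L -> 0 <= T -> (forall t, 0 <= s2 * t <= T -> small_at t) ->
  \int[mu]_(x in `[- L, L]) (cutoff L x * (chi (s1 * x + (- 2 * s2 * (s2 * T) - c)) *
     mollified_density (s2 * T) x)) <=
  \int[mu]_(x in `[- L, L]) (cutoff L x * (chi (s1 * x + (- 2 * s2 * 0 - c)) *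
     mollified_density 0 x))
    + T * ((2 / L + Num.sqrt (5 * e) / be) * (48 + 560 * (be * Mw)) * ((1 + be) * kernel_mass) ^+ 2).
Proof.
move=> s1E s2E e5 L0 T0 small.
have cdrho g x : sqintegrable g -> {for x, continuous (convol g (derive1 (rho e)))}.
  by move=> sg; exact: is_derive_continuous (is_derive_convol_supported x sg sdrho drhoS).
have crho g x : sqintegrable g -> {for x, continuous (convol g (rho e))}.
  by move=> sg; exact: is_derive_continuous (is_derive_convol_supported x sg (@smooth_rho R e) rhoS).
have cU2 t : continuous (U2 t).
  by apply: continuous_mul; [exact: continuous_fcst|move=> x; exact: cdrho].
have cN2 t : continuous (N2 t).
  by apply: continuous_mul; [exact: continuous_fcst|move=> x; exact: cdrho].
have cM1 t : continuous (M1 t) by move=> x; exact: crho.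
have cM2 t : continuous (M2 t) by move=> x; exact: crho.
have bc (d : R) V h : L2curve V -> sqintegrable h -> locally_bounded (fun t x => d * convol (V t) h x).
  by move=> cV sh; exact: locally_boundedM (locally_bounded_cst d) (locally_bounded_convol cV sh).
have bl := @locally_bounded_convol R.
(* The relative error of the mollified products plays the role of d in [energy_balance] and has to
   be at most 1; hence e <= 1/5. *)
have d01 : 0 <= Num.sqrt (5 * e) <= 1.
  by rewrite sqrtr_ge0 -[leRHS]sqrtr1 ler_wsqrtr//; lra.
have H := (energy_balance be0 A0 C0 AC2
  (fun t x => dxrho x (su t) (wu t)) (fun t x => dxdrho x (sux t))
  (fun t x => dxrho x (se t) (we t)) (fun t x => dxdrho x (sex t))
  (fun t x => dxka x (su t)) (fun t x => dxdka x (su t))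
  (fun t x => dxka x (se t)) (fun t x => dxdka x (se t))
  (fun t x => dxka x (sv t)) (fun t x => dxdka x (sv t))
  (fun t x => dxka x (sw t)) (fun t x => dxdka x (sw t))
  dtU dtU1 dtN dtN1 cU2 cN2 cM1 cM2
  (bl _ _ cu srho) (bc be _ _ cux srho) (bc (be ^+ 2) _ _ cux sqdrho)
  (bl _ _ ceta srho) (bc be _ _ cetax srho) (bc (be ^+ 2) _ _ cetax sqdrho)
  (bl _ _ cu ska) (bc be _ _ cu sdka) (bl _ _ ceta ska) (bc be _ _ ceta sdka)
  (bl _ _ cv ska) (bc be _ _ cv sdka) (bl _ _ cw ska) (bc be _ _ cw sdka)
  (bl _ _ cw srho) (bl _ _ cv srho)
  hchi hdchi chi01 dchi0 om_le com c s1E s2E (P := P) L0 T0 d01).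
refine (H (((1 + be) * kernel_mass) ^+ 2) _) => {H} t tT.
have ht := small t tT; have [iP PK] := P_integrable ht; split=> // x.
have [hU hU1] := (bound_rho x (su t) (u_le t), bound_rho x (sux t) (ux_le t)).
have [hN hN1] := (bound_rho x (se t) (eta_le t), bound_rho x (sex t) (etax_le t)).
have [hq hr] := (bound_ka x (su t) (u_le t), bound_ka x (se t) (eta_le t)).
have [hm hn] := (bound_ka x (sv t) (v_le ht), bound_ka x (sw t) (w_le ht)).
split; [exact: U_small|exact: N_small|exact: UN_close|exact: UU_close|].
move=> f; rewrite !inE => /or4P[/eqP->|/eqP->|/eqP->|].
- exact: hU.1.
- exact: hU1.2.
- exact: hN.1.
move=> /or4P[/eqP->|/eqP->|/eqP->|].
- exact: hN1.2.
- exact: hq.1.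
- exact: hq.2.
move=> /or4P[/eqP->|/eqP->|/eqP->|].
- exact: hr.1.
- exact: hr.2.
- exact: hm.1.
move=> /or3P[/eqP->|/eqP->|/eqP->].
- exact: hm.2.
- exact: hn.1.
- exact: hn.2.
Qed.

End mollified_energy.

(** * Removing the mollification *)

Section passage_to_the_limit.
Context {R : realType}.
Local Notation mu := (@lebesgue_measure R).
Implicit Types (f g psi : R -> R) (x y z s t c M d e H : R).

Lemma integral_dominated_cvg (fn : nat -> R -> R) f g : (forall n, measurable_fun setT (fn n)) ->
  measurable_fun setT f -> {ae mu, forall x, fn n x @[n --> \oo] --> f x} -> integrableR g ->
  (forall n x, `|fn n x| <= g x) ->
  (\int[mu]_x fn n x) @[n --> \oo] --> \int[mu]_x f x.
Proof.
move=> mfn mf fnf ig fng.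
have [||||| if_ _ hcv] := @dominated_convergence _ _ _ mu setT measurableT
  (fun n x => (fn n x)%:E) (EFin \o f) (EFin \o g).
- by move=> n; apply/measurable_EFinP; exact: mfn.
- exact/measurable_EFinP.
- by apply: (ae_imp fnf) => x hx _; apply: cvg_EFin => //; exact: nearW.
- exact: ig.
- by apply: aeW => x n _; rewrite /= lee_fin.
have h : (\int[mu]_x (fn n x)%:E)%E @[n --> \oo] --> (\int[mu]_x f x)%:E.
  by rewrite EFin_integral.
exact: fine_cvg h.
Qed.

(** Fatou's lemma for a limit already known to be integrable: the minimum of gn n and g is dominated
    by g and converges to g. *)
Lemma integral_le_of_cvg (gn : nat -> R -> R) g (Bn : nat -> R) B :
  (forall n, integrableR (gn n)) -> (forall n x, 0 <= gn n x) -> integrableR g ->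
  (forall x, 0 <= g x) -> {ae mu, forall x, gn n x @[n --> \oo] --> g x} ->
  (\forall n \near \oo, \int[mu]_x gn n x <= Bn n) -> Bn n @[n --> \oo] --> B ->
  \int[mu]_x g x <= B.
Proof.
move=> ign gn0 ig g0 gng hB BB.
have mg := integrableR_measurable ig.
have mm n : measurable_fun setT (fun x => Num.min (gn n x) (g x)).
  by apply: measurable_minr => //; exact: integrableR_measurable.
have mle n x : `|Num.min (gn n x) (g x)| <= g x.
  by rewrite ger0_norm ?ge_min ?lexx ?orbT// le_min gn0 g0.
have cv : {ae mu, forall x, Num.min (gn n x) (g x) @[n --> \oo] --> g x}.
  (* The minimum is written with an absolute value, so that its limit follows from the algebra of
     limits. *)
  apply: (ae_imp gng) => x hx; rewrite -[X in _ --> X]minxx minr_absE.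
  under eq_cvg do rewrite minr_absE.
  apply: cvgM; last exact: cvg_cst.
  apply: cvgB; first by apply: cvgD => //; exact: cvg_cst.
  by apply: cvg_norm; apply: cvgB => //; exact: cvg_cst.
have := integral_dominated_cvg mm mg cv ig mle.
move/ler_cvg_to; apply; first exact: BB.
apply: filterS hB => n; apply: le_trans; apply: le_integral_integrableR => //.
  exact: (le_integrableR (mm n) ig (mle n)).
by move=> x; rewrite ge_min lexx.
Qed.

(** [rho e] lives in [-1, 1], where the weight varies by a factor H at most, so [young_weighted]
    applies with k2 = H rho e, of mass H. *)
Lemma mollification_weighted f psi H e : sqintegrable f -> 0 < e <= 1 ->
  measurable_fun setT psi -> (forall x, 0 <= psi x <= 1) -> 0 <= H ->
  (forall x y, `|x - y| <= 1 -> psi x <= H * psi y) ->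
  integrableR (fun x => psi x * convol f (rho e) x ^+ 2) /\
  \int[mu]_x (psi x * convol f (rho e) x ^+ 2) <= H * \int[mu]_x (psi x * f x ^+ 2).
Proof.
move=> sf /andP[e0 e1] mpsi psi01 H0 hH; have [Cr Cr0 hCr] := @rho_le R.
have ir := rho_integrable e0; have sr := sqintegrable_rho e0.
have kb z : 0 <= rho e z <= Cr / e by rewrite rho_ge0//= hCr.
have k20 z : 0 <= H * rho e z by rewrite mulr_ge0// rho_ge0.
have har x y : psi x * rho e (x - y) <= psi y * (H * rho e (x - y)).
  have [xy|xy] := leP e `|x - y|; first by rewrite (rho_supported e0 xy) !mulr0.
  rewrite mulrA [psi y * H]mulrC ler_wpM2r ?rho_ge0// hH//; lra.
have mU : measurable_fun setT (convol f (rho e)).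
  apply: continuous_measurable_fun => x.
  exact: is_derive_continuous (is_derive_convol_supported x sf (@smooth_rho R e) (rho_supported e0)).
have hU x : `|convol f (rho e) x| <= \int[mu]_y (`|f y| * rho e (x - y)).
  apply: (le_trans (le_normr_Rintegral measurableT (convol_integrable x sf sr))).
  rewrite le_eqVlt; apply/orP; left; apply/eqP; apply: eq_Rintegral => y _.
  by rewrite normrM (ger0_norm (rho_ge0 _ e0)).
have [iP hP] := young_weighted sf ir kb (integrableRZ H ir) k20 mpsi psi01 har mU hU.
by split=> //; rewrite (le_trans hP)// RintegralZl// integral_rho// mulr1 mul1r.
Qed.

Lemma cutoff_cvg x : (\1_(`[- n.+1%:R, n.+1%:R]%classic) x * cutoff n.+1%:R x : R)
  @[n --> \oo] --> (1 : R).
Proof.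
have h1 : (1 - n.+1%:R^-1 * (n.+1%:R^-1 * x ^+ 2) : R) @[n --> \oo] --> (1 : R).
  rewrite -[X in _ --> X]subr0; apply: cvgB; first exact: cvg_cst.
  rewrite -[X in _ --> X](mul0r (0 * x ^+ 2)); apply: cvgM; first exact: cvg_harmonic.
  by apply: cvgM; [exact: cvg_harmonic|exact: cvg_cst].
apply: cvg_trans h1; apply: near_eq_cvg; near=> n.
have xn : `|x| <= n.+1%:R.
  have hx : `|x| <= n%:R by near: n; exact: nbhs_infty_ger.
  by apply: (le_trans hx); rewrite ler_nat.
rewrite indicE mem_set ?mul1r; last by rewrite /= in_itv /= -ler_norml.
by rewrite /cutoff expr2 invfM -mulrA.
Unshelve. all: by end_near. Qed.

End passage_to_the_limit.

(** * The weighted energy inequality for weak solutions *)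

Section weighted_energy.
Context {R : realType}.
Local Notation mu := (@lebesgue_measure R).
Implicit Types (x y z s t c M d H : R).

Lemma integral_segment_indic (h : R -> R) p q : continuous h ->
  integrableR (fun x => \1_(`[p, q]%classic) x * h x) /\
  \int[mu]_x (\1_(`[p, q]%classic) x * h x) = \int[mu]_(x in `[p, q]) h x.
Proof.
move=> ch; have e1 : (fun x => \1_(`[p, q]%classic) x * h x) = h \_ `[p, q].
  by apply/funext => x; rewrite patchE indicE; case: ifP => _; rewrite ?mul1r ?mul0r.
rewrite e1 -Rintegral_mkcond; split=> //.
have := continuous_segment_integrable p q ch; rewrite integrable_mkcond//; congr integrable.
by apply/funext => x; rewrite /= /patch; case: ifP.
Qed.

(** The least coefficient of the energy density as a form in u, its derivative, eta and its
    derivative; 1/4 lies below (1 + N) / 2 for |N| <= 1/128, which takes care of the cubic term. *)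
Definition coercivity (be A C : R) := Num.min 4^-1 (Num.min (A * be ^+ 2 / 2) (C * be ^+ 2 / 2)).

Lemma energy_density_bounds (be A C U Ux N Nx : R) : 0 <= A -> 0 <= C -> A + C <= 2 ->
  `|N| <= 128^-1 ->
  coercivity be A C * (U ^+ 2 + Ux ^+ 2 + N ^+ 2 + Nx ^+ 2) <=
    energy_density A C U (be * Ux) N (be * Nx) <=
  (1 + be ^+ 2) * (U ^+ 2 + Ux ^+ 2 + N ^+ 2 + Nx ^+ 2).
Proof.
move=> A0 C0 AC2; rewrite ler_norml => /andP[N1 N2].
have [a1 a2 a3] : [/\ coercivity be A C <= 4^-1, coercivity be A C <= A * be ^+ 2 / 2 &
    coercivity be A C <= C * be ^+ 2 / 2].
  by rewrite /coercivity !ge_min !lexx !orbT.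
have A2 : A <= 2 by lra.
have C2 : C <= 2 by lra.
move: a1 a2 a3; set al := coercivity be A C; rewrite /energy_density !exprMn.
have b0 := sqr_ge0 be; move: (be ^+ 2) b0 => b b0.
have U0 := sqr_ge0 U; have X0 := sqr_ge0 Ux; have N0 := sqr_ge0 N; have Y0 := sqr_ge0 Nx.
have hN1 := ler_wpM2l U0 N1; have hN2 := ler_wpM2l U0 N2.
move: (U ^+ 2) (Ux ^+ 2) (N ^+ 2) (Nx ^+ 2) U0 X0 N0 Y0 hN1 hN2 => p1 p2 p3 p4 U0 X0 N0 Y0 hN1 hN2.
move=> a1 a2 a3.
have h1 := ler_wpM2r U0 a1; have h2 := ler_wpM2r X0 a2.
have h3 := ler_wpM2r N0 a1; have h4 := ler_wpM2r Y0 a3.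
have bx := mulr_ge0 b0 X0; have by_ := mulr_ge0 b0 Y0.
have bu := mulr_ge0 b0 U0; have bn := mulr_ge0 b0 N0.
have k1 := ler_wpM2r bx A2; have k2 := ler_wpM2r by_ C2.
clear A2 C2 A0 C0 AC2 a1 a2 a3 N1 N2.
by apply/andP; split; lra.
Qed.

Lemma coercivity_gt0 (be A C : R) : 0 < be -> 0 < A -> 0 < C -> 0 < coercivity be A C.
Proof. by move=> b0 A0 C0; rewrite !lt_min !divr_gt0 ?mulr_gt0 ?exprn_gt0// invr_gt0 ltr0n. Qed.

Definition sqr_sum (u ux eta etax : R -> R) x := u x ^+ 2 + ux x ^+ 2 + eta x ^+ 2 + etax x ^+ 2.

Definition mollified_sqr_sum e (u ux eta etax : R -> R) :=
  sqr_sum (convol u (rho e)) (convol ux (rho e)) (convol eta (rho e)) (convol etax (rho e)).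

Lemma sqr_sum_ge0 u ux eta etax x : 0 <= sqr_sum u ux eta etax x.
Proof. by rewrite !addr_ge0 ?sqr_ge0. Qed.

Lemma sqr_sum_integrable u ux eta etax : sqintegrable u -> sqintegrable ux ->
  sqintegrable eta -> sqintegrable etax -> integrableR (sqr_sum u ux eta etax).
Proof. by move=> [_ h1] [_ h2] [_ h3] [_ h4]; exact/integrableRD/h4/integrableRD/h3/integrableRD. Qed.

Lemma mollified_sqr_sum_weighted u ux eta etax (psi : R -> R) H e :
  sqintegrable u -> sqintegrable ux -> sqintegrable eta -> sqintegrable etax ->
  0 < e <= 1 -> measurable_fun setT psi -> (forall x, 0 <= psi x <= 1) -> 0 <= H ->
  (forall x y, `|x - y| <= 1 -> psi x <= H * psi y) ->
  integrableR (fun x => psi x * mollified_sqr_sum e u ux eta etax x) /\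
  \int[mu]_x (psi x * mollified_sqr_sum e u ux eta etax x) <=
    H * \int[mu]_x (psi x * sqr_sum u ux eta etax x).
Proof.
move=> s1 s2 s3 s4 ee mpsi psi01 H0 hH.
have [i1 h1] := mollification_weighted s1 ee mpsi psi01 H0 hH.
have [i2 h2] := mollification_weighted s2 ee mpsi psi01 H0 hH.
have [i3 h3] := mollification_weighted s3 ee mpsi psi01 H0 hH.
have [i4 h4] := mollification_weighted s4 ee mpsi psi01 H0 hH.
have ip f : sqintegrable f -> integrableR (fun x => psi x * f x ^+ 2).
  move=> [_ h]; apply: (integrableR_bounded (M := 1)) => // x.
  by case/andP: (psi01 x) => a b; rewrite ger0_norm.
have [j1 j2 j3 j4] := (And4 (ip _ s1) (ip _ s2) (ip _ s3) (ip _ s4)).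
have e1 (f1 f2 f3 f4 : R -> R) : (fun x => psi x * sqr_sum f1 f2 f3 f4 x) =
    (fun x => psi x * f1 x ^+ 2 + psi x * f2 x ^+ 2 + psi x * f3 x ^+ 2 + psi x * f4 x ^+ 2).
  by apply/funext => x; rewrite /sqr_sum; ring.
have e2 (f1 f2 f3 f4 : R -> R) : integrableR (fun x => psi x * f1 x ^+ 2) ->
    integrableR (fun x => psi x * f2 x ^+ 2) -> integrableR (fun x => psi x * f3 x ^+ 2) ->
    integrableR (fun x => psi x * f4 x ^+ 2) ->
    integrableR (fun x => psi x * sqr_sum f1 f2 f3 f4 x) /\
    \int[mu]_x (psi x * sqr_sum f1 f2 f3 f4 x) = \int[mu]_x (psi x * f1 x ^+ 2)
      + \int[mu]_x (psi x * f2 x ^+ 2) + \int[mu]_x (psi x * f3 x ^+ 2)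
      + \int[mu]_x (psi x * f4 x ^+ 2).
  move=> l1 l2 l3 l4; rewrite e1; have l12 := integrableRD l1 l2; have l123 := integrableRD l12 l3.
  split; first exact: integrableRD.
  by rewrite !RintegralD.
have [k1 ->] := e2 _ _ _ _ i1 i2 i3 i4; have [_ ->] := e2 _ _ _ _ j1 j2 j3 j4; split=> //.
by rewrite !mulrDr !lerD.
Qed.

Variables (be A C : R).
Hypotheses (be0 : 0 < be) (A0 : 0 < A) (C0 : 0 < C) (AC2 : A + C <= 2).
Variables (u ux eta etax : R -> R -> R).
Hypotheses (hu : H1curve u ux) (he : H1curve eta etax).
Hypothesis weak_eta : forall phi, test_function2 phi ->
  \int[mu]_t (\int[mu]_x
      (eta t x * (dt phi t x - be ^+ 2 * dx (dx (dt phi)) t x)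
       + (- A * be ^+ 2) * u t x * dx (dx (dx phi)) t x
       + (u t x + u t x * eta t x) * dx phi t x)) = 0.
Hypothesis weak_u : forall phi, test_function2 phi ->
  \int[mu]_t (\int[mu]_x
      (u t x * (dt phi t x - be ^+ 2 * dx (dx (dt phi)) t x)
       + (- C * be ^+ 2) * eta t x * dx (dx (dx phi)) t x
       + (eta t x + 2^-1 * u t x ^+ 2) * dx phi t x)) = 0.
Variables (chi dchi om : R -> R) (Mw H : R).
Hypotheses (hchi : forall y, is_derive y 1 chi (dchi y))
  (hdchi : forall y, is_derive y 1 dchi (om y * dchi y))
  (chi01 : forall y, 0 <= chi y <= 1) (dchi0 : forall y, 0 <= dchi y <= Mw)
  (om_le : forall y, be * `|om y| <= 96^-1) (com : continuous om)
  (H0 : 0 <= H) (harnack : forall x y, `|x - y| <= 1 -> chi x <= H * chi y).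

Let q t := sqr_sum (u t) (ux t) (eta t) (etax t).
Let D e t := mollified_sqr_sum e (u t) (ux t) (eta t) (etax t).

(** Along L = n + 1 and e = 1 / (n + 1) both errors vanish. At the final time the coercive lower
    bound passes to the limit by [integral_le_of_cvg]; at time 0 the upper bound needs no limit,
    since [mollified_sqr_sum_weighted] removes the mollification at the price of H. *)
Lemma weighted_energy s1 s2 c T : `|s1| = 1 -> `|s2| = 1 -> 0 <= T ->
  (forall t, 0 <= s2 * t <= T -> small_at u ux eta etax t) ->
  coercivity be A C * \int[mu]_x (chi (s1 * x + (- 2 * s2 * (s2 * T) - c)) * q (s2 * T) x) <=
  (1 + be ^+ 2) * (H * \int[mu]_x (chi (s1 * x + (- 2 * s2 * 0 - c)) * q 0 x)).
Proof.
move=> s1E s2E T0 small.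
pose psi t x := chi (s1 * x + (- 2 * s2 * t - c)).
have psi01 t x : 0 <= psi t x <= 1 by exact: chi01.
have cpsi t : continuous (psi t).
  move=> x; exact: is_derive_continuous (@is_derive_comp_affine _ chi x s1 _ _ (hchi _)).
have mpsi t : measurable_fun setT (psi t) by exact: continuous_measurable_fun (cpsi t).
have psiH t x y : `|x - y| <= 1 -> psi t x <= H * psi t y.
  move=> xy; apply: harnack.
  rewrite (_ : _ - _ = s1 * (x - y)); last by ring.
  by rewrite normrM s1E mul1r.
have [[su _] [sux _] wu] := hu; have [[se _] [sex _] we] := he.
set al := coercivity be A C; have al0 : 0 < al by exact: coercivity_gt0.
pose e (n : nat) : R := n.+1%:R^-1; pose L (n : nat) : R := n.+1%:R.
have e01 n : 0 < e n <= 1 by rewrite invr_gt0 ltr0n invf_le1 ?ltr0n ?ler1n.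
have cconv f n : sqintegrable f -> continuous (convol f (rho (e n))).
  move=> sf x; have /andP[en _] := e01 n.
  exact: is_derive_continuous (is_derive_convol_supported x sf (@smooth_rho R _) (rho_supported en)).
have cD n t : continuous (D (e n) t).
  have c1 := cconv _ n (su t); have c2 := cconv _ n (sux t); have c3 := cconv _ n (se t).
  have c4 := cconv _ n (sex t); rewrite /D /mollified_sqr_sum /sqr_sum; continuous_tac.
have cdens n t : continuous (mollified_density be A C u ux eta etax (e n) t).
  have c1 := cconv _ n (su t); have c2 := cconv _ n (sux t); have c3 := cconv _ n (se t).
  have c4 := cconv _ n (sex t); rewrite /mollified_density /energy_density; continuous_tac.
have bounds n t x : small_at u ux eta etax t -> al * D (e n) t x <=
    mollified_density be A C u ux eta etax (e n) t x <= (1 + be ^+ 2) * D (e n) t x.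
  move=> [_ ht]; apply: energy_density_bounds; [exact: ltW|exact: ltW|exact: AC2|].
  exact: (le_trans (convol_rho_sup x (se t) (we t) (e01 n)) ht).
have cg n t (f : R -> R) : continuous f -> continuous (fun x => cutoff (L n) x * (psi t x * f x)).
  by move=> cf; apply: continuous_mul; [exact: continuous_cutoff|exact: continuous_mul].
(* The lower bound replaces the energy density here, because its almost everywhere limit is the
   quadratic quantity of the statement. *)
pose gn n x := \1_(`[- L n, L n]%classic) x * (cutoff (L n) x * (psi (s2 * T) x * (al * D (e n) (s2 * T) x))).
have calD n t : continuous (fun x => al * D (e n) t x).
  by apply: continuous_mul => //; exact: continuous_fcst.
have gnP n := integral_segment_indic (- L n) (L n) (cg n (s2 * T) _ (calD n (s2 * T))).
have s2s2 : s2 * s2 = 1 by rewrite -expr2 -(real_normK (num_real s2)) s2E expr1n.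
have smallT : small_at u ux eta etax (s2 * T).
  by apply: small; rewrite mulrA s2s2 mul1r T0 lexx.
have small0 : small_at u ux eta etax 0 by apply: small; rewrite mulr0 lexx T0.
have qi t : integrableR (q t) by exact: sqr_sum_integrable.
have psiq t s : integrableR (fun x => psi t x * q s x).
  apply: (integrableR_bounded (M := 1)) => // x.
  by case/andP: (psi01 t x) => a b; rewrite ger0_norm.
have <- : \int[mu]_x (al * (psi (s2 * T) x * q (s2 * T) x)) =
    al * \int[mu]_x (psi (s2 * T) x * q (s2 * T) x).
  exact: (RintegralZl al measurableT (psiq (s2 * T) (s2 * T))).
pose K := (48 + 560 * (be * Mw)) * ((1 + be) * kernel_mass be) ^+ 2.
pose Bn n := (1 + be ^+ 2) * (H * \int[mu]_x (psi 0 x * q 0 x)) +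
  T * ((2 * e n + Num.sqrt (5 * e n) / be) * K).
apply: (@integral_le_of_cvg R gn (fun x => al * (psi (s2 * T) x * q (s2 * T) x)) Bn).
- by move=> n; have [] := gnP n.
- move=> n x; rewrite /gn indicE; case: (boolP (x \in _)) => [/set_mem xI|_]; last by rewrite mul0r.
  have /andP[p0 _] := psi01 (s2 * T) x; have /andP[c0 _] := cutoff_ge0_le1 xI.
  by rewrite mul1r !mulr_ge0 ?(ltW al0)// sqr_sum_ge0.
- exact: integrableRZ.
- move=> x; have /andP[p0 _] := psi01 (s2 * T) x.
  by apply: mulr_ge0; [exact: ltW|rewrite mulr_ge0// sqr_sum_ge0].
- have := ae_and (ae_and (convol_rho_ae (su (s2 * T))) (convol_rho_ae (sux (s2 * T))))
    (ae_and (convol_rho_ae (se (s2 * T))) (convol_rho_ae (sex (s2 * T)))).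
  move/ae_imp; apply => x [[h1 h2] [h3 h4]].
  have -> : gn^~ x = fun n => (\1_(`[- n.+1%:R, n.+1%:R]%classic) x * cutoff n.+1%:R x) *
      (al * (psi (s2 * T) x * D (e n) (s2 * T) x)).
    by apply/funext => n; rewrite /gn /L; ring.
  rewrite -[X in _ --> X]mul1r; apply: cvgM; first exact: cutoff_cvg.
  apply: cvgM; first exact: cvg_cst.
  apply: cvgM; first exact: cvg_cst.
  rewrite /D /mollified_sqr_sum /q /sqr_sum.
  have sq (f : nat -> R) (l : R) : f n @[n --> \oo] --> l -> (f n ^+ 2) @[n --> \oo] --> l ^+ 2.
    by move=> hf; exact: (cvgM hf hf).
  by apply: cvgD; [apply: cvgD; [apply: cvgD|]|]; exact: sq.
- near=> n.
  (* The mollification parameter is 1 / (n + 1), so n >= 4 gives the required e <= 1/5. *)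
  have n4 : (4 <= n)%N by near: n; exact: nbhs_infty_ge.
  have e5 : e n <= 5^-1 by rewrite lef_pV2 ?posrE ?ltr0n// ler_nat.
  have L0 : 0 < L n by rewrite ltr0n.
  have [_ ->] := gnP n.
  have key := mollified_energy_balance be0 (ltW A0) (ltW C0) AC2 hu he weak_eta weak_u (e01 n)
    hchi hdchi chi01 dchi0 om_le com c s1E s2E e5 L0 T0 small.
  apply: (@le_trans _ _ (\int[mu]_(x in `[- L n, L n]) (cutoff (L n) x *
     (psi (s2 * T) x * mollified_density be A C u ux eta etax (e n) (s2 * T) x)))).
    apply: le_Rintegral.
    - exact: measurable_itv.
    - apply: continuous_segment_integrable; exact: (cg n _ _ (calD n _)).
    - apply: continuous_segment_integrable; exact: (cg n _ _ (cdens n _)).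
    move=> x xI; have /andP[c0 _] := cutoff_ge0_le1 xI; have /andP[p0 _] := psi01 (s2 * T) x.
    rewrite ler_wpM2l// ler_wpM2l//.
    by have /andP[] := bounds n _ x smallT.
  apply: (le_trans key); apply: lerD; last first.
    by rewrite /K /e /L le_eqVlt; apply/orP; left; apply/eqP; ring.
  have [iS hS] := mollified_sqr_sum_weighted (su 0) (sux 0) (se 0) (sex 0) (e01 n) (mpsi 0)
    (psi01 0) H0 (psiH 0).
  apply: (le_integral_segment _ iS _ _ hS).
  - exact: (cg n 0 _ (cdens n 0)).
  - move=> x; have /andP[p0 _] := psi01 0 x; by rewrite mulr_ge0// sqr_sum_ge0.
  - by rewrite addr_ge0// sqr_ge0.
  move=> x xI; have /andP[c0 c1] := cutoff_ge0_le1 xI; have /andP[p0 _] := psi01 0 x.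
  have /andP[b1 b2] := bounds n _ x small0.
  have d0 : 0 <= mollified_density be A C u ux eta etax (e n) 0 x.
    by apply: le_trans b1; rewrite mulr_ge0 ?(ltW al0)// sqr_sum_ge0.
  apply: (@le_trans _ _ (psi 0 x * mollified_density be A C u ux eta etax (e n) 0 x)).
    by rewrite ler_piMl// mulr_ge0.
  by rewrite [leRHS]mulrCA ler_wpM2l.
- rewrite -[X in _ --> X]addr0; apply: cvgD; first exact: cvg_cst.
  rewrite -[X in _ --> X](mulr0 T); apply: cvgM; first exact: cvg_cst.
  rewrite -[X in _ --> X](mul0r K); apply: cvgM; last exact: cvg_cst.
  have he0 : e n @[n --> \oo] --> (0 : R) by exact: cvg_harmonic.
  rewrite -[X in _ --> X]addr0; apply: cvgD.
    by rewrite -[X in _ --> X](mulr0 2); apply: cvgM => //; exact: cvg_cst.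
  rewrite -[X in _ --> X](mul0r be^-1); apply: cvgM; last exact: cvg_cst.
  rewrite -sqrtr0; apply: (@continuous_cvg _ _ _ _ _ _ _ _ (@sqrt_continuous R 0)).
  by rewrite -[X in _ --> X](mulr0 5); apply: cvgM => //; exact: cvg_cst.
Unshelve. all: by end_near. Qed.

End weighted_energy.

(** * Decay outside the cone and solitary waves *)

Section logistic.
Context {R : realType}.
Implicit Types (k x y : R).

(** By the logistic equation the second derivative is k (1 - 2 logistic) times the first, a factor
    of absolute value at most k. A small slope k therefore gives the slow variation demanded by the
    energy inequality. *)
Definition logistic k x : R := (1 + expR (- (k * x)))^-1.

Lemma logistic_gt0 k x : 0 < logistic k x.
Proof. by rewrite invr_gt0 addr_gt0 ?expR_gt0. Qed.

Lemma logistic_le1 k x : logistic k x <= 1.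
Proof. by rewrite invf_le1 ?addr_gt0 ?expR_gt0// lerDl expR_ge0. Qed.

Lemma logistic_ge0_le1 k x : 0 <= logistic k x <= 1.
Proof. by rewrite ltW ?logistic_gt0// logistic_le1. Qed.

Definition dlogistic k x : R := k * (logistic k x * (1 - logistic k x)).

Lemma is_derive_logistic k x : is_derive x 1 (logistic k) (dlogistic k x).
Proof.
have n0 : 1 + expR (- (k * x)) != 0 by rewrite gt_eqF// addr_gt0 ?expR_gt0.
have h : is_derive x 1 (fun y => 1 + expR (- (k * y))) (- (k * expR (- (k * x)))).
  apply: (is_derive_eq (is_derive_fD (is_derive_fcst x 1) (is_derive_fcomp
    (is_derive_fN (is_derive_fZ k (is_derive_id x 1))) (is_derive_expR _)))).
  by rewrite mulr1; ring.
set z := 1 + expR (- (k * x)) in n0.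
have dV : is_derive z 1 (fun y : R => y^-1) (- z ^- 2).
  by apply: (is_derive_eq (@is_deriveV _ id z 1 1 n0 (is_derive_id _ _))); rewrite /GRing.scale /= mulr1.
apply: (is_derive_eq (is_derive_fcomp h dV)).
rewrite /dlogistic /logistic -/z (_ : expR (- (k * x)) = z - 1); last by rewrite /z addrC addKr.
by move: z n0 {dV} => z n0; field.
Qed.

Lemma is_derive_dlogistic k x :
  is_derive x 1 (dlogistic k) (k * (1 - 2 * logistic k x) * dlogistic k x).
Proof.
have h := is_derive_logistic k x.
apply: (is_derive_eq (is_derive_fZ k (is_derive_fM h (is_derive_fB (is_derive_fcst x 1) h)))).
ring.
Qed.

Lemma dlogistic_bounds k x : 0 <= k -> 0 <= dlogistic k x <= k.
Proof.
move=> k0; have /andP[a b] := logistic_ge0_le1 k x.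
rewrite mulr_ge0 ?mulr_ge0 ?subr_ge0//= -[leRHS]mulr1 ler_wpM2l//; nra.
Qed.

Lemma logistic_slope k x : 0 <= k -> `|k * (1 - 2 * logistic k x)| <= k.
Proof.
move=> k0; have /andP[a b] := logistic_ge0_le1 k x.
rewrite normrM (ger0_norm k0) -[leRHS]mulr1 ler_wpM2l// ler_norml; apply/andP; split; lra.
Qed.

Lemma continuous_logistic k : continuous (logistic k).
Proof. by move=> x; exact: is_derive_continuous (is_derive_logistic k x). Qed.

Lemma logistic_harnack k x y : 0 <= k -> `|x - y| <= 1 -> logistic k x <= expR k * logistic k y.
Proof.
move=> k0; rewrite ler_norml => /andP[_ xy].
have e1 := expR_gt0 (- (k * x)); have e2 := expR_gt0 (- (k * y)).
rewrite /logistic ler_pdivlMr ?addr_gt0// mulrC ler_pdivrMr ?addr_gt0// mulrDr mulr1 -expRD.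
by apply: lerD; [rewrite -expR0 ler_expR|rewrite ler_expR]; nra.
Qed.

Lemma logistic_ge_half k x : 0 <= k -> 0 <= x -> 2^-1 <= logistic k x.
Proof.
move=> k0 x0; rewrite /logistic lef_pV2 ?posrE ?addr_gt0 ?expR_gt0//.
by rewrite [leRHS](_ : 2 = 1 + 1)// lerD2l -expR0 ler_expR oppr_le0 mulr_ge0.
Qed.

Lemma logistic_le_expR k x : logistic k x <= expR (k * x).
Proof.
have -> : expR (k * x) = (expR (- (k * x)))^-1 by rewrite expRN invrK.
rewrite /logistic lef_pV2 ?posrE ?addr_gt0 ?expR_gt0//.
by rewrite lerDr.
Qed.

Lemma logistic_increasing k x y : 0 <= k -> x <= y -> logistic k x <= logistic k y.
Proof.
move=> k0 xy; rewrite /logistic lef_pV2 ?posrE ?addr_gt0 ?expR_gt0// lerD2l ler_expR lerN2.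
exact: ler_wpM2l.
Qed.

(** At the infimum Ts of the times where n >= th, continuity gives n Ts >= th. Just before Ts the
    bound n <= th has held throughout, so n <= K < th there, and continuity fails. *)
Lemma continuity_argument (n : R -> R) (th K : R) : continuous n -> n 0 < th -> K < th ->
  (forall T, 0 <= T -> (forall t, 0 <= t <= T -> n t <= th) -> n T <= K) ->
  forall T, 0 <= T -> n T < th.
Proof.
move=> cn n0 Kth hK T T0; rewrite ltNge; apply/negP => nT.
pose S : set R := [set t | 0 <= t /\ th <= n t].
have S0 : S !=set0 by exists T.
have lS : has_lbound S by exists 0 => t [].
have iS : has_inf S by [].
set Ts := inf S.
have Ts0 : 0 <= Ts by apply: lb_le_inf => // t [].
have before t : 0 <= t < Ts -> n t < th.
  move=> /andP[t0 tT]; rewrite ltNge; apply/negP => h.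
  by move: tT; rewrite ltNge => /negP; apply; apply: ge_inf.
have nTs : th <= n Ts.
  rewrite leNgt; apply/negP => h; have h' : 0 < th - n Ts by rewrite subr_gt0.
  have /cvgr_dist_lt/(_ _ h')[/= d d0 hd] := cn Ts.
  have [t [t0 nt] tT] := inf_adherent d0 iS.
  have tTs : Ts <= t by apply: ge_inf.
  have := hd t; rewrite /ball_ /= distrC ger0_norm ?subr_ge0// => /(_ _).
  rewrite ltrBlDl => /(_ tT); have := ler_norm (n t - n Ts); rewrite distrC => h1 h2.
  by move: nt; rewrite leNgt => /negP; apply; lra.
have Tsp : 0 < Ts.
  by rewrite lt_neqAle Ts0 andbT; apply/eqP => h; move: nTs; rewrite -h leNgt n0.
have g0 : 0 < th - K by rewrite subr_gt0.
have /cvgr_dist_lt/(_ _ g0)[/= d d0 hd] := cn Ts.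
pose t := Num.max 0 (Ts - d / 2).
have t0 : 0 <= t by rewrite le_max lexx.
have tT : t < Ts by rewrite gt_max Tsp /=; lra.
have td : Ts - d / 2 <= t by rewrite le_max lexx orbT.
have nt : n t <= K.
  apply: hK => // s /andP[s0 st]; apply/ltW/before; rewrite s0; exact: le_lt_trans tT.
have := hd t; rewrite /ball_ /= ger0_norm ?subr_ge0 ?(ltW tT)// => /(_ _).
have h1 : Ts - t < d by lra.
by move=> /(_ h1); have := ler_norm (n Ts - n t) => h2 h3; lra.
Qed.

End logistic.

(** * Smallness for all times and decay outside the cone *)

Section decay.
Context {R : realType}.
Local Notation mu := (@lebesgue_measure R).
Implicit Types (x y z s t d H k : R) (f g : R -> R) (u eta : R -> R -> R).

Lemma left_of_cone x d T : x < - ((2 + d) * T) -> 0 <= -1 * x - (2 * T + d * T).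
Proof. by move=> h; lra. Qed.

Lemma right_of_cone x d T : (2 + d) * T < x -> 0 <= 1 * x - (2 * T + d * T).
Proof. by move=> h; lra. Qed.

Lemma half_mul_le x y : 2^-1 <= x -> 0 <= y -> 1 <= 2 * (x + y).
Proof. by move=> h1 h2; lra. Qed.

Lemma le_of_sqr_le x y : 0 <= x -> 0 <= y -> x ^+ 2 <= y ^+ 2 -> x <= y.
Proof. by move=> x0 y0; rewrite ler_pXn2r. Qed.

Lemma sqr_H1xH1_norm f g : H1xH1_norm setT f g ^+ 2 = \int[mu]_x quad f g x.
Proof. by rewrite sqr_sqrtr//; apply: Rintegral_ge0 => x _; exact: quad_ge0. Qed.

Lemma H1xH1_norm_ge0 (I : set R) f g : 0 <= H1xH1_norm I f g.
Proof. exact: sqrtr_ge0. Qed.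

(** Each of the two norms in [small_H1] then contributes at most 1/256. *)
Definition small_norm : R := (256 * sup_cst)^-1.

Lemma small_norm_gt0 : 0 < small_norm.
Proof. by rewrite invr_gt0 mulr_gt0 ?ltr0n// ltr_pwDl ?L2norm_ge0. Qed.

Lemma small_H1_of_norm f g : H1 f -> H1 g -> H1xH1_norm setT f g <= small_norm ->
  small_H1 f (wderiv f) /\ small_H1 g (wderiv g).
Proof.
move=> hf hg hn.
have [sf sf'] := H1_sqintegrable hf; have [sg sg'] := H1_sqintegrable hg.
have s0 : 0 < sup_cst :> R by rewrite ltr_pwDl ?L2norm_ge0.
have bnd h : sqintegrable h -> (forall x, h x ^+ 2 <= quad f g x) -> sup_cst * L2norm h <= 256^-1.
  move=> sh hh; have h1 := le_trans (le_H1xH1_norm hf hg sh hh) hn.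
  by rewrite mulrC -ler_pdivlMr// -invfM.
have sub x : [/\ f x ^+ 2 <= quad f g x, wderiv f x ^+ 2 <= quad f g x,
    g x ^+ 2 <= quad f g x & wderiv g x ^+ 2 <= quad f g x].
  have := sqr_ge0 (f x); have := sqr_ge0 (wderiv f x).
  have := sqr_ge0 (g x); have := sqr_ge0 (wderiv g x); rewrite /quad.
  by split; lra.
have b1 : sup_cst * L2norm f <= 256^-1 by apply: bnd => // x; case: (sub x).
have b2 : sup_cst * L2norm (wderiv f) <= 256^-1 by apply: bnd => // x; case: (sub x).
have b3 : sup_cst * L2norm g <= 256^-1 by apply: bnd => // x; case: (sub x).
have b4 : sup_cst * L2norm (wderiv g) <= 256^-1 by apply: bnd => // x; case: (sub x).
have e : 256^-1 + 256^-1 <= 128^-1 :> R by clear; lra.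
by split; rewrite /small_H1 mulrDr; [exact: (le_trans (lerD b1 b2) e)|exact: (le_trans (lerD b3 b4) e)].
Qed.

Lemma H1xH1_norm_continuous u eta : C_H1xH1 u eta ->
  continuous (fun t => H1xH1_norm setT (u t) (eta t)).
Proof.
move=> hC t; have [[c1 c2 _] [c3 c4 _]] := C_H1xH1_curve hC.
have [hH _] := hC.
have e1 s : H1xH1_norm setT (u s) (eta s) = Num.sqrt (L2norm (u s) ^+ 2 +
    L2norm (wderiv (u s)) ^+ 2 + L2norm (eta s) ^+ 2 + L2norm (wderiv (eta s)) ^+ 2).
  have [hu he] := hH s; have [[_ i1] [_ i2]] := H1_sqintegrable hu.
  have [[_ i3] [_ i4]] := H1_sqintegrable he; 
  have k := f_equal2 +%R (f_equal2 +%R (f_equal2 +%R (sqr_L2norm (u s))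
    (sqr_L2norm (wderiv (u s)))) (sqr_L2norm (eta s))) (sqr_L2norm (wderiv (eta s))).
  have i12 := integrableRD i1 i2; have i123 := integrableRD i12 i3.
  rewrite k /H1xH1_norm -(RintegralD measurableT i1 i2) -(RintegralD measurableT i12 i3).
  by rewrite -(RintegralD measurableT i123 i4).
have -> : (fun s => H1xH1_norm setT (u s) (eta s)) = fun s => Num.sqrt (L2norm (u s) ^+ 2 +
    L2norm (wderiv (u s)) ^+ 2 + L2norm (eta s) ^+ 2 + L2norm (wderiv (eta s)) ^+ 2).
  exact/funext.
apply: continuous_comp; last exact: sqrt_continuous.
have sq (V : R -> R -> R) : L2curve V -> L2norm (V s) ^+ 2 @[s --> t] --> L2norm (V t) ^+ 2.
  move=> cV; have h := L2curve_norm (t := t) cV; exact: (cvgM h h).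
by apply: cvgD; [apply: cvgD; [apply: cvgD|]|]; exact: sq.
Qed.

(** Along integers T the weight is at most exp (k s x) exp (-k d)^T, which tends to 0 at every x,
    and f dominates. Monotonicity in T extends the bound to real T. *)
Lemma logistic_tail k d s f : 0 < k -> 0 < d -> integrableR f -> (forall x, 0 <= f x) ->
  forall e : R, 0 < e -> exists M, forall T, M <= T ->
    \int[mu]_x (logistic k (s * x - d * T) * f x) < e.
Proof.
move=> k0 d0 iF f0 e e0; have mf := integrableR_measurable iF.
have ml c : measurable_fun setT (fun x => logistic k (s * x - c)).
  apply: continuous_measurable_fun => x.
  exact: is_derive_continuous (@is_derive_comp_affine _ (logistic k) x s (- c) _ (is_derive_logistic _ _)).
have il c : integrableR (fun x => logistic k (s * x - c) * f x).
  apply: (integrableR_bounded (M := 1)) => // x.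
  by have /andP[a b] := logistic_ge0_le1 k (s * x - c); rewrite ger0_norm.
have cv : (\int[mu]_x (logistic k (s * x - d * n%:R) * f x)) @[n --> \oo] --> (0 : R).
  have -> : (0 : R) = \int[mu]_(x in setT) (cst 0 x).
    by rewrite Rintegral_cst ?mul0r.
  apply: (@integral_dominated_cvg _ _ _ f) => //.
  - by move=> n; exact: integrableR_measurable (il _).
  - apply: aeW => x /=; rewrite -[X in _ --> X](mul0r (f x)).
    apply: cvgM; last exact: cvg_cst.
    have hexp : expR (k * (s * x)) * expR (- (k * d)) ^+ n @[n --> \oo] --> (0 : R).
      rewrite -[X in _ --> X](mulr0 (expR (k * (s * x)))); apply: cvgM; first exact: cvg_cst.
      apply: cvg_expr; rewrite ger0_norm ?expR_ge0// -[ltRHS]expR0 ltr_expR oppr_lt0.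
      exact: mulr_gt0.
    apply: (squeeze_cvgr _ (cvg_cst 0) hexp); apply: nearW => n.
    have /andP[l0 _] := logistic_ge0_le1 k (s * x - d * n%:R); rewrite l0 /=.
    apply: (le_trans (logistic_le_expR _ _)); rewrite -expRM_natr -expRD ler_expR.
    by rewrite le_eqVlt; apply/orP; left; apply/eqP; ring.
  - move=> n x; have /andP[l0 l1] := logistic_ge0_le1 k (s * x - d * n%:R).
    by rewrite normrM (ger0_norm l0) (ger0_norm (f0 x)) ler_piMl.
have /cvgr_lt/(_ _ e0)[N _ hN] := cv.
exists N%:R => T NT; apply: le_lt_trans (hN N (leqnn N)).
apply: le_integral_integrableR => // x; rewrite ler_wpM2r//.
by apply: logistic_increasing; [exact: ltW|rewrite lerD2l lerN2 ler_wpM2l// ltW].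
Qed.

Variables (a b c : R).
Hypothesis abc : abcd_conditions a b c.
Let be := Num.sqrt b.
Let A := - a / b.
Let C := - c / b.

Let b0 : 0 < b. Proof. by case: abc. Qed.
Let be0 : 0 < be. Proof. by rewrite sqrtr_gt0. Qed.
Let be2 : be ^+ 2 = b. Proof. by rewrite sqr_sqrtr// ltW. Qed.
Let A0 : 0 < A. Proof. by case: abc => _ a0 _ _; rewrite divr_gt0// oppr_gt0. Qed.
Let C0 : 0 < C. Proof. by case: abc => _ _ c0 _; rewrite divr_gt0// oppr_gt0. Qed.
Let AC2 : A + C <= 2.
Proof.
(* Adding the two relations eliminates theta: a + c + 2 b = 1/3. *)
case: abc => b0' _ _ [th [_ h1 h2]]; rewrite -mulrDl ler_pdivrMr//.
by move: h1 h2; move: (th ^+ 2) => w; lra.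
Qed.
Let aE : - A * be ^+ 2 = a. Proof. by rewrite be2 /A; field; rewrite gt_eqF. Qed.
Let cE : - C * be ^+ 2 = c. Proof. by rewrite be2 /C; field; rewrite gt_eqF. Qed.

(** The ratio of the upper and lower constants of the energy density, times the Harnack constant of
    the weight. *)
Let Kw H := (coercivity be A C)^-1 * ((1 + be ^+ 2) * H).

Let Kw0 H : 0 <= H -> 0 <= Kw H.
Proof.
by move=> H0; rewrite mulr_ge0 ?invr_ge0 ?(ltW (coercivity_gt0 be0 A0 C0))// mulr_ge0// addr_ge0 ?sqr_ge0.
Qed.

Let small_solution u eta t := H1xH1_norm setT (u t) (eta t) <= small_norm.

Let weighted_solution u eta (chi dchi om : R -> R) (Mw H : R) : abcd_solution a b c u eta ->
  (forall y, is_derive y 1 chi (dchi y)) -> (forall y, is_derive y 1 dchi (om y * dchi y)) ->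
  (forall y, 0 <= chi y <= 1) -> (forall y, 0 <= dchi y <= Mw) ->
  (forall y, be * `|om y| <= 96^-1) -> continuous om -> 0 <= H ->
  (forall x y, `|x - y| <= 1 -> chi x <= H * chi y) ->
  forall s1 s2 c' T, `|s1| = 1 -> `|s2| = 1 -> 0 <= T ->
  (forall t, 0 <= s2 * t <= T -> small_solution u eta t) ->
  \int[mu]_x (chi (s1 * x - (2 * T + c')) * quad (u (s2 * T)) (eta (s2 * T)) x) <=
  Kw H * \int[mu]_x (chi (s1 * x - c') * quad (u 0) (eta 0) x).
Proof.
move=> [hC heq] h1 h2 h3 h4 h5 h6 H0 h7 s1 s2 c' T s1E s2E T0 small.
have [cu ce] := C_H1xH1_curve hC; have [hH _] := hC.
have we phi : test_function2 phi -> \int[mu]_t (\int[mu]_x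
      (eta t x * (dt phi t x - be ^+ 2 * dx (dx (dt phi)) t x)
       + (- A * be ^+ 2) * u t x * dx (dx (dx phi)) t x
       + (u t x + u t x * eta t x) * dx phi t x)) = 0.
  by move=> /heq[h _]; rewrite aE be2.
have wu phi : test_function2 phi -> \int[mu]_t (\int[mu]_x
      (u t x * (dt phi t x - be ^+ 2 * dx (dx (dt phi)) t x)
       + (- C * be ^+ 2) * eta t x * dx (dx (dx phi)) t x
       + (eta t x + 2^-1 * u t x ^+ 2) * dx phi t x)) = 0.
  by move=> /heq[_ h]; rewrite cE be2.
have sm t : 0 <= s2 * t <= T -> small_at u (fun t => wderiv (u t)) eta (fun t => wderiv (eta t)) t.
  move=> tT; have [hu he] := hH t; have [k1 k2] := small_H1_of_norm hu he (small t tT).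
  by split.
have := weighted_energy be0 A0 C0 AC2 cu ce we wu h1 h2 h3 h4 h5 h6 H0 h7 c' s1E s2E T0 sm.
have s2s2 : s2 * s2 = 1 by rewrite -expr2 -(real_normK (num_real s2)) s2E expr1n.
have eT : - 2 * s2 * (s2 * T) - c' = - (2 * T + c').
  by rewrite mulrA -[- 2 * s2 * s2]mulrA s2s2; ring.
have e0 : - 2 * s2 * 0 - c' = - c' by rewrite mulr0 sub0r.
rewrite eT e0 mulrA => h; rewrite /Kw -mulrA ler_pdivlMl ?coercivity_gt0//.
Qed.

Let solution_small : exists2 eps0 : R, 0 < eps0 & forall u eta, abcd_solution a b c u eta ->
  H1xH1_norm setT (u 0) (eta 0) < eps0 -> forall t, small_solution u eta t.
Proof.
pose K1 := Num.sqrt (Kw 1); have K10 : 0 <= K1 by exact: sqrtr_ge0.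
have K11 : 0 < 1 + K1 by rewrite ltr_pwDl.
(* The divisor makes both n 0 and K1 n 0 smaller than [small_norm], the two strict inequalities that
   [continuity_argument] asks for. *)
exists (small_norm / (1 + K1)); first by rewrite divr_gt0// small_norm_gt0.
move=> u eta sol n0 t; pose s2 : R := if 0 <= t then 1 else -1.
have s2E : `|s2| = 1 by rewrite /s2; case: ifP; rewrite ?normrN normr1.
have s2s2 : s2 * s2 = 1 by rewrite -expr2 -(real_normK (num_real s2)) s2E expr1n.
have tE : t = s2 * `|t|.
  rewrite /s2; have [t0|t0] := leP 0 t; first by rewrite ger0_norm// mul1r.
  by rewrite ltr0_norm// mulN1r opprK.
pose n t' := H1xH1_norm setT (u (s2 * t')) (eta (s2 * t')).
have [hC _] := sol; have [hH _] := hC.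
have cn : continuous n.
  move=> t'; have h : {for t', continuous (fun y => s2 * y)}.
    by apply: continuousM; [exact: cst_continuous|exact: id].
  exact: (continuous_comp h (@H1xH1_norm_continuous u eta hC (s2 * t'))).
have n00 : n 0 = H1xH1_norm setT (u 0) (eta 0) by rewrite /n mulr0.
have n1 : n 0 * (1 + K1) < small_norm by rewrite n00 -ltr_pdivlMr.
have nge0 t' : 0 <= n t' by exact: H1xH1_norm_ge0.
have nK : 0 <= n 0 * K1 by rewrite mulr_ge0.
have lt1 : n 0 < small_norm.
  by move: n1; rewrite mulrDr mulr1 => h; apply: le_lt_trans h; rewrite lerDl.
have lt2 : K1 * n 0 < small_norm.
  by move: n1; rewrite mulrDr mulr1 mulrC => h; apply: le_lt_trans h; rewrite mulrC lerDr.
suff step T : 0 <= T -> (forall t', 0 <= t' <= T -> n t' <= small_norm) -> n T <= K1 * n 0.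
  have := continuity_argument cn lt1 lt2 step (normr_ge0 t).
  by rewrite /n -tE => /ltW.
move=> T0 hT.
have sm t' : 0 <= s2 * t' <= T -> small_solution u eta t'.
  by move=> h; have := hT _ h; rewrite /n mulrA s2s2 mul1r.
have d1 y : is_derive y 1 (fun _ : R => 1 : R) ((fun=> 0 : R) y) by exact: is_derive_fcst.
have d2 y : is_derive y 1 (fun _ : R => 0 : R) ((fun=> 0 : R) y * (fun=> 0 : R) y).
  by rewrite mulr0; exact: is_derive_fcst.
have c01 (y : R) : 0 <= (fun=> 1 : R) y <= 1 by rewrite ler01 lexx.
have c00 (y : R) : 0 <= (fun=> 0 : R) y <= 0 by rewrite lexx.
have com (y : R) : be * `|(fun=> 0 : R) y| <= 96^-1 by rewrite normr0 mulr0 invr_ge0 ler0n.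
have cc : continuous (fun _ : R => 0 : R) by exact: continuous_fcst.
have har (x y : R) : `|x - y| <= 1 -> (fun=> 1 : R) x <= 1 * (fun=> 1 : R) y by rewrite mul1r.
have := weighted_solution sol d1 d2 c01 c00 com cc ler01 har 0 (normr1 R) s2E T0 sm.
under eq_Rintegral do rewrite mul1r.
under [X in _ <= _ * X]eq_Rintegral do rewrite mul1r.
rewrite -!sqr_H1xH1_norm -n00 -/(n T) => h.
have hh : n T ^+ 2 <= (K1 * n 0) ^+ 2 by rewrite exprMn (sqr_sqrtr (Kw0 ler01)).
exact: (le_of_sqr_le (nge0 T) (mulr_ge0 K10 (nge0 0)) hh).
Qed.

Let decay_half u eta s2 eps delta : abcd_solution a b c u eta -> `|s2| = 1 ->
  (forall t, small_solution u eta t) -> 0 < eps -> 0 < delta ->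
  forall e : R, 0 < e -> exists M, forall T, M <= T ->
    H1xH1_norm (exterior (2 + eps) (2 + delta) (s2 * T)) (u (s2 * T)) (eta (s2 * T)) < e.
Proof.
move=> sol s2E small eps0 delta0 e e0; have [[hH _] _] := sol.
(* The largest slope compatible with the condition that be |om| be at most 1/96. *)
pose k := (96 * be)^-1; have k0 : 0 < k by rewrite invr_gt0 mulr_gt0 ?ltr0n.
have q0 t x := quad_ge0 (u t) (eta t) x.
have qi t : integrableR (quad (u t) (eta t)) by case: (hH t) => hu he; exact: quad_integrable.
have com y : be * `|k * (1 - 2 * logistic k y)| <= 96^-1.
  have -> : 96^-1 = be * k by rewrite /k invfM mulrCA divff ?mulr1// gt_eqF.
  by rewrite ler_wpM2l ?(ltW be0)// logistic_slope// ltW.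
have cc : continuous (fun y => k * (1 - 2 * logistic k y)).
  have cl := @continuous_logistic R k; continuous_tac.
have W := weighted_solution sol (is_derive_logistic k) (is_derive_dlogistic k)
  (logistic_ge0_le1 k) (fun y => dlogistic_bounds y (ltW k0)) com cc (expR_ge0 k)
  (fun x y => @logistic_harnack R k x y (ltW k0)).
(* The summand 1 only keeps the divisor positive. *)
pose Kd := 2 * Kw (expR k) + 1.
have Kd0 : 0 < Kd by rewrite ltr_pwDr// mulr_ge0// Kw0// expR_ge0.
have e2 : 0 < e ^+ 2 / (2 * Kd) by rewrite divr_gt0 ?exprn_gt0 ?mulr_gt0.
have [M1 hM1] := @logistic_tail k delta 1 _ k0 delta0 (qi 0) (q0 0) _ e2.
have [M2 hM2] := @logistic_tail k eps (-1) _ k0 eps0 (qi 0) (q0 0) _ e2.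
exists (Num.max 0 (Num.max M1 M2)) => T; rewrite !ge_max => /and3P[T0 /hM1 F1 /hM2 F2].
(* The shift depends on the final time: the front is at (2 + delta) T in the end and at delta T
   initially. The case of the left half-line uses the reflected weight and eps. *)
have W1 := W 1 s2 (delta * T) T (normr1 R) s2E T0 (fun t _ => small t).
have nN1 : `|-1 : R| = 1 by rewrite normrN1.
have W2 := W (-1) s2 (eps * T) T nN1 s2E T0 (fun t _ => small t).
set t := s2 * T in W1 W2 *.
have tT : `|t| = T by rewrite normrM s2E mul1r ger0_norm.
set I := exterior _ _ _.
have mI : measurable I by apply: measurableU; exact: measurable_itv.
pose p1 x := logistic k (1 * x - (2 * T + delta * T)).
pose p2 x := logistic k (-1 * x - (2 * T + eps * T)).
have il s c' : integrableR (fun x => logistic k (s * x - c') * quad (u t) (eta t) x).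
  apply: (integrableR_bounded (M := 1)) => //.
    apply: continuous_measurable_fun => x.
    exact: is_derive_continuous (@is_derive_comp_affine _ (logistic k) x s (- c') _ (is_derive_logistic _ _)).
  by move=> x; have /andP[l0 l1] := logistic_ge0_le1 k (s * x - c'); rewrite ger0_norm.
have mq : mu.-integrable I (EFin \o quad (u t) (eta t)) by exact: integrableS (qi t).
have i1 := il 1 (2 * T + delta * T); have i2 := il (-1) (2 * T + eps * T).
have ipq : integrableR (fun x => 2 * (p1 x * quad (u t) (eta t) x + p2 x * quad (u t) (eta t) x)).
  exact: (integrableRZ 2 (integrableRD i1 i2)).
have key : \int[mu]_(x in I) quad (u t) (eta t) x <=
    2 * (\int[mu]_x (p1 x * quad (u t) (eta t) x) + \int[mu]_x (p2 x * quad (u t) (eta t) x)).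
  rewrite -(RintegralD measurableT i1 i2) -(RintegralZl 2 measurableT (integrableRD i1 i2)).
  rewrite Rintegral_mkcond; apply: le_integral_integrableR => //.
    move: mq; rewrite integrable_mkcond//; congr integrable.
    by apply/funext => x; rewrite /= /patch; case: ifP.
  move=> x; have Q := q0 t x; have l1 := logistic_gt0 k (1 * x - (2 * T + delta * T)).
  have l2 := logistic_gt0 k (-1 * x - (2 * T + eps * T)).
  rewrite patchE; case: ifPn => [/set_mem|_]; last first.
    by rewrite mulr_ge0// addr_ge0// mulr_ge0// ltW.
  rewrite -mulrDl mulrA -[leLHS]mul1r => xI; apply: ler_wpM2r => //.
  have [h|h] : 2^-1 <= p1 x \/ 2^-1 <= p2 x.
  - case: xI; rewrite /= in_itv /= tT ?andbT => h; [right|left].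
      exact: (logistic_ge_half (ltW k0) (left_of_cone h)).
    exact: (logistic_ge_half (ltW k0) (right_of_cone h)).
  - exact: (half_mul_le h (ltW l2)).
  - by rewrite addrC; exact: (half_mul_le h (ltW l1)).
rewrite -[ltRHS]ger0_norm ?(ltW e0)// -sqrtr_sqr ltr_sqrt ?exprn_gt0//.
apply: (le_lt_trans key).
have h : 2 * (Kw (expR k) * (\int[mu]_x (logistic k (1 * x - delta * T) * quad (u 0) (eta 0) x)) +
  Kw (expR k) * (\int[mu]_x (logistic k (-1 * x - eps * T) * quad (u 0) (eta 0) x))) < e ^+ 2.
  rewrite -mulrDr mulrA; have F12 := ltrD F1 F2.
  have Fs0 s c' : 0 <= \int[mu]_x (logistic k (s * x - c') * quad (u 0) (eta 0) x).
    apply: Rintegral_ge0 => x _; apply: mulr_ge0 => //.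
    by have /andP[] := logistic_ge0_le1 k (s * x - c').
  have {}Fs0 := addr_ge0 (Fs0 1 (delta * T)) (Fs0 (-1) (eps * T)).
  move: F12 Fs0; set S := (X in X < _) => F12 Fs0.
  apply: (@le_lt_trans _ _ (Kd * S)); first by rewrite ler_wpM2r// /Kd lerDl.
  rewrite mulrC -ltr_pdivlMr//; apply: (lt_le_trans F12).
  by rewrite le_eqVlt; apply/orP; left; apply/eqP; field; rewrite gt_eqF.
exact: (le_lt_trans (ler_wpM2l (ler0n _ 2) (lerD W1 W2)) h).
Qed.

Lemma exterior_decay_two : exterior_decay a b c 2.
Proof.
move=> eps delta eps_gt0 delta_gt0; have [e0 e00 small] := solution_small.
exists e0; split=> // u eta sol /(small _ _ sol) sm.
have d1 := decay_half sol (normr1 R) sm eps_gt0 delta_gt0.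
have d2 := decay_half sol (normrN1 R) sm eps_gt0 delta_gt0.
split; apply/cvgr0Pnorm_lt => e e_gt0.
  have [M hM] := d1 e e_gt0; near=> t.
  have := hM t; rewrite mul1r ger0_norm ?H1xH1_norm_ge0//; apply.
  by near: t; apply: nbhs_pinfty_ge; rewrite num_real.
have [M hM] := d2 e e_gt0; near=> t.
have := hM (- t); rewrite mulN1r opprK ger0_norm ?H1xH1_norm_ge0//; apply.
by rewrite lerNr; near: t; apply: nbhs_ninfty_le; rewrite num_real.
Unshelve. all: by end_near. Qed.

End decay.

(** * Absence of small solitary waves *)

Section solitary_waves.
Context {R : realType}.
Local Notation mu := (@lebesgue_measure R).
Implicit Types (a b c s v w x y t : R) (f U N : R -> R).

(** Enlarging eps and delta by w - v at speed v describes the same region as speed w. *)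
Lemma exterior_decayW a b c v w : v <= w -> exterior_decay a b c v -> exterior_decay a b c w.
Proof.
move=> vw dec eps delta e0 d0.
have e1 : 0 < eps + (w - v) by rewrite ltr_pwDl// subr_ge0.
have d1 : 0 < delta + (w - v) by rewrite ltr_pwDl// subr_ge0.
have := dec _ _ e1 d1.
have -> : v + (eps + (w - v)) = w + eps by ring.
by have -> : v + (delta + (w - v)) = w + delta by ring.
Qed.

(** A point within n of omega t satisfies |y| >= s t - n, and n < d t leaves more than (s - d) t =
    (2 + d) t. *)
Lemma cone_escape s d n y t omega : 0 < d -> s - 2 - d = d -> s <= `|omega| -> `|y - omega * t| <= n ->
  n / d < t -> (2 + d) * `|t| < `|y|.
Proof.
move=> d0 sd so yn nt; have n0 : 0 <= n by exact: le_trans yn.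
have t0 : 0 < t by apply: le_lt_trans nt; rewrite divr_ge0// ltW.
rewrite (gtr0_norm t0); move: nt; rewrite ltr_pdivrMr// => nt.
have h1 : `|omega| * t <= `|y| + n.
  rewrite -[X in _ * X <= _](gtr0_norm t0) -normrM (_ : omega * t = y - (y - omega * t)); last by ring.
  by apply: (le_trans (ler_normB _ _)); rewrite lerD2l.
have h2 := ler_wpM2r (ltW t0) so.
have e : s = 2 + d + d by lra.
by rewrite e in h2; lra.
Qed.

Lemma integral_eq0_ae f : integrableR f -> (forall x, 0 <= f x) -> \int[mu]_x f x <= 0 ->
  {ae mu, forall x, f x = 0}.
Proof.
move=> iF f0 h; have mf := integrableR_measurable iF.
have e0 : \int[mu]_x f x = 0.
  by apply/eqP; rewrite eq_le h Rintegral_ge0.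
have e1 : (\int[mu]_x `|(f x)%:E| = 0)%E.
  under eq_integral do rewrite abse_EFin ger0_norm//.
  by rewrite -EFin_integral// e0.
have mF : measurable_fun setT (EFin \o f) by exact/measurable_EFinP.
have [/(_ e1) h0 _] := @ae_eq_integral_abs _ _ _ mu setT measurableT (EFin \o f) mF.
by apply: (ae_imp h0) => x /(_ I) [].
Qed.

(** The mass of U^2 + N^2 on a fixed segment [-n, n] is conserved by the translation, and at late
    times it lies in the exterior region. Decay makes it zero for every n. *)
Lemma decay_no_solitary_wave a b c s : 2 < s -> exterior_decay a b c 2 ->
  no_small_solitary_wave a b c s.
Proof.
(* Half of the excess speed opens the cone, and the other half is left for the wave to outrun it. *)
move=> s2 dec; pose d := (s - 2) / 2; have d0 : 0 < d by rewrite divr_gt0// subr_gt0.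
have sd : s - 2 - d = d by rewrite /d; field.
have [eps0 [e0 small]] := dec d d d0 d0; exists eps0; split=> // -[U [N [omega [sol nz so n0]]]].
apply: nz; have [[hH _] _] := sol.
pose f x := U x ^+ 2 + N x ^+ 2.
have f0 x : 0 <= f x by rewrite addr_ge0 ?sqr_ge0.
have U0 : (fun x => U (x - omega * 0)) = U by apply/funext => x; rewrite mulr0 subr0.
have N0 : (fun x => N (x - omega * 0)) = N by apply/funext => x; rewrite mulr0 subr0.
have [hU hN] := hH 0; rewrite U0 in hU; rewrite N0 in hN.
have iF : integrableR f.
  have [[_ i1] _] := H1_sqintegrable hU; have [[_ i2] _] := H1_sqintegrable hN.
  exact: integrableRD.
have small' := small _ _ sol; rewrite /= U0 N0 in small'; have [lim _] := small' n0.
pose h (n : nat) x := \1_(`[- n%:R, n%:R]%classic) x * f x.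
have h0 n x : 0 <= h n x by rewrite mulr_ge0.
have ih n : integrableR (h n).
  have mI : measurable_fun setT (\1_(`[- n%:R, n%:R]%classic) : R -> R).
    by apply: measurable_indic; exact: measurable_itv.
  apply: (integrableR_bounded (M := 1) mI) => //.
  by move=> x; rewrite indicE; case: (x \in _); rewrite ?normr1 ?normr0.
have hn n : \int[mu]_x h n x <= 0.
  rewrite leNgt; apply/negP => hpos.
  have sq0 : 0 < Num.sqrt (\int[mu]_x h n x) by rewrite sqrtr_gt0.
  move/cvgr0Pnorm_lt/(_ _ sq0): lim => -[M [_ hM]].
  (* Later than M for the decay, and later than n / d for [cone_escape]. *)
  pose t := Num.max M (n%:R / d) + 1.
  have Mt : M < t by apply: (@le_lt_trans _ _ (Num.max M (n%:R / d))); rewrite ?le_max ?lexx// ltrDl.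
  have nt : n%:R / d < t.
    by apply: (@le_lt_trans _ _ (Num.max M (n%:R / d))); rewrite ?le_max ?lexx ?orbT// ltrDl.
  have := hM t Mt; rewrite /= ger0_norm ?sqrtr_ge0//.
  apply/negP; rewrite -leNgt; apply: ler_wsqrtr.
  have [hu he] := hH t.
  set I := exterior _ _ _.
  have mI : measurable I by apply: measurableU; exact: measurable_itv.
  rewrite -(integral_shift (- (omega * t)) (ih n)) [leRHS]Rintegral_mkcond.
  have iq := quad_integrable hu he.
  apply: le_integral_integrableR.
  - exact: integrableR_shift.
  - have mq : mu.-integrable I (EFin \o quad (fun x => U (x - omega * t)) (fun x => N (x - omega * t))).
      exact: integrableS iq.
    move: mq; rewrite integrable_mkcond//; congr integrable.
    by apply/funext => x; rewrite /= /patch; case: ifP.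
  move=> x; have q0 := quad_ge0 (fun x => U (x - omega * t)) (fun x => N (x - omega * t)) x.
  rewrite patchE /h indicE; case: (boolP (x - omega * t \in _)) => [/set_mem xn|_]; last first.
    by rewrite mul0r; case: ifP.
  have xI : I x.
    move: xn; rewrite /= in_itv /= -ler_norml => xn.
    have := cone_escape d0 sd so xn nt; rewrite ltr_normr => /orP[hx|hx]; [right|left].
      by rewrite /= in_itv /= hx.
    by rewrite /= in_itv /= ltrNr.
  rewrite mem_set// mul1r /f /quad.
  have := sqr_ge0 (wderiv (fun x => U (x - omega * t)) x).
  have := sqr_ge0 (wderiv (fun x => N (x - omega * t)) x).
  by lra.
have int0 : \int[mu]_x f x <= 0.
  apply: (@integral_le_of_cvg R h f (fun=> 0) 0 ih h0 iF f0).
  - apply: aeW => x; rewrite -[X in _ --> X]mul1r; apply: cvgM; last exact: cvg_cst.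
    apply: cvg_near_cst; near=> n; rewrite indicE mem_set// /= in_itv /= -ler_norml.
    by near: n; exact: nbhs_infty_ger.
  - exact: nearW.
  - exact: cvg_cst.
apply: (ae_imp (integral_eq0_ae iF f0 int0)) => x /eqP.
rewrite paddr_eq0 ?sqr_ge0// => /andP[/eqP hu /eqP hn'].
by split; apply/eqP; rewrite -sqrf_eq0; apply/eqP.
Unshelve. all: by end_near. Qed.

End solitary_waves.

Theorem corollary2p2 (R : realType) (a b c : R) (abc : abcd_conditions a b c) :
  [/\ exterior_decay a b c 3,
      a = c /\ c = 6^-1 - b -> exterior_decay a b c 2,
      forall s : R, 3 < s -> no_small_solitary_wave a b c s &
      a = c -> forall s : R, 2 < s -> no_small_solitary_wave a b c s].
Proof.
have dec := exterior_decay_two abc.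
have le23 : (2 : R) <= 3 by rewrite ler_nat.
split=> [||s s3|_ s s2].
- exact: exterior_decayW le23 dec.
- by [].
- exact: decay_no_solitary_wave (le_lt_trans le23 s3) dec.
- exact: decay_no_solitary_wave s2 dec.
Qed.
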